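(* Let $T:\Lambda\to\Lambda$ be a nonuniformly expanding map with return time $\tau\in L^p(Y)$ for some $p\ge 2$, and let $\mu$ be its associated $T$-invariant probability measure. Fix $d\ge1$. There is a constant $C>0$, depending continuously on $\operatorname{diam}\Lambda$, $C_1$, $\beta$, $\eta$, $p$ and $|\tau|_p$, such that for every $v\in C^\eta(\Lambda,\mathbb{R}^d)$ with $\int_\Lambda v\,d\mu=0$ and all $n\ge1$, \[ \Big|\max_{k\le n}|S_kv|\Big|_{2(p-1)}\le C n^{1/2}\|v\|_\eta,\qquad \Big|\max_{k\le n}|\mathbb{S}_kv|\Big|_{p-1}\le C n\|v\|_\eta^2 , \] where \[ S_kv=\sum_{0\le j<k}v\circ T^j,\qquad \mathbb{S}_kv=\sum_{0\le i<j<k}(v\circ T^i)\otimes(v\circ T^j), \] and $|\cdot|_q$ denotes the $L^q$-norm on $(\Lambda,\mu)$.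
   Context: Nonuniformly expanding maps. Let $(\Lambda,d_\Lambda)$ be a bounded metric space with finite Borel measure $\rho$ and let $T:\Lambda\to\Lambda$ be a nonsingular transformation. Let $Y\subset\Lambda$ be a subset of positive measure and $\alpha$ an at most countable measurable partition of $Y$. Suppose there is an integrable function $\tau:Y\to\mathbb{Z}^+$ (the return time), constant on each $a\in\alpha$ with value $\tau(a)\ge1$, and constants $\beta>1$, $\eta\in(0,1]$, $C_1\ge1$ such that for each $a\in\alpha$: (1) $F=T^\tau$ restricts to a (measure-theoretic) bijection from $a$ onto $Y$; (2) $d_\Lambda(Fx,Fy)\ge\beta d_\Lambda(x,y)$ for all $x,y\in a$; (3) $d_\Lambda(T^\ell x,T^\ell y)\le C_1 d_\Lambda(Fx,Fy)$ for all $x,y\in a$, $0\le\ell<\tau(a)$; (4) $\zeta_0=\frac{d\rho|_Y}{d\rho|_Y\circ F}$ satisfies $|\log\zeta_0(x)-\log\zeta_0(y)|\le C_1 d_\Lambda(Fx,Fy)^\eta$ for all $x,y\in a$. Such a $T$ is called nonuniformly expanding. ($\tau$ need not be the first return time.) There is a unique absolutely continuous $F$-invariant probability measure $\mu_Y$ on $Y$, and $|\tau|_p$ is the $L^p$-norm on $(Y,\mu_Y)$. The Young tower is $\Delta=\{(y,\ell)\in Y\times\mathbb{Z}:0\le\ell\le\tau(y)-1\}$ with $f_\Delta(y,\ell)=(y,\ell+1)$ for $\ell\le\tau(y)-2$ and $f_\Delta(y,\tau(y)-1)=(Fy,0)$; $\pi_\Delta(y,\ell)=T^\ell y$ is a semiconjugacy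 from $f_\Delta$ to $T$; $\mu_\Delta=(\mu_Y\times\text{counting})/\int_Y\tau\,d\mu_Y$ is an ergodic $f_\Delta$-invariant probability measure on $\Delta$; and $\mu=(\pi_\Delta)_*\mu_\Delta$ is an absolutely continuous ergodic $T$-invariant probability measure on $\Lambda$. Notation. $a\otimes b=ab^T$ for $a,b\in\mathbb{R}^d$; $|\cdot|$ on matrices is the Frobenius norm. $\|v\|_\eta=|v|_\infty+|v|_\eta$ with $|v|_\infty=\sup|v|$ and $|v|_\eta=\sup_{x\ne y}|v(x)-v(y)|/d_\Lambda(x,y)^\eta$; $C^\eta(\Lambda,\mathbb{R}^d)$ is the space of $v:\Lambda\to\mathbb{R}^d$ with $\|v\|_\eta<\infty$. *)

(* Defs.v *)
From HB Require Import structures.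
From mathcomp Require Import all_boot all_order all_algebra.
From mathcomp Require Import all_classical all_reals all_analysis.
Set Implicit Arguments.
Unset Strict Implicit.
Unset Printing Implicit Defensive.
Import Order.TTheory GRing.Theory Num.Theory.
Import numFieldNormedType.Exports.
Local Open Scope classical_set_scope.
Local Open Scope ring_scope.

(* Metric spaces whose measurable sets are exactly the Borel sets. The library
   makes every measurable type pointed, hence nonempty. *)
HB.mixin Record isBorelMetric (disp : measure_display) (R : realType) T
    & Measurable disp T & Metric R T := {
  measurable_borel : @measurable disp T = <<s @open T >>
}.

#[short(type="borelMetricType")]
HB.structure Definition BorelMetric (disp : measure_display) (R : realType) :=
  { T of Measurable disp T & Metric R T & isBorelMetric disp R T }.

Definition bounded_space (R : realType) (L : metricType R) : Prop :=
  exists M : R, forall x y : L, mdist x y <= M.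

Definition diameter (R : realType) (L : metricType R) : R :=
  sup [set r | exists x y : L, r = mdist x y].

Definition induced_map (L : Type) (T : L -> L) (tau : L -> nat) (y : L) : L :=
  iter (tau y) T y.

Section NonuniformlyExpanding.
Context (disp : measure_display) (R : realType) (L : borelMetricType disp R).
Variable rho : {measure set L -> \bar R}.
Local Open Scope ereal_scope.

Definition nonsingular (T : L -> L) : Prop :=
  measurable_fun setT T /\ pushforward rho T `<< rho.

(* G is a bijection from A onto B up to rho-null sets, with measurable inverse:
   it is one from A' onto B', which have full measure in A and in B. *)
Definition mt_bijection (G : L -> L) (A B A' B' : set L) : Prop :=
  [/\ measurable A' /\ measurable B',
      A' `<=` A /\ B' `<=` B,
      rho (A `\` A') = 0 /\ rho (B `\` B') = 0,
      set_bij A' B' G &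
      forall E, measurable E -> E `<=` A' -> measurable (G @` E)].

(* zeta is a version, on a, of the Radon-Nikodym derivative of rho with respect
   to nu = rho \o G, that is nu E = rho (G @` E), where G is a bijection on the
   subset a' of full measure in a. *)
Definition is_jacobian (G : L -> L) (a a' : set L) (zeta : L -> R) : Prop :=
  exists nu : {measure set L -> \bar R},
    (forall E, measurable E -> nu E = rho (G @` (E `&` a'))) /\
    (forall E, measurable E -> E `<=` a ->
       rho E = \int[nu]_(x in E) (zeta x)%:E).

Definition log_holder (G : L -> L) (a : set L) (C1 eta : R) (zeta : L -> R) :
    Prop :=
  forall x y, a x -> a y ->
    (`|ln (zeta x) - ln (zeta y)| <= C1 * mdist (G x) (G y) `^ eta)%R.

(* tau is a total function of which only the values on Y matter. *)
Record nonuniformly_expanding (T : L -> L) (Y : set L) (alpha : set (set L))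
    (tau : L -> nat) (beta eta C1 : R) : Prop := {
  nue_bounded : bounded_space L ;
  nue_nonsingular : nonsingular T ;
  nue_measurable_base : measurable Y ;
  nue_base_gt0 : 0 < rho Y ;
  nue_countable : countable alpha ;
  nue_partition : partition alpha id Y ;
  nue_measurable_partition : forall a, alpha a -> measurable a ;
  nue_tau_ge1 : forall y, Y y -> (1 <= tau y)%N ;
  nue_tau_cst : forall a, alpha a ->
    forall x y, a x -> a y -> tau x = tau y ;
  nue_tau_integrable : rho.-integrable Y (fun y => (tau y)%:R%:E) ;
  nue_beta : (1 < beta)%R ;
  nue_eta : (0 < eta <= 1)%R ;
  nue_C1 : (1 <= C1)%R ;
  nue_expanding : forall a, alpha a -> forall x y, a x -> a y ->
    (beta * mdist x y <= mdist (induced_map T tau x) (induced_map T tau y))%R ;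
  nue_backward : forall a, alpha a -> forall x y, a x -> a y ->
    forall l, (l < tau x)%N ->
    (mdist (iter l T x) (iter l T y)
       <= C1 * mdist (induced_map T tau x) (induced_map T tau y))%R ;
  nue_full_branch_distortion : forall a, alpha a ->
    exists a' Y' : set L, mt_bijection (induced_map T tau) a Y a' Y' /\
    exists zeta : L -> R,
      [/\ measurable_fun a zeta,
          forall x, a x -> (0 < zeta x)%R,
          is_jacobian (induced_map T tau) a a' zeta &
          log_holder (induced_map T tau) a C1 eta zeta]
}.

(* Measures on Y are represented by measures on L which give full mass to Y. *)
Definition is_acip (Y : set L) (F : L -> L) (muY : {measure set L -> \bar R}) :
    Prop :=
  [/\ muY Y = 1, muY setT = 1, muY `<< rho &
      forall B, measurable B -> muY (Y `&` F @^-1` B) = muY B].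

End NonuniformlyExpanding.

Section Tower.
Context (disp : measure_display) (R : realType) (L : measurableType disp).
Local Open Scope ereal_scope.

Definition tower (Y : set L) (tau : L -> nat) : set (L * nat) :=
  [set yl | Y yl.1 /\ (yl.2 < tau yl.1)%N].

Definition tower_proj (T : L -> L) (yl : L * nat) : L := iter yl.2 T yl.1.

Definition tower_measure (Y : set L) (tau : L -> nat)
    (muY : {measure set L -> \bar R}) (A : set (L * nat)) : \bar R :=
  (muY \x counting) (A `&` tower Y tau) / \int[muY]_(y in Y) (tau y)%:R%:E.

Definition return_time_norm (Y : set L) (tau : L -> nat)
    (muY : {measure set L -> \bar R}) (p : R) : \bar R :=
  'N[muY]_(p%:E)[(fun y => (tau y)%:R%:E) \_ Y].

End Tower.

Definition frobenius (R : realType) (m n : nat) (A : 'M[R]_(m, n)) : R :=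
  Num.sqrt (\sum_i \sum_j A i j ^+ 2).

Definition outer (R : realType) (d : nat) (a b : 'cV[R]_d) : 'M[R]_d :=
  a *m b^T.

Section HolderNorm.
Context (R : realType) (L : metricType R) (d : nat).
Local Open Scope ereal_scope.

Definition sup_norm (v : L -> 'cV[R]_d) : \bar R :=
  ereal_sup [set (frobenius (v x))%:E | x in setT].

(* The maximum with 0 matters only if L is a single point: the library's
   supremum of the empty set is -oo. *)
Definition holder_seminorm (eta : R) (v : L -> 'cV[R]_d) : \bar R :=
  Order.max 0 (ereal_sup [set r | exists x y : L, x != y /\
    r = (frobenius (v x - v y)%R / mdist x y `^ eta)%:E]).

Definition holder_norm (eta : R) (v : L -> 'cV[R]_d) : \bar R :=
  sup_norm v + holder_seminorm eta v.

End HolderNorm.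

Definition birkhoff_sum (R : realType) (L : Type) (d : nat) (T : L -> L)
    (v : L -> 'cV[R]_d) (k : nat) (x : L) : 'cV[R]_d :=
  \sum_(j < k) v (iter j T x).

Definition iterated_sum (R : realType) (L : Type) (d : nat) (T : L -> L)
    (v : L -> 'cV[R]_d) (k : nat) (x : L) : 'M[R]_d :=
  \sum_(j < k) \sum_(i < j) outer (v (iter i T x)) (v (iter j T x)).

(* Admissible values of (diam L, C1, beta, eta, p, |tau|_p). *)
Definition param_domain (R : realType) : set (R * R * R * R * R * R) :=
  [set z | let: (D, C1, beta, eta, p, t) := z in
    [/\ 0 <= D, 1 <= C1, 1 < beta, 0 < eta <= 1 & 2 <= p /\ 1 <= t]].

(* Main.v *)
(* Write [f] for the tower map, [P] for its invariant probability, [u] for the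
   lifted observable and [S m] for its ergodic sums. All moments come from one
   estimate: for bounded [g] and [m <= n],
     |E (g o f^m * S m)| <= E (|g| * c)
   where [c] is a multiple of the height in the tower (truncated at [n]), so
   that [E (c^(p-1))] is controlled by the moment of order [p] of [tau].

   From the estimate to the moments: read backwards in time, [S] is a process
   to which the pathwise (deterministic) form of Doob's inequality applies. It
   bounds the power of the maximum by a discrete stochastic integral against
   [u]. Summation by parts turns the expectation of that integral into terms
   [E (g o f^m * S m)], which the estimate bounds, and Young's inequality
   absorbs them. The iterated sums are treated as transforms of [S] by
   normalized multipliers. No martingale decomposition is needed.

   For the estimate, [u] is cohomologous to a function [W] supported by the top
   of the tower, with values the block sums [V] of mean zero, and the
   correlations of [V] with [h o F^n] decay exponentially. This decay is proved
   by coupling: [F] contracts the log-Hoelder constants of densities, so a fixed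
   proportion of the invariant measure can be subtracted at each step. To avoid
   transfer operators and null sets, densities are replaced by set functions
   [s] with [s E1 * lam E2 <= exp (K t^eta) * lam E1 * s E2] whenever [E1] and
   [E2] are within distance [t]. *)

Require Import Defs.
From HB Require Import structures.
From mathcomp Require Import all_boot all_order all_algebra.
From mathcomp Require Import all_classical all_reals all_analysis.
From mathcomp Require Import measurable_realfun.
From mathcomp Require Import zify ring lra.
Set Implicit Arguments.
Unset Strict Implicit.
Unset Printing Implicit Defensive.
Import Order.TTheory GRing.Theory Num.Theory.
Import numFieldNormedType.Exports.
Local Open Scope classical_set_scope.
Local Open Scope ring_scope.

(** * Pathwise inequalities *)

(** The exponents [p - 1] and [2 * (p - 1)] have two sources. A column of the tower has as many
    levels as its return time, so a cost of the size of the height keeps on the tower only the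
    moment of order [q = p - 1]. In the pathwise inequality of order [r = 2 * q] the integrand has
    degree [r - 1] in the maximum and its increments, which are all that summation by parts retains,
    have degree [r - 2]. The sum of the costs therefore enters with the complementary degree 2, and
    Young's inequality produces its power [r / 2 = q], exactly the moment at hand.

    The estimate must be uniform in [m] although the sums have length [m]. On the base, what grows
    with [m] is used only through its difference with its composition by [F], in which everything
    cancels except the two ends of an orbit segment. At most [tau] return times are compatible with
    an end, and weighting them by the height calls for the second moment of [tau], hence for
    [p >= 2].

    Every constant is an explicit formula in the parameters, so that continuity can be checked term
    by term. *)

Section RealPowers.
Context {R : realType}.
Implicit Types x y s t r Q : R.

(** Convexity of the power, obtained from Young's inequality with the conjugate exponents [s] and
    [s / (s - 1)]; the case [s = 1] is treated apart. *)
Lemma powR_tangent s x y : 1 <= s -> 0 <= x -> 0 <= y ->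
  x `^ s - y `^ s <= s * x `^ (s - 1) * (x - y).
Proof.
move=> s1 x0 y0; have s0 : 0 < s by lra.
have [s_eq1|sn1] := eqVneq s 1.
  by rewrite s_eq1 subrr powRr0 !powRr1// !mul1r.
have s1' : 0 < s - 1 by rewrite subr_gt0 lt_neqAle eq_sym sn1.
have q0 : 0 < s / (s - 1) by rewrite divr_gt0.
have pq : s^-1 + (s / (s - 1))^-1 = 1.
  by rewrite invf_div; field; rewrite ?gt_eqF// subr_eq0.
have := conjugate_powR y0 (powR_ge0 x (s - 1)) s0 q0 pq.
rewrite -powRrM (_ : (s - 1) * (s / (s - 1)) = s); last by field; rewrite gt_eqF.
rewrite invf_div -(ler_pM2l s0) => h.
have -> : s * x `^ (s - 1) * (x - y) =
  s * (x * x `^ (s - 1)) - s * (y * x `^ (s - 1)) by ring.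
rewrite mulr_powRB1//.
have e : s * (y `^ s / s + x `^ s * ((s - 1) / s)) = y `^ s + (s - 1) * x `^ s.
  by field; rewrite gt_eqF.
by rewrite e in h; lra.
Qed.

Lemma powR_le s x y : 0 <= s -> 0 <= x -> x <= y -> x `^ s <= y `^ s.
Proof.
move=> s0 x0 xy; apply: ge0_ler_powR => //; rewrite nnegrE//.
exact: le_trans xy.
Qed.

Lemma powR_lip s x y Q : 1 <= s -> 0 <= x <= Q -> 0 <= y <= Q ->
  `|x `^ s - y `^ s| <= s * Q `^ (s - 1) * `|x - y|.
Proof.
move=> s1; have s0 : 0 <= s by lra.
wlog xy : x y / y <= x.
  move=> H /andP[x0 xQ] /andP[y0 yQ]; have [/ltW yx|xy] := ltP x y.
    by rewrite distrC (distrC x); apply: H => //; apply/andP.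
  by apply: H => //; apply/andP.
move=> /andP[x0 xQ] /andP[y0 yQ].
rewrite (ger0_norm (x := x - y)) ?subr_ge0//.
rewrite ger0_norm ?subr_ge0 ?powR_le//.
apply: (le_trans (powR_tangent s1 x0 y0)).
rewrite ler_wpM2r ?subr_ge0// ler_wpM2l// powR_le//; lra.
Qed.

(** The odd power: [r * spowR (r - 1)] is the derivative of the [r]-th power of the absolute
    value. *)
Definition spowR s y := if 0 <= y then y `^ s else - (- y) `^ s.

Lemma spowR0 s : s != 0 -> spowR s 0 = 0.
Proof. by move=> s0; rewrite /spowR lexx powR0. Qed.

Lemma normr_spowR s y : `|spowR s y| = `|y| `^ s.
Proof.
rewrite /spowR; case: (leP 0 y) => y0.
  by rewrite [`|y|]ger0_norm// ger0_norm ?powR_ge0.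
by rewrite normrN [`|y|]ltr0_norm// ger0_norm ?powR_ge0.
Qed.

Lemma powR_split s x Q : 1 <= s -> 0 <= x <= Q -> x `^ s <= Q `^ (s - 1) * x.
Proof.
move=> s1 /andP[x0 xQ]; rewrite -(@mulr_powRB1 _ x s)//; last by lra.
rewrite mulrC ler_wpM2r// powR_le//; lra.
Qed.

Lemma spowR_lip s x y Q : 1 <= s -> `|x| <= Q -> `|y| <= Q ->
  `|spowR s x - spowR s y| <= s * Q `^ (s - 1) * `|x - y|.
Proof.
move=> s1 xQ yQ.
have Qs : 0 <= Q `^ (s - 1) by exact: powR_ge0.
have aux u v : 0 <= u <= Q -> 0 <= v <= Q ->
    `|u `^ s + v `^ s| <= s * Q `^ (s - 1) * (u + v).
  move=> uQ vQ; rewrite ger0_norm ?addr_ge0 ?powR_ge0//.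
  have := powR_split s1 uQ; have := powR_split s1 vQ.
  case/andP: uQ => u0 _; case/andP: vQ => v0 _.
  move=> h1 h2; apply: (@le_trans _ _ (1 * Q `^ (s - 1) * (u + v))); first lra.
  by rewrite ler_wpM2r ?ler_wpM2r// addr_ge0.
have /andP[xQ1 xQ2] : - Q <= x <= Q by rewrite -ler_norml.
have /andP[yQ1 yQ2] : - Q <= y <= Q by rewrite -ler_norml.
rewrite /spowR; case: (leP 0 x) => x0; case: (leP 0 y) => y0.
- by apply: powR_lip => //; apply/andP.
- have -> : `|x - y| = x + - y by rewrite ger0_norm//; lra.
  by rewrite opprK; apply: aux; apply/andP; split; lra.
- have -> : `|x - y| = - x + y by rewrite ler0_norm; lra.
  have -> : - (- x) `^ s - y `^ s = - ((- x) `^ s + y `^ s) by ring.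
  by rewrite normrN; apply: aux; apply/andP; split; lra.
- have -> : `|x - y| = `|- x - - y| by rewrite -normrN; congr `|_|; ring.
  have -> : - (- x) `^ s - - (- y) `^ s = - ((- x) `^ s - (- y) `^ s) by ring.
  by rewrite normrN; apply: powR_lip => //; apply/andP; split; lra.
Qed.

Lemma normr_powR_tangent r x y : 2 <= r ->
  `|y| `^ r - `|x| `^ r <= r * spowR (r - 1) y * (y - x).
Proof.
move=> r2.
have r1 : 1 <= r by lra.
apply: (le_trans (powR_tangent r1 (normr_ge0 y) (normr_ge0 x))).
have r0 : 0 <= r by lra.
rewrite -!mulrA ler_wpM2l//.
have p0 : 0 <= `|y| `^ (r - 1) by exact: powR_ge0.
rewrite /spowR; case: (leP 0 y) => y0.
  rewrite (ger0_norm y0) in p0 *; rewrite ler_wpM2l// lerD2l lerN2.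
  exact: ler_norm.
rewrite (ltr0_norm y0) in p0 *; rewrite mulNr -mulrN ler_wpM2l//.
have := ler_norm (- x); rewrite normrN; lra.
Qed.

(** Young's inequality by cases: either [Q] dominates [4 * K * D] or it is dominated by it. The
    factor 1/4 here and in [young_absorb2] leaves half of the power of [Q] after both
    absorptions. *)
Lemma young_absorb1 r K Q D : 1 <= r -> 0 <= K -> 0 <= Q -> 0 <= D ->
  K * (Q `^ (r - 1) * D) <= Q `^ r / 4 + (4 * K * D) `^ r.
Proof.
move=> r1 K0 Q0 D0; have r0 : 0 < r by lra.
have Qr := powR_ge0 Q (r - 1).
have KD : 0 <= 4 * K * D by rewrite !mulr_ge0.
have [h|h] := leP (4 * K * D) Q.
  apply: (@le_trans _ _ (Q `^ r / 4)); last by rewrite lerDl powR_ge0.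
  rewrite -(mulr_powRB1 Q0 r0).
  have : Q `^ (r - 1) * (4 * K * D) <= Q `^ (r - 1) * Q by rewrite ler_wpM2l.
  lra.
apply: (@le_trans _ _ ((4 * K * D) `^ r)); last first.
  by rewrite lerDr divr_ge0// powR_ge0.
rewrite -(mulr_powRB1 KD r0).
have h1 : Q `^ (r - 1) <= (4 * K * D) `^ (r - 1) by apply: powR_le => //; lra.
apply: (@le_trans _ _ (4 * K * D * Q `^ (r - 1))); last by rewrite ler_wpM2l.
have : 0 <= K * (Q `^ (r - 1) * D) by rewrite !mulr_ge0.
have -> : 4 * K * D * Q `^ (r - 1) = 4 * (K * (Q `^ (r - 1) * D)) by ring.
lra.
Qed.

Lemma young_absorb2 r K Q B : 2 <= r -> 0 <= K -> 0 <= Q -> 0 <= B ->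
  K * (Q `^ (r - 2) * B) <= Q `^ r / 4 + (4 * K * B) `^ (r / 2).
Proof.
move=> r2 K0 Q0 B0; have r0 : 0 < r by lra.
have Qr := powR_ge0 Q (r - 2).
have KB : 0 <= 4 * K * B by rewrite !mulr_ge0.
have [h|h] := leP (4 * K * B) (Q ^+ 2).
  apply: (@le_trans _ _ (Q `^ r / 4)); last by rewrite lerDl powR_ge0.
  rewrite -(mulr_powRB1 Q0 r0) -(@mulr_powRB1 _ Q (r - 1))//; last lra.
  rewrite (_ : r - 1 - 1 = r - 2); last by ring.
  have : Q `^ (r - 2) * (4 * K * B) <= Q `^ (r - 2) * Q ^+ 2 by rewrite ler_wpM2l.
  rewrite expr2; lra.
apply: (@le_trans _ _ ((4 * K * B) `^ (r / 2))); last first.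
  by rewrite lerDr divr_ge0// powR_ge0.
rewrite -(mulr_powRB1 KB (p := r / 2)); last by lra.
have h1 : Q `^ (r - 2) <= (4 * K * B) `^ (r / 2 - 1).
  rewrite (_ : r - 2 = 2 * (r / 2 - 1)); last by field.
  by rewrite powRrM powR_mulrn//; apply: powR_le; [lra | rewrite exprn_ge0 | exact: ltW].
apply: (@le_trans _ _ (4 * K * B * Q `^ (r - 2))); last by rewrite ler_wpM2l.
have : 0 <= K * (Q `^ (r - 2) * B) by rewrite !mulr_ge0.
have -> : 4 * K * B * Q `^ (r - 2) = 4 * (K * (Q `^ (r - 2) * B)) by ring.
lra.
Qed.

End RealPowers.

Section PathwiseInequality.
Context {R : realType}.

(* Doob's maximal inequality in pathwise form: the last sum is a martingale
   transform when [y] is a martingale. *)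
Lemma pathwise_doob (r : R) (n : nat) (y M : nat -> R) : 2 <= r -> y 0%N = 0 ->
  M 0%N = 0 ->
  (forall k, (k < n)%N -> M k.+1 = Num.max (M k) (y k.+1)) ->
  M n `^ r <= 4 * 4 `^ r * `|y n| `^ r
              - 4 * \sum_(k < n) M k `^ (r - 1) * (y k.+1 - y k).
Proof.
move=> r2 y0 M0 MS.
have r0 : 0 < r by lra.
have r10 : 0 < r - 1 by lra.
have Mge0 k : (k <= n)%N -> 0 <= M k.
  elim: k => [|k ih] kn; first by rewrite M0.
  by rewrite MS// le_max ih// ltnW.
(* The running maximum moves only to a value taken by [y]. When it stays, both sides are unchanged;
   when it moves, the step is the tangent inequality between the old and the new maximum. *)
have doob : forall k, (k <= n)%N ->
    (r - 1) * M k `^ r <= r * (M k `^ (r - 1) * y k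
                       - \sum_(i < k) M i `^ (r - 1) * (y i.+1 - y i)).
  elim=> [_|k ih kn].
    by rewrite M0 y0 big_ord0 powR0 ?gt_eqF// !mulr0 subr0 mulr0.
  have {ih} := ih (ltnW kn); rewrite big_ord_recr/= MS//.
  set S := \sum_(_ < _) _; have Mk0 := Mge0 k (ltnW kn).
  case: (leP (M k) (y k.+1)) => My ih; last first.
    apply: (le_trans ih); rewrite ler_wpM2l ?(ltW r0)//.
    by rewrite le_eqVlt; apply/orP; left; apply/eqP; ring.
  have yk0 : 0 <= y k.+1 by exact: le_trans My.
  have := powR_tangent (s := r) _ Mk0 yk0.
  have -> : 1 <= r by lra.
  move=> /(_ isT).
  move=> h; have eM := mulr_powRB1 Mk0 r0; have eY := mulr_powRB1 yk0 r0.
  have reM : r * (M k * M k `^ (r - 1)) = r * M k `^ r by rewrite eM.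
  have reY : r * (y k.+1 * y k.+1 `^ (r - 1)) = r * y k.+1 `^ r by rewrite eY.
  have e1 : r * (y k.+1 `^ (r - 1) * y k.+1 - (S + M k `^ (r - 1) * (y k.+1 - y k))) =
    r * (M k `^ (r - 1) * y k - S) + r * (y k.+1 * y k.+1 `^ (r - 1))
     - r * M k `^ (r - 1) * y k.+1 by ring.
  have e2 : r * M k `^ (r - 1) * (M k - y k.+1) =
    r * (M k * M k `^ (r - 1)) - r * M k `^ (r - 1) * y k.+1 by ring.
  have e3 : (r - 1) * y k.+1 `^ r = r * y k.+1 `^ r - y k.+1 `^ r by ring.
  have e4 : (r - 1) * M k `^ r = r * M k `^ r - M k `^ r by ring.
  rewrite e1 e3 reY; rewrite e2 reM in h; rewrite e4 in ih.
  move: h ih; set X1 := r * M k `^ (r - 1) * y k.+1; set X2 := r * M k `^ r.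
  set X3 := r * y k.+1 `^ r; set X4 := r * _; lra.
have {doob} := doob n (leqnn n).
set S := \sum_(_ < _) _ => doob.
set a := M n; set z := `|y n|.
have a0 : 0 <= a by exact: Mge0.
have z0 : 0 <= z by rewrite /z.
have ar0 : 0 <= a `^ r by exact: powR_ge0.
have ar1 : 0 <= a `^ (r - 1) by exact: powR_ge0.
(* The factor r / (r - 1) is at most 2 because [r >= 2]. *)
have bound : a `^ r <= 2 * (a `^ (r - 1) * z - S).
  set b := a `^ (r - 1) * y n - S in doob *.
  have bz : b <= a `^ (r - 1) * z - S.
    by rewrite lerD2r ler_wpM2l// ler_norm.
  have b0 : 0 <= b by rewrite -(pmulr_rge0 b r0) (le_trans _ doob)// mulr_ge0// ltW.
  apply: (@le_trans _ _ (2 * b)); last by rewrite ler_wpM2l.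
  rewrite -(ler_pM2l r10) (le_trans doob)//.
  have : 0 <= (r - 2) * b by rewrite mulr_ge0// subr_ge0.
  lra.
have young : a `^ (r - 1) * z <= a `^ r / 4 + 4 `^ r * z `^ r.
  have [za|az] := leP z (a / 4).
    apply: (@le_trans _ _ (a `^ (r - 1) * (a / 4))); first by rewrite ler_wpM2l.
    rewrite mulrA (mulrC _ a) mulr_powRB1// lerDl mulr_ge0 ?powR_ge0//.
  have a4z : a <= 4 * z by lra.
  apply: (@le_trans _ _ ((4 * z) `^ r)).
    rewrite -[leRHS](@mulr_powRB1 _ (4 * z) r)//; last by lra.
    rewrite mulrC ler_pM//; first by lra.
    by apply: powR_le => //; lra.
  by rewrite powRM// lerDr divr_ge0.
lra.
Qed.

Variables (r : R) (n : nat) (y : nat -> R).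
Hypotheses (r2 : 2 <= r) (y0 : y 0%N = 0).

Variables (Q : R).
Hypotheses (yQ : forall k, (k <= n)%N -> `|y k| <= Q)
  (dy1 : forall k, (k < n)%N -> `|y k.+1 - y k| <= 1).

(** The tangent inequality has its slope at [y k.+1], while a transform needs it at [y k].
    Increments being at most 1, the exchange costs a multiple of Q^(r-2) per step, the discrete
    second-order term of Ito's formula. *)
Lemma pathwise_power :
  `|y n| `^ r <= r * \sum_(k < n) spowR (r - 1) (y k) * (y k.+1 - y k)
    + r * (r - 1) * n%:R * Q `^ (r - 2).
Proof.
have r2' := r2.
have r0 : 0 <= r by lra.
have step : forall k, (k <= n)%N ->
  `|y k| `^ r <= r * \sum_(i < k) spowR (r - 1) (y i) * (y i.+1 - y i)
    + r * (r - 1) * k%:R * Q `^ (r - 2).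
  elim=> [_|k ih kn].
    by rewrite y0 normr0 big_ord0 powR0 ?mulr0 ?mul0r ?addr0// gt_eqF//; lra.
  have {ih} := ih (ltnW kn); rewrite big_ord_recr/=.
  have := normr_powR_tangent (y k) (y k.+1) r2.
  set S := \sum_(_ < _) _.
  set d := y k.+1 - y k.
  have := @spowR_lip _ (r - 1) (y k.+1) (y k) Q.
  have -> : 1 <= r - 1 by lra.
  have -> : r - 1 - 1 = r - 2 by ring.
  move=> /(_ isT (yQ kn) (yQ (ltnW kn))); rewrite -/d.
  set p := spowR _ _; set p' := spowR _ _ => lip t ih.
  have Q0 : 0 <= Q `^ (r - 2) by exact: powR_ge0.
  have d1 : `|d| <= 1 by exact: dy1.
  have pd : (p - p') * d <= (r - 1) * Q `^ (r - 2).
    apply: (le_trans (ler_norm _)); rewrite normrM.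
    apply: (@le_trans _ _ (`|p - p'| * 1)); first by rewrite ler_wpM2l.
    rewrite mulr1 (le_trans lip)// ler_piMr// mulr_ge0//; lra.
  have rpd : r * ((p - p') * d) <= r * ((r - 1) * Q `^ (r - 2)) by rewrite ler_wpM2l.
  rewrite -natr1.
  have -> : r * (S + p' * d) + r * (r - 1) * (k%:R + 1) * Q `^ (r - 2) =
    (r * S + r * (r - 1) * k%:R * Q `^ (r - 2)) + r * p * d
    + (r * ((r - 1) * Q `^ (r - 2)) - r * ((p - p') * d)) by ring.
  lra.
exact: step.
Qed.

(** The integrand that results from adding Doob's inequality for [y] and for [- y], with [b] and [c]
    their running maxima, and from bounding the two final values, together 8 * 4^r times the power
    of [y n], by [pathwise_power]. *)
Definition pathwise_weight (a b c : R) : R :=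
  8 * 4 `^ r * r * spowR (r - 1) a - 4 * b `^ (r - 1) + 4 * c `^ (r - 1).

(** Large enough to control at once the weight, its Lipschitz constant and the second-order term of
    [pathwise_power]. *)
Definition pathwise_const : R := r * (8 * 4 `^ r * r + 8).

Lemma pathwise_weight_bound (a b c B : R) : `|a| <= B -> 0 <= b <= B -> 0 <= c <= B ->
  `|pathwise_weight a b c| <= pathwise_const * B `^ (r - 1).
Proof.
have r2' := r2.
move=> aB /andP[b0 bB] /andP[c0 cB].
have r1 : 0 <= r - 1 by lra.
have r0 : 0 <= r by lra.
have R0 : 0 <= B `^ (r - 1) by exact: powR_ge0.
have h1 : `|spowR (r - 1) a| <= B `^ (r - 1) by rewrite normr_spowR powR_le.
have h2 : b `^ (r - 1) <= B `^ (r - 1) by rewrite powR_le.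
have h3 : c `^ (r - 1) <= B `^ (r - 1) by rewrite powR_le.
have K0 : 0 <= 8 * 4 `^ r * r by rewrite !mulr_ge0 ?powR_ge0.
have b1 := powR_ge0 b (r - 1); have c1 := powR_ge0 c (r - 1).
apply: (@le_trans _ _ ((8 * 4 `^ r * r + 8) * B `^ (r - 1))); last first.
  rewrite ler_wpM2r// ler_peMl//; lra.
rewrite /pathwise_weight -addrA (le_trans (ler_normD _ _))// [leRHS]mulrDl.
apply: lerD; first by rewrite normrM (ger0_norm K0) ler_wpM2l.
by rewrite ler_norml; apply/andP; split; lra.
Qed.

Lemma pathwise_weight_lip (a b c a' b' c' B : R) :
  `|a| <= B -> 0 <= b <= B -> 0 <= c <= B ->
  `|a'| <= B -> 0 <= b' <= B -> 0 <= c' <= B ->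
  `|a - a'| <= 1 -> `|b - b'| <= 1 -> `|c - c'| <= 1 ->
  `|pathwise_weight a b c - pathwise_weight a' b' c'| <=
    pathwise_const * B `^ (r - 2).
Proof.
have r2' := r2.
move=> aB bB cB a'B b'B c'B da db dc.
have r1 : 1 <= r - 1 by lra.
have K0 : 0 <= 8 * 4 `^ r * r by rewrite !mulr_ge0 ?powR_ge0//; lra.
have R0 : 0 <= B `^ (r - 2) by exact: powR_ge0.
have rr : r - 1 - 1 = r - 2 by ring.
have C0 : 0 <= (r - 1) * B `^ (r - 2) by rewrite mulr_ge0//; lra.
have tr (u v : R) : `|u| <= (r - 1) * B `^ (r - 1 - 1) * v -> v <= 1 ->
    `|u| <= r * B `^ (r - 2).
  rewrite rr => h v1; apply: (le_trans h).
  apply: (@le_trans _ _ ((r - 1) * B `^ (r - 2) * 1)); first by rewrite ler_wpM2l.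
  by rewrite mulr1 ler_wpM2r//; lra.
have h1 := tr _ `|a - a'| (spowR_lip r1 aB a'B) da.
have h2 := tr _ `|b - b'| (powR_lip r1 bB b'B) db.
have h3 := tr _ `|c - c'| (powR_lip r1 cB c'B) dc.
rewrite /pathwise_weight /pathwise_const.
set X := spowR _ a in h1 *; set X' := spowR _ a' in h1 *.
set Y := b `^ _ in h2 *; set Y' := b' `^ _ in h2 *.
set Z := c `^ _ in h3 *; set Z' := c' `^ _ in h3 *.
set K := 8 * 4 `^ r * r in K0 *.
have -> : K * X - 4 * Y + 4 * Z - (K * X' - 4 * Y' + 4 * Z') =
  K * (X - X') + (- 4 * (Y - Y') + 4 * (Z - Z')) by ring.
have -> : r * (K + 8) * B `^ (r - 2) =
  K * (r * B `^ (r - 2)) + (4 * (r * B `^ (r - 2)) + 4 * (r * B `^ (r - 2))) by ring.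
rewrite (le_trans (ler_normD _ _))// lerD//.
  by rewrite normrM (ger0_norm K0) ler_wpM2l.
rewrite (le_trans (ler_normD _ _))// lerD// normrM.
  by rewrite normrN (ger0_norm (x := 4))// ler_wpM2l.
by rewrite (ger0_norm (x := 4))// ler_wpM2l.
Qed.

Lemma pathwise_maximal (Mp Mn : nat -> R) :
  Mp 0%N = 0 -> (forall k, (k < n)%N -> Mp k.+1 = Num.max (Mp k) (y k.+1)) ->
  Mn 0%N = 0 -> (forall k, (k < n)%N -> Mn k.+1 = Num.max (Mn k) (- y k.+1)) ->
  Q = Num.max (Mp n) (Mn n) ->
  Q `^ r <= \sum_(k < n) pathwise_weight (y k) (Mp k) (Mn k) * (y k.+1 - y k)
    + pathwise_const * n%:R * (8 * 4 `^ r) * Q `^ (r - 2).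
Proof.
have r2' := r2.
move=> Mp0 MpS Mn0 MnS QE.
have Mpn := pathwise_doob r2 y0 Mp0 MpS.
have Mnn : Mn n `^ r <= 4 * 4 `^ r * `|y n| `^ r
              + 4 * \sum_(k < n) Mn k `^ (r - 1) * (y k.+1 - y k).
  have := @pathwise_doob r n (fun k => - y k) Mn r2 _ Mn0 MnS.
  rewrite y0 oppr0 normrN => /(_ erefl) h; apply: (le_trans h).
  rewrite lerD2l -mulrN lter_pM2l// -sumrN.
  apply: ler_sum => k _.
  by have -> : - y k.+1 - - y k = - (y k.+1 - y k); [ring | rewrite mulrN opprK].
have Qr : Q `^ r <= Mp n `^ r + Mn n `^ r.
  rewrite QE; case: (leP (Mp n) (Mn n)) => _; first by rewrite lerDr powR_ge0.
  by rewrite lerDl powR_ge0.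
have P := pathwise_power.
set F := 4 `^ r in Mpn Mnn *.
have F0 : 0 <= F by exact: powR_ge0.
have -> : \sum_(k < n) pathwise_weight (y k) (Mp k) (Mn k) * (y k.+1 - y k) =
  8 * F * (r * \sum_(k < n) spowR (r - 1) (y k) * (y k.+1 - y k))
  - 4 * (\sum_(k < n) Mp k `^ (r - 1) * (y k.+1 - y k))
  + 4 * (\sum_(k < n) Mn k `^ (r - 1) * (y k.+1 - y k)).
  rewrite !mulr_sumr -sumrB -big_split/=; apply: eq_bigr => k _.
  by rewrite /pathwise_weight -/F; ring.
have {}P : 8 * F * `|y n| `^ r <= 8 * F * (r * \sum_(k < n) spowR (r - 1) (y k) * (y k.+1 - y k)) +
   8 * F * (r * (r - 1) * n%:R * Q `^ (r - 2)).
  by rewrite -mulrDr ler_wpM2l// mulr_ge0.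
have : 8 * F * (r * (r - 1) * n%:R * Q `^ (r - 2)) <=
  pathwise_const * n%:R * (8 * F) * Q `^ (r - 2).
  have -> : 8 * F * (r * (r - 1) * n%:R * Q `^ (r - 2)) =
    r * (r - 1) * (n%:R * (8 * F) * Q `^ (r - 2)) by ring.
  rewrite /pathwise_const -!(mulrA (r * _)) ler_wpM2r ?mulr_ge0 ?powR_ge0//.
  rewrite ler_wpM2l; [|lra|]; first by lra.
  have : 0 <= 8 * F * r - r.
    have F1 : 1 <= F.
      by rewrite -[leLHS](powRr0 (4 : R)); apply: ler_powR; lra.
    have : 0 <= (8 * F - 1) * r by rewrite mulr_ge0; lra.
    lra.
  by rewrite -/F; lra.
move: P Qr Mpn Mnn; lra.
Qed.

End PathwiseInequality.

(** * Transforms along a measure-preserving map *)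

Section BoundedMeasurable.
Context d (Om : measurableType d) (R : realType).
Implicit Types g h : Om -> R.

(** Every function in the moment argument is bounded, which settles integrability once and for all;
    the bound is existential, so no estimate can depend on it. *)
Definition bounded_measurable g :=
  measurable_fun setT g /\ exists B, forall w, `|g w| <= B.

Lemma bm_ext g h : g =1 h -> bounded_measurable g -> bounded_measurable h.
Proof. by move=> /funext ->. Qed.

Lemma bm_cst (r : R) : bounded_measurable (fun=> r).
Proof. by split; [exact: measurable_cst | exists `|r|]. Qed.

Lemma bmD g h : bounded_measurable g -> bounded_measurable h ->
  bounded_measurable (fun w => g w + h w).
Proof.
move=> [mg [B gB]] [mh [C hC]]; split; first exact: measurable_funD.
by exists (B + C) => w; rewrite (le_trans (ler_normD _ _))// lerD.
Qed.

Lemma bmM g h : bounded_measurable g -> bounded_measurable h ->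
  bounded_measurable (fun w => g w * h w).
Proof.
move=> [mg [B gB]] [mh [C hC]]; split; first exact: measurable_funM.
by exists (B * C) => w; rewrite normrM ler_pM.
Qed.

Lemma bmZ (r : R) g : bounded_measurable g -> bounded_measurable (fun w => r * g w).
Proof. by move=> ?; apply: bmM => //; exact: bm_cst. Qed.

Lemma bmB g h : bounded_measurable g -> bounded_measurable h ->
  bounded_measurable (fun w => g w - h w).
Proof.
move=> bg bh; apply: bmD => //.
by apply: (bm_ext (g := fun w => -1 * h w)) => [w|]; [rewrite mulN1r | exact: bmZ].
Qed.

Lemma bm_sum n (g : nat -> Om -> R) : (forall i, bounded_measurable (g i)) ->
  bounded_measurable (fun w => \sum_(i < n) g i w).
Proof.
move=> bg; elim: n => [|n ih].
  by apply: (bm_ext (g := fun=> 0)) (bm_cst 0) => w; rewrite big_ord0.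
apply: (bm_ext (g := fun w => \sum_(i < n) g i w + g n w)) => [w|].
  by rewrite big_ord_recr.
exact: bmD.
Qed.

Lemma bm_comp (phi : R -> R) g : measurable_fun setT phi ->
  (forall B, exists C, forall x, `|x| <= B -> `|phi x| <= C) ->
  bounded_measurable g -> bounded_measurable (fun w => phi (g w)).
Proof.
move=> mphi bphi [mg [B gB]]; split; first exact: measurableT_comp.
by have [C hC] := bphi B; exists C => w; exact: hC.
Qed.

Lemma bm_norm g : bounded_measurable g -> bounded_measurable (fun w => `|g w|).
Proof.
apply: (bm_comp (phi := fun x => `|x|)); first exact: normr_measurable.
by move=> B; exists B => x; rewrite normr_id.
Qed.

Lemma bm_max g h : bounded_measurable g -> bounded_measurable h ->
  bounded_measurable (fun w => Num.max (g w) (h w)).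
Proof.
move=> [mg [B gB]] [mh [C hC]]; split; first exact: measurable_maxr.
exists (B + C) => w.
case: (leP (g w) (h w)) => _.
  by rewrite (le_trans (hC w))// lerDr (le_trans _ (gB w)).
by rewrite (le_trans (gB w))// lerDl (le_trans _ (hC w)).
Qed.

Lemma powR_bounded (s B : R) : 0 <= s ->
  exists C, forall x, `|x| <= B -> `|x `^ s| <= C.
Proof.
move=> s0; exists (1 + B `^ s) => x xB; have B0 := powR_ge0 B s.
have [x0|x0] := ltP x 0; first by rewrite lt0_norm_powR//; lra.
rewrite norm_powR// ger0_norm//; rewrite ger0_norm// in xB.
by apply: (le_trans (powR_le s0 x0 xB)); lra.
Qed.

Lemma bm_powR (s : R) g : 0 <= s -> bounded_measurable g ->
  bounded_measurable (fun w => g w `^ s).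
Proof.
move=> s0; apply: (bm_comp (phi := fun x => x `^ s)); first exact: measurable_powR.
by move=> B; exact: powR_bounded.
Qed.

Lemma bm_preim (f : Om -> Om) g : measurable_fun setT f ->
  bounded_measurable g -> bounded_measurable (fun w => g (f w)).
Proof.
move=> mf [mg [B gB]]; split; first exact: (measurableT_comp mg mf).
by exists B.
Qed.

Lemma measurable_iter (f : Om -> Om) m : measurable_fun setT f ->
  measurable_fun setT (iter m f).
Proof.
by move=> mf; elim: m => [|m ih]; [exact: measurable_id | exact: measurableT_comp].
Qed.

End BoundedMeasurable.

Section Expectation.
Context d (Om : measurableType d) (R : realType) (P : probability Om R).
Implicit Types g h : Om -> R.

Definition expect g : R := \int[P]_w g w.

Lemma bm_integrable g : bounded_measurable g -> P.-integrable setT (EFin \o g).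
Proof.
move=> [mg [B gB]]; apply: measurable_bounded_integrable => //.
  by rewrite (le_lt_trans (probability_le1 P _))// ltry.
by exists B; split; [exact: num_real|] => x Bx y _; exact: le_trans (gB y) (ltW Bx).
Qed.

Lemma expectD g h : bounded_measurable g -> bounded_measurable h ->
  expect (fun w => g w + h w) = expect g + expect h.
Proof. by move=> bg bh; apply: RintegralD => //; exact: bm_integrable. Qed.

Lemma expectB g h : bounded_measurable g -> bounded_measurable h ->
  expect (fun w => g w - h w) = expect g - expect h.
Proof. by move=> bg bh; apply: RintegralB => //; exact: bm_integrable. Qed.

Lemma expectZ r g : bounded_measurable g ->
  expect (fun w => r * g w) = r * expect g.
Proof. by move=> bg; apply: RintegralZl => //; exact: bm_integrable. Qed.

Lemma expect_sum n (g : nat -> Om -> R) : (forall i, bounded_measurable (g i)) ->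
  expect (fun w => \sum_(i < n) g i w) = \sum_(i < n) expect (g i).
Proof.
move=> bg; elim: n => [|n ih].
  by rewrite big_ord0 /expect; under eq_Rintegral do rewrite big_ord0;
     rewrite Rintegral_cst// mul0r.
rewrite big_ord_recr/= -ih -expectD//; last exact: bm_sum.
by congr expect; apply/funext => w; rewrite big_ord_recr.
Qed.

Lemma expect_cst r : expect (fun=> r) = r.
Proof.
rewrite /expect Rintegral_cst// (_ : fine _ = 1) ?mulr1//.
exact: (congr1 fine (probability_setT P)).
Qed.

Lemma expect_le g h : bounded_measurable g -> bounded_measurable h ->
  (forall w, g w <= h w) -> expect g <= expect h.
Proof.
by move=> bg bh gh; apply: le_Rintegral => //; exact: bm_integrable.
Qed.

Lemma expect_ge0 g : (forall w, 0 <= g w) -> 0 <= expect g.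
Proof. by move=> g0; exact: Rintegral_ge0. Qed.

Lemma le_norm_expect g : bounded_measurable g ->
  `|expect g| <= expect (fun w => `|g w|).
Proof. by move=> bg; apply: le_normr_Rintegral => //; exact: bm_integrable. Qed.

Lemma expect_preserving (f : Om -> Om) g : measurable_fun setT f ->
  (forall A, measurable A -> P (f @^-1` A) = P A) -> bounded_measurable g ->
  expect (fun w => g (f w)) = expect g.
Proof.
move=> mf fP bg; rewrite /expect /Rintegral; congr fine.
have bgf := bm_integrable (bm_preim mf bg).
have mg : measurable_fun setT (EFin \o g) by apply/measurable_EFinP; case: bg.
have := @integral_pushforward _ _ _ _ R f mf P setT (EFin \o g) mg.
rewrite preimage_setT => /(_ bgf measurableT) /= <-.
by apply: eq_measure_integral => A mA _; exact: fP.
Qed.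

End Expectation.

(** * Maximal inequality for transforms under a decorrelation hypothesis *)

Section TransformBound.
Context d (Om : measurableType d) (R : realType) (P : probability Om R).
Local Notation bm := (@bounded_measurable d Om R).
Local Notation E := (expect P).
Variable f : Om -> Om.
Hypotheses (mf : measurable_fun setT f)
  (fP : forall A, measurable A -> P (f @^-1` A) = P A).

Definition ergodic_sum (u : Om -> R) m w : R := \sum_(i < m) u (iter i f w).

Lemma ergodic_sumS u m w : ergodic_sum u m.+1 w = ergodic_sum u m w + u (iter m f w).
Proof. by rewrite /ergodic_sum big_ord_recr. Qed.

Lemma bm_iter m g : bm g -> bm (fun w => g (iter m f w)).
Proof. by move=> bg; apply: bm_preim => //; exact: measurable_iter. Qed.

Lemma bm_ergodic_sum u m : bm u -> bm (ergodic_sum u m).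
Proof. by move=> bu; apply: (@bm_sum _ _ _ m (fun i w => u (iter i f w))) => i; exact: bm_iter. Qed.

Lemma expect_iter m g : bm g -> E (fun w => g (iter m f w)) = E g.
Proof.
move=> bg; elim: m => [//|m ih]; rewrite -{}ih.
rewrite -(expect_preserving mf fP (bm_iter m bg)); congr expect.
by apply/funext => w; rewrite iterSr.
Qed.

Variables (u c : Om -> R).
Hypotheses (bu : bm u) (u1 : forall w, `|u w| <= 1)
           (bc : bm c) (c0 : forall w, 0 <= c w).
Variable n : nat.
Hypothesis decorrelation : forall m g, (m <= n)%N -> bm g ->
  `|E (fun w => g (iter m f w) * ergodic_sum u m w)| <= E (fun w => `|g w| * c w).

Variable theta : nat -> Om -> R.
Hypotheses (btheta : forall j, bm (theta j)) (theta1 : forall j w, `|theta j w| <= 1).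

(* Time runs backwards: the values at time [j] are functions of the orbit of
   length [j] starting at the point [w], and for a horizon [n] they are
   evaluated at [f^(n-j)]. *)
Fixpoint transform j w : R :=
  if j is i.+1 then transform i (f w) + theta i (f w) * u w else 0.

Fixpoint transform_sup j w : R :=
  if j is i.+1 then Num.max (transform_sup i (f w)) (transform j w) else 0.

Fixpoint transform_inf j w : R :=
  if j is i.+1 then Num.max (transform_inf i (f w)) (- transform j w) else 0.

Definition transform_max j w : R := Num.max (transform_sup j w) (transform_inf j w).

Lemma bm_transform j : bm (transform j).
Proof.
elim: j => [|j ih]; first exact: bm_cst.
apply: bmD; first exact: bm_preim.
by apply: bmM => //; exact: bm_preim.
Qed.

Lemma bm_transform_sup j : bm (transform_sup j).
Proof.
elim: j => [|j ih]; first exact: bm_cst.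
by apply: bm_max; [exact: bm_preim | exact: (bm_transform j.+1)].
Qed.

Lemma bm_transform_inf j : bm (transform_inf j).
Proof.
elim: j => [|j ih]; first exact: bm_cst.
apply: bm_max; first exact: bm_preim.
apply: (bm_ext (g := fun w => 0 - transform j.+1 w)) => [w|]; first by rewrite sub0r.
by apply: bmB; [exact: bm_cst | exact: (bm_transform j.+1)].
Qed.

Lemma bm_transform_max j : bm (transform_max j).
Proof. by apply: bm_max; [exact: bm_transform_sup | exact: bm_transform_inf]. Qed.

Lemma transform_sup_ge0 j w : 0 <= transform_sup j w.
Proof. by elim: j w => [//|j ih] w /=; rewrite le_max ih. Qed.

Lemma transform_inf_ge0 j w : 0 <= transform_inf j w.
Proof. by elim: j w => [//|j ih] w /=; rewrite le_max ih. Qed.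

Lemma transform_max_ge0 j w : 0 <= transform_max j w.
Proof. by rewrite le_max transform_sup_ge0. Qed.

Lemma transform_le_max j w : `|transform j w| <= transform_max j w.
Proof.
rewrite ler_norml lerNl !le_max; case: j => [|j] /=; first by rewrite oppr0 lexx.
by rewrite !le_max !lexx !orbT.
Qed.

Lemma transform_maxS j w : transform_max j (f w) <= transform_max j.+1 w.
Proof.
rewrite /transform_max /= ge_max !le_max !lexx/= !orbT; exact: erefl.
Qed.

Lemma rev_iter j w : (j < n)%N -> iter (n - j) f w = f (iter (n - j.+1) f w).
Proof. by move=> jn; rewrite -subnSK. Qed.

Lemma transform_max_mono j w : (j <= n)%N ->
  transform_max j (iter (n - j) f w) <= transform_max n w.
Proof.
move=> jn; rewrite -{1}(subKn jn); move: (n - j)%N => k {j jn}.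
elim: k => [|k ih] /=; first by rewrite subn0.
have [nk|kn] := leqP n k.
  have -> : (n - k.+1 = 0)%N by lia.
  by rewrite {1}/transform_max /= maxxx transform_max_ge0.
apply: le_trans ih; rewrite (_ : n - k = (n - k.+1).+1)%N; last lia.
exact: transform_maxS.
Qed.

Lemma transform_le j w : (j <= n)%N ->
  `|transform j (iter (n - j) f w)| <= transform_max n w.
Proof. by move=> jn; exact: le_trans (transform_le_max _ _) (transform_max_mono w jn). Qed.

Variable r : R.
Hypothesis r2 : 2 <= r.

Let weight j w := pathwise_weight r (transform j w) (transform_sup j w) (transform_inf j w).
(** The increments of the transform are [theta] times [u], so this is the integrand once [u] itself
    is the integrator. *)
Let H j w := theta j w * weight j w.
Let cst := pathwise_const r.
Let rev (A : nat -> Om -> R) j w := A j (iter (n - j) f w).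

(** The price of varying multipliers in the summation by parts: it vanishes for constant ones, and
    [multiplier_variation] bounds it for the iterated sums. *)
Definition transform_variation w : R :=
  \sum_(k < n) `|theta k.+1 (iter (n - k.+1) f w) - theta k (iter (n - k) f w)|
               * c (iter (n - k.+1) f w).

Let bm_weight j : bm (weight j).
Proof.
have r2' := r2; have r0 : 0 <= r - 1 by lra.
apply: bmD; last by apply: bmZ; apply: bm_powR => //; exact: bm_transform_inf.
apply: bmB; last by apply: bmZ; apply: bm_powR => //; exact: bm_transform_sup.
apply: bmZ; apply: (bm_comp (phi := spowR (r - 1))) (bm_transform j).
  apply: measurable_fun_ifT.
  - by apply: measurable_fun_ler => //; exact: measurable_cst.
  - exact: measurable_powR.
  - apply: measurable_funN; apply: (measurableT_comp (measurable_powR _)).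
    exact: measurable_funN.
by move=> B; exists (B `^ (r - 1)) => x xB; rewrite normr_spowR powR_le.
Qed.

Let bmH j : bm (H j). Proof. exact: bmM. Qed.

Let cst_ge0 : 0 <= cst.
Proof.
have r2' := r2; rewrite /cst /pathwise_const mulr_ge0 ?addr_ge0 ?mulr_ge0 ?powR_ge0//; lra.
Qed.

Let transform_revS k w : (k < n)%N ->
  rev transform k.+1 w - rev transform k w
  = rev theta k w * u (iter (n - k.+1) f w).
Proof. by move=> kn; rewrite /rev (rev_iter w kn) /= addrC addKr. Qed.

Lemma transform_step k w : (k < n)%N ->
  `|transform k.+1 (iter (n - k.+1) f w) - transform k (iter (n - k) f w)| <= 1.
Proof.
by move=> kn; rewrite (transform_revS w kn) normrM mulr_ile1 ?normr_ge0 ?theta1 ?u1.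
Qed.

Let pathwise w : transform_max n w `^ r <=
  \sum_(k < n) rev H k w * u (iter (n - k.+1) f w)
  + cst * n%:R * (8 * 4 `^ r) * transform_max n w `^ (r - 2).
Proof.
have step k : (k < n)%N -> `|rev transform k.+1 w - rev transform k w| <= 1.
  exact: transform_step.
have bnd k : (k <= n)%N -> `|rev transform k w| <= transform_max n w.
  exact: transform_le.
have sS k : (k < n)%N -> rev transform_sup k.+1 w =
    Num.max (rev transform_sup k w) (rev transform k.+1 w).
  by move=> kn; rewrite /rev (rev_iter w kn).
have iS k : (k < n)%N -> rev transform_inf k.+1 w =
    Num.max (rev transform_inf k w) (- rev transform k.+1 w).
  by move=> kn; rewrite /rev (rev_iter w kn).
have := @pathwise_maximal R r n (rev transform ^~ w) r2 erefl _ bnd step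
  (rev transform_sup ^~ w) (rev transform_inf ^~ w) erefl sS erefl iS.
rewrite /rev subnn => /(_ erefl) h.
apply: (le_trans h); rewrite lerD2r; apply: ler_sum => k _.
have := transform_revS w (ltn_ord k); rewrite /rev => ->.
by rewrite /H /weight mulrA (mulrC (theta _ _)).
Qed.

Let rev_weight_0 w : weight 0 w = 0.
Proof.
have r2' := r2; rewrite /weight /pathwise_weight /= spowR0 ?powR0 ?gt_eqF//; lra.
Qed.

(** The sums of [u] start at [w], while the increment of [H] sits at the end of the orbit piece that
    they cover, as the decorrelation hypothesis requires. The boundary terms vanish because the
    weight is zero at reversed time 0 and [ergodic_sum u 0] is zero. *)
Let abel w : \sum_(k < n) rev H k w * u (iter (n - k.+1) f w) =
  \sum_(k < n) (rev H k.+1 w - rev H k w) * ergodic_sum u (n - k.+1) w.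
Proof.
suff step m : (m <= n)%N -> \sum_(k < m) rev H k w * u (iter (n - k.+1) f w) =
    \sum_(k < m) (rev H k.+1 w - rev H k w) * ergodic_sum u (n - k.+1) w
    + (rev H 0 w * ergodic_sum u n w - rev H m w * ergodic_sum u (n - m) w).
  rewrite (step n (leqnn n)) subnn (_ : ergodic_sum u 0 w = 0) ?mulr0; last by rewrite /ergodic_sum big_ord0.
  have -> : rev H 0 w = 0 by rewrite /rev /H rev_weight_0 mulr0.
  by rewrite mul0r subr0 addr0.
elim: m => [_|m ih mn]; first by rewrite !big_ord0 subn0 subrr addr0.
rewrite !big_ord_recr/= (ih (ltnW mn)).
rewrite (_ : (n - m)%N = (n - m.+1).+1) ?ergodic_sumS; last by lia.
by set X := \sum_(_ < _) _; ring.
Qed.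

Let increment w k : (k < n)%N -> `|rev H k.+1 w - rev H k w| <=
  cst * (transform_max n w `^ (r - 1) * `|rev theta k.+1 w - rev theta k w|
         + transform_max n w `^ (r - 2)).
Proof.
move=> kn; set Q := transform_max n w.
have iter_k i : (i <= n)%N -> [/\ `|rev transform i w| <= Q,
    0 <= rev transform_sup i w <= Q & 0 <= rev transform_inf i w <= Q].
  move=> i_n; split; first exact: transform_le.
  - rewrite transform_sup_ge0/= (le_trans _ (transform_max_mono w i_n))//.
    by rewrite /transform_max le_max lexx.
  - rewrite transform_inf_ge0/= (le_trans _ (transform_max_mono w i_n))//.
    by rewrite /transform_max le_max lexx orbT.
have [t1 s1 i1] := iter_k k.+1 kn; have [t0 s0 i0] := iter_k k (ltnW kn).
have dt := transform_step w kn.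
(* A running maximum dominates the current value, so it moves by no more than the process does. *)
have maxstep (a b e : R) : e <= a -> `|b - e| <= 1 -> `|Num.max a b - a| <= 1.
  move=> ea be; case: (leP a b) => ab; last by rewrite subrr normr0 ler01.
  rewrite ger0_norm ?subr_ge0//; move: be; rewrite ler_norml.
  by move=> /andP[? ?]; lra.
have h1 := pathwise_weight_bound r2 t1 s1 i1.
have h2 : `|rev weight k.+1 w - rev weight k w| <= cst * Q `^ (r - 2).
  apply: pathwise_weight_lip => //.
    rewrite /rev (rev_iter w kn); apply: maxstep dt; rewrite (rev_iter w kn).
    by case: (k) => [|j] //=; rewrite le_max lexx orbT.
  rewrite /rev (rev_iter w kn).
  apply: (@maxstep _ _ (- transform k (f (iter (n - k.+1) f w)))).
    by case: (k) => [|j] /=; rewrite ?oppr0// le_max lexx orbT.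
  by rewrite -opprD normrN -(rev_iter w kn).
have -> : rev H k.+1 w - rev H k w =
  (rev theta k.+1 w - rev theta k w) * rev weight k.+1 w
  + rev theta k w * (rev weight k.+1 w - rev weight k w).
  by rewrite /rev /H; ring.
rewrite (le_trans (ler_normD _ _))// [leRHS]mulrDr; apply: lerD.
  rewrite normrM mulrC (_ : cst * _ = cst * Q `^ (r - 1) * `|rev theta k.+1 w - rev theta k w|).
    by rewrite ler_wpM2r.
  by rewrite mulrA.
rewrite normrM (le_trans _ h2)// ler_piMl//; exact: theta1.
Qed.

Lemma expect_transform_max : E (fun w => transform_max n w `^ r) <=
  2 * E (fun w => (4 * cst * transform_variation w) `^ r
      + (4 * cst * (8 * 4 `^ r * n%:R + ergodic_sum c n w)) `^ (r / 2)).
Proof.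
have r2' := r2; have r0 : 0 <= r by lra.
pose Q w := transform_max n w.
pose D w := (4 * cst * transform_variation w) `^ r
      + (4 * cst * (8 * 4 `^ r * n%:R + ergodic_sum c n w)) `^ (r / 2).
have bQ : bm Q by exact: bm_transform_max.
have bQr : bm (fun w => Q w `^ r) by exact: bm_powR.
have bQ2 : bm (fun w => cst * n%:R * (8 * 4 `^ r) * Q w `^ (r - 2)).
  by apply: bmZ; apply: bm_powR => //; lra.
have bV : bm transform_variation.
  apply: (@bm_sum _ _ _ n (fun k w => `|theta k.+1 (iter (n - k.+1) f w)
     - theta k (iter (n - k) f w)| * c (iter (n - k.+1) f w))) => k.
  by apply: bmM; [apply: bm_norm; apply: bmB; exact: bm_iter | exact: bm_iter].
have bD : bm D.
  apply: bmD; apply: bm_powR => //; [exact: bmZ | lra |].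
  by apply: bmZ; apply: bmD; [exact: bm_cst | exact: bm_ergodic_sum].
have brH k : bm (rev H k) by exact: bm_iter.
pose G k w := `|rev H k.+1 w - rev H k w| * c (iter (n - k.+1) f w).
have bG k : bm (G k).
  by apply: bmM; [apply: bm_norm; exact: bmB | exact: bm_iter].
have bHx : bm (fun w => \sum_(k < n) rev H k w * u (iter (n - k.+1) f w)).
  apply: (@bm_sum _ _ _ n (fun k w => rev H k w * u (iter (n - k.+1) f w))) => k.
  by apply: bmM => //; exact: bm_iter.
have step1 : E (fun w => \sum_(k < n) rev H k w * u (iter (n - k.+1) f w)) <=
    E (fun w => \sum_(k < n) G k w).
  have -> : (fun w => \sum_(k < n) rev H k w * u (iter (n - k.+1) f w)) =
    (fun w => \sum_(k < n) (rev H k.+1 w - rev H k w) * ergodic_sum u (n - k.+1) w).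
    by apply/funext => w; exact: abel.
  rewrite (@expect_sum _ _ _ P n (fun k w =>
    (rev H k.+1 w - rev H k w) * ergodic_sum u (n - k.+1) w)); last first.
    by move=> k; apply: bmM; [exact: bmB | exact: bm_ergodic_sum].
  rewrite (@expect_sum _ _ _ P n G)//; apply: ler_sum => k _.
  pose g w := H k.+1 w - H k (f w).
  have bg : bm g by apply: bmB => //; exact: bm_preim.
  have gE w : rev H k.+1 w - rev H k w = g (iter (n - k.+1) f w).
    by rewrite /g /rev (rev_iter w (ltn_ord k)).
  apply: (@le_trans _ _ (E (fun w => `|g w| * c w))).
    apply: le_trans (decorrelation (leq_subr k.+1 n) bg).
    apply: (le_trans (ler_norm _)).
    rewrite le_eqVlt; apply/orP; left; apply/eqP; congr `|E _|.
    by apply/funext => w; rewrite gE.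
  (* Invariance moves the bound back to the time from which the increment came; the terms for all
     [k] then refer to one orbit and can be recombined pointwise. *)
  rewrite -(expect_iter (n - k.+1)); last by apply: bmM => //; exact: bm_norm.
  rewrite le_eqVlt; apply/orP; left; apply/eqP; congr (E _).
  by apply/funext => w; rewrite /G gE.
have sumc w : \sum_(k < n) c (iter (n - k.+1) f w) = ergodic_sum c n w.
  rewrite /ergodic_sum (reindex_inj rev_ord_inj)/=.
  by apply: eq_bigr => k _; rewrite (_ : n - (n - k.+1).+1 = k)%N//; have := ltn_ord k; lia.
have step2 w : \sum_(k < n) G k w + cst * n%:R * (8 * 4 `^ r) * Q w `^ (r - 2)
    <= 2^-1 * Q w `^ r + D w.
  have Q0 : 0 <= Q w by exact: transform_max_ge0.
  have V0 : 0 <= transform_variation w by apply: sumr_ge0 => k _; rewrite mulr_ge0.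
  have C0 : 0 <= ergodic_sum c n w by exact: sumr_ge0.
  have B0 : 0 <= 8 * 4 `^ r * n%:R + ergodic_sum c n w.
    by rewrite addr_ge0// !mulr_ge0// powR_ge0.
  apply: (@le_trans _ _ (cst * (Q w `^ (r - 1) * transform_variation w) +
    cst * (Q w `^ (r - 2) * (8 * 4 `^ r * n%:R + ergodic_sum c n w)))).
    have -> : cst * (Q w `^ (r - 1) * transform_variation w) +
      cst * (Q w `^ (r - 2) * (8 * 4 `^ r * n%:R + ergodic_sum c n w)) =
      (cst * (Q w `^ (r - 1) * transform_variation w) +
      cst * (Q w `^ (r - 2) * ergodic_sum c n w)) +
      cst * n%:R * (8 * 4 `^ r) * Q w `^ (r - 2) by ring.
    rewrite lerD2r -sumc /transform_variation !mulr_sumr -big_split/=.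
    apply: ler_sum => k _; rewrite /G.
    apply: (le_trans (ler_wpM2r (c0 _) (increment w (ltn_ord k)))).
    by rewrite le_eqVlt; apply/orP; left; apply/eqP; rewrite /rev; ring.
  have r1 : 1 <= r by lra.
  have := young_absorb1 r1 cst_ge0 Q0 V0; have := young_absorb2 r2 cst_ge0 Q0 B0.
  rewrite /D; lra.
have bSG : bm (fun w => \sum_(k < n) G k w) := @bm_sum _ _ _ n G bG.
(* The expectation of Q^r is finite because [Q] is bounded, so half of it can be moved to the
   left-hand side. *)
have key : E (fun w => Q w `^ r) <= 2^-1 * E (fun w => Q w `^ r) + E D.
  rewrite -expectZ// -expectD//; last exact: bmZ.
  apply: (@le_trans _ _ (E (fun w => \sum_(k < n) rev H k w * u (iter (n - k.+1) f w)
    + cst * n%:R * (8 * 4 `^ r) * Q w `^ (r - 2)))).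
    by apply: expect_le => //; exact: bmD.
  apply: (@le_trans _ _ (E (fun w => \sum_(k < n) G k w + cst * n%:R * (8 * 4 `^ r) * Q w `^ (r - 2)))).
    by rewrite (expectD P bHx bQ2) (expectD P bSG bQ2) lerD2r; exact: step1.
  apply: expect_le => //; first exact: bmD.
  by apply: bmD => //; exact: bmZ.
have -> : (fun w => transform_max n w `^ r) = (fun w => Q w `^ r) by [].
rewrite -/D; lra.
Qed.

End TransformBound.

(** * Moments of sums and iterated sums *)

Section PowerSums.
Context {R : realType}.
Implicit Types x y s : R.

Lemma powR_addr_le s x y : 0 <= s -> 0 <= x -> 0 <= y ->
  (x + y) `^ s <= 2 `^ s * (x `^ s + y `^ s).
Proof.
move=> s0 x0 y0; rewrite mulrDr -!powRM//.
have [xy|yx] := leP x y.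
  apply: (@le_trans _ _ ((2 * y) `^ s)); last by rewrite lerDr powR_ge0.
  by apply: powR_le => //; [rewrite addr_ge0 | lra].
apply: (@le_trans _ _ ((2 * x) `^ s)); last by rewrite lerDl powR_ge0.
by apply: powR_le => //; [rewrite addr_ge0 | lra].
Qed.

Lemma powR_double x s : 0 <= x -> (x ^+ 2) `^ s = x `^ (2 * s).
Proof. by move=> x0; rewrite powRrM powR_mulrn. Qed.

Lemma powR_mul_le s x y : 0 <= s -> 0 <= x -> 0 <= y ->
  (x * y) `^ s <= x `^ (2 * s) + y `^ (2 * s).
Proof.
move=> s0 x0 y0; rewrite -!powR_double//.
have [xy|yx] := leP x y.
  apply: (@le_trans _ _ ((y ^+ 2) `^ s)); last by rewrite lerDr powR_ge0.
  by apply: powR_le => //; rewrite ?mulr_ge0// expr2 ler_wpM2r.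
apply: (@le_trans _ _ ((x ^+ 2) `^ s)); last by rewrite lerDl powR_ge0.
by apply: powR_le => //; rewrite ?mulr_ge0// expr2 ler_wpM2l// ltW.
Qed.

Lemma powR_sum_le n (x : nat -> R) s : 1 <= s -> (forall i, 0 <= x i) ->
  (\sum_(i < n) x i) `^ s <= n%:R `^ (s - 1) * \sum_(i < n) x i `^ s.
Proof.
move=> s1 x0; have s0 : 0 < s by lra.
case: n => [|n]; first by rewrite !big_ord0 mulr0 powR0// gt_eqF.
set N : R := n.+1%:R; have N0 : 0 < N by rewrite ltr0n.
set S := \sum_(i < n.+1) x i; have S0 : 0 <= S by exact: sumr_ge0.
set m := S / N; have m0 : 0 <= m by rewrite divr_ge0// ltW.
have h : \sum_(i < n.+1) (m `^ s - x i `^ s) <= \sum_(i < n.+1) s * m `^ (s - 1) * (m - x i).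
  by apply: ler_sum => i _; exact: powR_tangent.
have e1 : \sum_(i < n.+1) (m - x i) = 0.
  by rewrite sumrB sumr_const card_ord -mulr_natr -/N -/S /m divfK ?gt_eqF// subrr.
move: h; rewrite -mulr_sumr e1 mulr0 sumrB subr_le0 sumr_const card_ord -mulr_natr -/N => h.
rewrite (_ : S = N * m); last by rewrite /m mulrC divfK ?gt_eqF.
rewrite powRM// ?(ltW N0)// -(mulr_powRB1 (ltW N0) s0).
by rewrite -mulrA mulrCA ler_wpM2l ?powR_ge0// mulrC.
Qed.

End PowerSums.

(** * From moments of order [q] of the cost to moments of order [2 * q] of the sums *)

Section Moments.
Context d (Om : measurableType d) (R : realType) (P : probability Om R).
Local Notation bm := (@bounded_measurable d Om R).
Local Notation E := (expect P).
Variable f : Om -> Om.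
Hypotheses (mf : measurable_fun setT f)
  (fP : forall A, measurable A -> P (f @^-1` A) = P A).
Variables (c : Om -> R) (q kappa K : R) (n : nat).
Hypotheses (bc : bm c) (c0 : forall w, 0 <= c w) (q1 : 1 <= q)
  (kappa1 : 1 <= kappa) (n1 : (1 <= n)%N)
  (c_step : forall w, c (f w) <= c w + kappa) (c_top : forall w, c w <= kappa * n%:R)
  (c_moment : E (fun w => c w `^ q) <= K).
Local Notation S := (ergodic_sum f).
Local Notation r := (2 * q).
Let N : R := n%:R.

Let N1 : 1 <= N. Proof. by rewrite /N ler1n. Qed.
Let q0 : 0 <= q. Proof. have q1' := q1; lra. Qed.

Lemma moment_nonneg : 0 <= K.
Proof.
by apply: le_trans c_moment; apply: expect_ge0 => w; exact: powR_ge0.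
Qed.

Lemma ergodic_sum_ge0 m w : 0 <= S c m w.
Proof. exact: sumr_ge0. Qed.

Lemma moment_ergodic_sum : E (fun w => S c n w `^ q) <= N `^ q * K.
Proof.
have q1' := q1; have qq : 0 < q by lra.
have bcq i : bm (fun w => c (iter i f w) `^ q) by apply: bm_powR => //; exact: bm_iter.
apply: (@le_trans _ _ (E (fun w => N `^ (q - 1) * \sum_(i < n) c (iter i f w) `^ q))).
  apply: expect_le; first by apply: bm_powR => //; exact: bm_ergodic_sum.
    by apply: bmZ; exact: (@bm_sum _ _ _ n (fun i w => c (iter i f w) `^ q)).
  by move=> w; exact: (@powR_sum_le _ n (fun i => c (iter i f w))).
rewrite expectZ; last exact: (@bm_sum _ _ _ n (fun i w => c (iter i f w) `^ q)).
rewrite (@expect_sum _ _ _ P n (fun i w => c (iter i f w) `^ q))//.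
have -> : \sum_(i < n) E (fun w => c (iter i f w) `^ q) = N * E (fun w => c w `^ q).
  rewrite (eq_bigr (fun=> E (fun w => c w `^ q))); last first.
    by move=> i _; exact: (expect_iter mf fP i (bm_powR q0 bc)).
  by rewrite sumr_const card_ord -mulr_natl.
rewrite mulrA (mulrC _ N) (mulr_powRB1 (le_trans ler01 N1) qq).
by rewrite ler_wpM2l// powR_ge0.
Qed.

Fixpoint running_max j w : R :=
  if j is i.+1 then Num.max (running_max i (f w)) (c w) else 0.

Lemma bm_running_max j : bm (running_max j).
Proof. by elim: j => [|j ih]; [exact: bm_cst | apply: bm_max => //; exact: bm_preim]. Qed.

Lemma running_max_ge0 j w : 0 <= running_max j w.
Proof. by elim: j w => [//|j ih] w /=; rewrite le_max ih. Qed.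

(** Summing c^r over the orbit and using the bound [kappa * N] on the cost would lose a factor [N].
    Instead the upward variation of c^r is summed: the cost rises by at most [kappa] per step, so a
    step adds at most a multiple of c^(r-1), and truncation turns c^(r-1) into (kappa N)^(q-1)
    c^q. *)
Let running_max_pow j w : (j <= n)%N -> running_max j.+1 w `^ r <=
  c w `^ r + r * kappa * (kappa * N) `^ (q - 1) * \sum_(i < j) c (iter i.+1 f w) `^ q.
Proof.
have q1' := q1; have k1' := kappa1; have N1' := N1.
have kN : 0 <= kappa * N by rewrite mulr_ge0; lra.
have C0 : 0 <= r * kappa * (kappa * N) `^ (q - 1) by rewrite !mulr_ge0 ?powR_ge0//; lra.
elim: j w => [|j ih] w jn.
  by rewrite /= big_ord0 mulr0 addr0 (elimT max_idPr).
have step : c (f w) `^ r <= c w `^ r + r * kappa * (kappa * N) `^ (q - 1) * c (f w) `^ q.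
  have [h|h] := leP (c (f w)) (c w).
    apply: (@le_trans _ _ (c w `^ r)); first by apply: powR_le => //; lra.
    by rewrite lerDl mulr_ge0 ?powR_ge0.
  have := @powR_tangent _ r (c (f w)) (c w).
  have -> : 1 <= r by lra.
  move=> /(_ isT (c0 _) (c0 _)) t.
  have ck : c (f w) - c w <= kappa by have := c_step w; lra.
  have cr : c (f w) `^ (r - 1) <= (kappa * N) `^ (q - 1) * c (f w) `^ q.
    have -> : r - 1 = (q - 1) + q by ring.
    rewrite powRD; last by apply/implyP => /eqP; lra.
    by rewrite ler_wpM2r ?powR_ge0// powR_le//; lra.
  rewrite -lerBlDl (le_trans t)//.
  apply: (@le_trans _ _ (r * c (f w) `^ (r - 1) * kappa)).
    by rewrite ler_wpM2l// mulr_ge0 ?powR_ge0//; lra.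
  have -> : r * kappa * (kappa * N) `^ (q - 1) * c (f w) `^ q =
    r * kappa * ((kappa * N) `^ (q - 1) * c (f w) `^ q) by ring.
  have -> : r * c (f w) `^ (r - 1) * kappa = r * kappa * c (f w) `^ (r - 1) by ring.
  by rewrite ler_wpM2l// mulr_ge0//; lra.
rewrite big_ord_recl/=.
have {}ih := ih (f w) (ltnW jn).
have e : \sum_(i < j) c (iter i.+1 f (f w)) `^ q =
         \sum_(i < j) c (f (iter (bump 0 i) f w)) `^ q.
  by apply: eq_bigr => i _; rewrite -iterSr.
rewrite e in ih.
rewrite mulrDr addrA; set Z := \sum_(_ < _) _ in ih *.
have Z0 : 0 <= Z by apply: sumr_ge0 => i _; exact: powR_ge0.
have XZ : 0 <= r * kappa * (kappa * N) `^ (q - 1) * Z by rewrite mulr_ge0.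
rewrite -/(running_max j.+1 (f w)).
case: (leP (running_max j.+1 (f w)) (c w)) => _.
  by rewrite -addrA lerDl addr_ge0// mulr_ge0// powR_ge0.
by rewrite (le_trans ih)// lerD2r.
Qed.

Lemma moment_running_max :
  E (fun w => running_max n w `^ r) <= (1 + r) * kappa `^ q * N `^ q * K.
Proof.
have q1' := q1; have k1' := kappa1; have N1' := N1.
have kN : 0 <= kappa * N by rewrite mulr_ge0; lra.
have bcq i : bm (fun w => c (iter i f w) `^ q) by apply: bm_powR => //; exact: bm_iter.
pose C := r * kappa * (kappa * N) `^ (q - 1).
have C0 : 0 <= C by rewrite !mulr_ge0 ?powR_ge0//; lra.
have nE : n = n.-1.+1 by rewrite prednK.
pose B w := (kappa * N) `^ q * c w `^ q + C * \sum_(i < n) c (iter i.+1 f w) `^ q.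
have bS : bm (fun w => \sum_(i < n) c (iter i.+1 f w) `^ q).
  exact: (@bm_sum _ _ _ n (fun i w => c (iter i.+1 f w) `^ q)).
have b1 : bm (fun w => (kappa * N) `^ q * c w `^ q) by apply: bmZ; exact: bm_powR.
have b2 : bm (fun w => C * \sum_(i < n) c (iter i.+1 f w) `^ q) by exact: bmZ.
apply: (@le_trans _ _ (E B)).
  apply: expect_le; [by apply: bm_powR; [lra | exact: bm_running_max]| exact: bmD |].
  move=> w; rewrite [in leLHS]nE.
  apply: (le_trans (running_max_pow w _)); first exact: leq_pred.
  rewrite /B lerD//.
    have -> : r = q + q by ring.
    rewrite powRD; last by apply/implyP => /eqP; lra.
    by rewrite ler_wpM2r ?powR_ge0// powR_le.
  rewrite -/C ler_wpM2l//; have : (0 < n)%N by [].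
  by case: (n) => [//|m] _; rewrite big_ord_recr/= lerDl powR_ge0.
rewrite /B expectD// !expectZ//; last exact: bm_powR.
rewrite (@expect_sum _ _ _ P n (fun i w => c (iter i.+1 f w) `^ q))//.
have -> : \sum_(i < n) E (fun w => c (iter i.+1 f w) `^ q) = N * E (fun w => c w `^ q).
  rewrite (eq_bigr (fun=> E (fun w => c w `^ q))); last first.
    by move=> i _; exact: (expect_iter mf fP i.+1 (bm_powR q0 bc)).
  by rewrite sumr_const card_ord -mulr_natl.
have -> : C * (N * E (fun w => c w `^ q)) = r * (kappa * N) `^ q * E (fun w => c w `^ q).
  rewrite -(@mulr_powRB1 _ (kappa * N) q)//; last lra.
  by rewrite /C; ring.
rewrite powRM; [|lra|lra].
set X := kappa `^ q * N `^ q; have X0 : 0 <= X by rewrite mulr_ge0 ?powR_ge0.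
have -> : X * E (fun w => c w `^ q) + r * X * E (fun w => c w `^ q) =
  ((1 + r) * X) * E (fun w => c w `^ q) by ring.
have -> : (1 + r) * kappa `^ q * N `^ q * K = (1 + r) * X * K by rewrite /X; ring.
by rewrite ler_wpM2l// mulr_ge0//; lra.
Qed.

Section FirstOrder.
Variable u : Om -> R.
Hypotheses (bu : bm u) (u1 : forall w, `|u w| <= 1).
Hypothesis decorrelation : forall m g, (m <= n)%N -> bm g ->
  `|E (fun w => g (iter m f w) * S u m w)| <= E (fun w => `|g w| * c w).

Definition sum_max j w := transform_max f u (fun _ _ => 1) j w.

Let one1 (j : nat) (w : Om) : `|(1 : R)| <= 1. Proof. by rewrite normr1. Qed.

Lemma ergodic_sumSl (v : Om -> R) m w : S v m.+1 w = v w + S v m (f w).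
Proof.
rewrite /ergodic_sum big_ord_recl; congr (_ + _).
by apply: eq_bigr => i _; rewrite -iterSr.
Qed.

Lemma transform_ergodic_sum j w : transform f u (fun _ _ => 1) j w = S u j w.
Proof.
elim: j w => [|j ih] w; first by rewrite /ergodic_sum big_ord0.
by rewrite /= ih ergodic_sumSl mul1r addrC.
Qed.

Lemma bm_sum_max j : bm (sum_max j).
Proof. by apply: bm_transform_max => // k; exact: bm_cst. Qed.

Lemma sum_max_ge0 j w : 0 <= sum_max j w.
Proof. exact: transform_max_ge0. Qed.

Lemma le_sum_max j w : `|S u j w| <= sum_max j w.
Proof. by rewrite -transform_ergodic_sum; exact: transform_le_max. Qed.

Definition moment_const1 : R :=
  2 * ((8 * pathwise_const r) `^ q * ((8 * 4 `^ r) `^ q + K)).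

(** With constant multipliers the variation is zero. What remains is the moment of order [r / 2 = q]
    of [n] plus the sum of the costs, which [moment_ergodic_sum] provides. *)
Lemma moment_sum_max : E (fun w => sum_max n w `^ r) <= moment_const1 * N `^ q.
Proof.
have q1' := q1; have N1' := N1.
have r2 : 2 <= r by lra.
have K0 := moment_nonneg.
pose cst := pathwise_const r.
have cst0 : 0 <= cst by rewrite mulr_ge0 ?addr_ge0 ?mulr_ge0 ?powR_ge0//; lra.
have := expect_transform_max mf fP bu u1 bc c0 decorrelation
  (theta := fun _ _ => 1) (fun=> bm_cst _ 1) one1 r2.
rewrite -/cst => h; apply: (le_trans h).
have -> : moment_const1 * N `^ q =
    2 * ((8 * cst) `^ q * (((8 * 4 `^ r) `^ q + K) * N `^ q)).
  by rewrite /moment_const1 -/cst; ring.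
rewrite ler_wpM2l//.
have c4 : 0 <= 4 * cst by exact: mulr_ge0.
have rq : r / 2 = q by field.
apply: (@le_trans _ _ (E (fun w => (8 * cst) `^ q * ((8 * 4 `^ r) `^ q * N `^ q + S c n w `^ q)))).
  apply: expect_le.
  - have bV : bm (transform_variation f c n (fun _ _ => 1)).
      apply: (bm_ext (g := fun=> 0)) (bm_cst _ 0) => w.
      rewrite /transform_variation big1// => k _.
      by rewrite subrr normr0 mul0r.
    apply: bmD; apply: bm_powR; [lra | exact: bmZ | lra |].
    by apply: bmZ; apply: bmD; [exact: bm_cst | exact: bm_ergodic_sum].
  - apply: bmZ; apply: bmD; first exact: bm_cst.
    by apply: bm_powR => //; exact: bm_ergodic_sum.
  - move=> w; rewrite /transform_variation big1; last first.
      by move=> k _; rewrite subrr normr0 mul0r.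
    rewrite mulr0 powR0 ?add0r ?rq; last by rewrite gt_eqF//; lra.
    have S0 := ergodic_sum_ge0 n w; have p4 := powR_ge0 (4 : R) r.
    have A0 : 0 <= 8 * 4 `^ r * N by rewrite mulr_ge0; lra.
    rewrite (@powRM _ (4 * cst)) ?addr_ge0//.
    apply: (@le_trans _ _ ((4 * cst) `^ q * (2 `^ q * ((8 * 4 `^ r * N) `^ q + S c n w `^ q)))).
      by rewrite ler_wpM2l ?powR_ge0// powR_addr_le.
    rewrite mulrA -powRM// (_ : 4 * cst * 2 = 8 * cst); last by ring.
    by rewrite (@powRM _ (8 * 4 `^ r)) ?mulr_ge0// /N; lra.
rewrite expectZ; last first.
  by apply: bmD; [exact: bm_cst | apply: bm_powR => //; exact: bm_ergodic_sum].
rewrite ler_wpM2l ?powR_ge0// expectD; last 2 first.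
- exact: bm_cst.
- by apply: bm_powR => //; exact: bm_ergodic_sum.
by rewrite expect_cst [leRHS]mulrDl lerD2l (mulrC K) moment_ergodic_sum.
Qed.

End FirstOrder.

Section OrbitMonotone.

Lemma orbit_mono (A : nat -> Om -> R) : (forall j w, A j (f w) <= A j.+1 w) ->
  forall m k w, A k (iter m f w) <= A (k + m)%N w.
Proof.
move=> mA; elim=> [|m ih] k w; first by rewrite addn0.
by rewrite iterSr addnS (le_trans (ih k (f w))).
Qed.

Lemma rev_mono (A : nat -> Om -> R) : (forall j w, A j (f w) <= A j.+1 w) ->
  forall k w, (k <= n)%N -> A k (iter (n - k) f w) <= A n w.
Proof. by move=> mA k w kn; rewrite -[in leRHS](subnKC kn); exact: orbit_mono. Qed.

Lemma ergodic_sum_cat (v : Om -> R) k m w :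
  S v (k + m) w = S v k w + S v m (iter k f w).
Proof.
elim: m => [|m ih]; first by rewrite addn0 {3}/ergodic_sum big_ord0 addr0.
by rewrite addnS !ergodic_sumS ih -addrA -iterD (addnC m).
Qed.

(** [sum_max] is a maximum over final segments of the orbit. An initial segment is the whole minus a
    final segment, whence the factor 2. *)
Lemma ergodic_sum_le_max (v : Om -> R) k w : (k <= n)%N ->
  `|S v k w| <= 2 * sum_max v n w.
Proof.
move=> kn.
have mono j x : sum_max v j (f x) <= sum_max v j.+1 x by exact: transform_maxS.
have h1 := le_sum_max v n w.
have h2 := le_trans (le_sum_max v (n - k) (iter k f w)) (orbit_mono mono k (n - k) w).
rewrite subnK// in h2.
have -> : S v k w = S v n w - S v (n - k) (iter k f w).
  by have := ergodic_sum_cat v k (n - k) w; rewrite subnKC// => ->; rewrite addrK.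
by rewrite (le_trans (ler_normB _ _))//; lra.
Qed.

End OrbitMonotone.

(** * Iterated sums of two observables *)

Section SecondOrder.
Variables ua ub : Om -> R.
Hypotheses (bua : bm ua) (ua1 : forall w, `|ua w| <= 1)
  (bub : bm ub) (ub1 : forall w, `|ub w| <= 1).
Hypothesis decorrelation_a : forall m g, (m <= n)%N -> bm g ->
  `|E (fun w => g (iter m f w) * S ua m w)| <= E (fun w => `|g w| * c w).
Hypothesis decorrelation_b : forall m g, (m <= n)%N -> bm g ->
  `|E (fun w => g (iter m f w) * S ub m w)| <= E (fun w => `|g w| * c w).

(* Dividing the inner sum [S ub j] by [envelope j] makes the double sum a
   transform with bounded multipliers. The terms in [c] are there so that the
   variation of the multipliers, weighted by [c], is bounded by the envelope. *)
Definition envelope j w : R :=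
  Num.sqrt N + sum_max ub j w + Num.sqrt (S c j w) + running_max j w.

Definition multiplier j w : R := S ub j w / envelope j w.

Let bm_sqrt g : (forall w, 0 <= g w) -> bm g -> bm (fun w => Num.sqrt (g w)).
Proof.
move=> g0 bg; apply: (bm_ext (g := fun w => g w `^ 2^-1)); last exact: bm_powR.
by move=> w; rewrite powR12_sqrt.
Qed.

Let bm_envelope j : bm (envelope j).
Proof.
apply: bmD; last exact: bm_running_max.
apply: bmD; last by apply: bm_sqrt; [exact: ergodic_sum_ge0 | exact: bm_ergodic_sum].
by apply: bmD; [exact: bm_cst | exact: bm_sum_max].
Qed.

Lemma envelope_ge1 j w : 1 <= envelope j w.
Proof.
have h1 := sum_max_ge0 ub j w; have h2 := sqrtr_ge0 (S c j w).
have h3 := running_max_ge0 j w.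
have h4 : 1 <= Num.sqrt N by rewrite -[leLHS]sqrtr1 ler_sqrt//; exact: le_trans N1.
by rewrite /envelope; lra.
Qed.

Lemma envelope_gt0 j w : 0 < envelope j w.
Proof. exact: lt_le_trans (envelope_ge1 j w). Qed.

Lemma ergodic_sum_le_envelope j w : `|S ub j w| <= envelope j w.
Proof.
apply: (le_trans (le_sum_max ub j w)).
have h2 := sqrtr_ge0 (S c j w); have h3 := running_max_ge0 j w.
by have h4 := sqrtr_ge0 N; rewrite /envelope; lra.
Qed.

Let bm_multiplier j : bm (multiplier j).
Proof.
apply: bmM; first exact: bm_ergodic_sum.
split; last first.
  exists 1 => w; rewrite normfV ger0_norm ?(ltW (envelope_gt0 j w))//.
  by rewrite invf_le1 ?envelope_ge1// envelope_gt0.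
have -> : (fun w => (envelope j w)^-1) = (fun w => envelope j w `^ (-1)).
  by apply/funext => w; rewrite powR_inv1// ltW// envelope_gt0.
by apply: (measurableT_comp (measurable_powR (-1))); case: (bm_envelope j).
Qed.

Lemma multiplier_le1 j w : `|multiplier j w| <= 1.
Proof.
rewrite /multiplier normrM normfV [X in _ / X]gtr0_norm ?envelope_gt0//.
by rewrite ler_pdivrMr ?envelope_gt0// mul1r ergodic_sum_le_envelope.
Qed.

Let ergodic_sum_c_mono j w : S c j (f w) <= S c j.+1 w.
Proof. by rewrite ergodic_sumSl lerDr. Qed.

Let sqrt_c_mono j w : Num.sqrt (S c j (f w)) <= Num.sqrt (S c j.+1 w).
Proof. by rewrite ler_sqrt ?ergodic_sum_ge0. Qed.

Lemma envelope_mono j w : envelope j (f w) <= envelope j.+1 w.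
Proof.
rewrite /envelope lerD//; last by rewrite /= le_max lexx.
rewrite lerD// lerD2l; exact: transform_maxS.
Qed.

(** The change of the multiplier is at most (1 + W' - W) / W', where W and W' are the old and the
    new envelope. The cost is the difference of the squares of two consecutive square roots, both at
    most W', so dividing it by W' leaves twice the difference of these roots. The cost itself is at
    most W' thanks to [running_max], so the other part leaves W' - W. Both bounds telescope. *)
Let variation_step j w : `|multiplier j.+1 w - multiplier j (f w)| * c w <=
  2 * (Num.sqrt (S c j.+1 w) - Num.sqrt (S c j (f w)))
  + (envelope j.+1 w - envelope j (f w)).
Proof.
have W0 := envelope_gt0 j (f w); have W1 := envelope_gt0 j.+1 w.
have WW := envelope_mono j w; have UW := ergodic_sum_le_envelope j (f w).
have sc := sqrt_c_mono j w.
have cE : c w = Num.sqrt (S c j.+1 w) ^+ 2 - Num.sqrt (S c j (f w)) ^+ 2.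
  by rewrite !sqr_sqrtr ?ergodic_sum_ge0// ergodic_sumSl addrK.
have cW : c w <= envelope j.+1 w.
  have h1 := sum_max_ge0 ub j.+1 w; have h2 := sqrtr_ge0 (S c j.+1 w).
  have h4 := sqrtr_ge0 N.
  have : c w <= running_max j.+1 w by rewrite /= le_max lexx orbT.
  by rewrite /envelope; lra.
have sW : Num.sqrt (S c j.+1 w) <= envelope j.+1 w.
  have h1 := sum_max_ge0 ub j.+1 w; have h3 := running_max_ge0 j.+1 w.
  by have h4 := sqrtr_ge0 N; rewrite /envelope; lra.
have s0 := sqrtr_ge0 (S c j (f w)).
have U1 := ub1 w; have c0w := c0 w.
have SE : S ub j.+1 w = ub w + S ub j (f w) by rewrite ergodic_sumSl.
rewrite /multiplier SE.
set U := S ub j (f w) in UW *; set V := ub w in U1 *; set C := c w in cE cW c0w *.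
set W := envelope j (f w) in W0 WW UW *; set W' := envelope j.+1 w in W1 WW cW sW *.
set a := Num.sqrt (S c j.+1 w) in sc cE sW *.
set b := Num.sqrt (S c j (f w)) in sc cE s0 *.
have -> : (V + U) / W' - U / W = V / W' - (U / W) * ((W' - W) / W').
  by field; rewrite ?gt_eqF.
have UW1 : `|U / W| <= 1.
  by rewrite normrM normfV (gtr0_norm W0) ler_pdivrMr// mul1r.
have b1 : `|V / W' - (U / W) * ((W' - W) / W')| <= (1 + (W' - W)) / W'.
  rewrite (le_trans (ler_normB _ _))// [leRHS]mulrDl; apply: lerD.
    by rewrite normrM normfV (gtr0_norm W1) ler_wpM2r// invr_ge0 ltW.
  rewrite normrM [X in _ * X]ger0_norm; last by rewrite divr_ge0 ?subr_ge0// ltW.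
  by rewrite ler_piMl// divr_ge0 ?subr_ge0// ltW.
apply: (le_trans (ler_wpM2r c0w b1)).
rewrite mulrAC ler_pdivrMr//.
have e1 : C <= 2 * (a - b) * W'.
  rewrite cE subr_sqr (mulrC 2) -mulrA ler_wpM2l ?subr_ge0//; lra.
have e2 : (W' - W) * C <= (W' - W) * W' by rewrite ler_wpM2l// subr_ge0.
have -> : (1 + (W' - W)) * C = C + (W' - W) * C by ring.
have -> : (2 * (a - b) + (W' - W)) * W' = 2 * (a - b) * W' + (W' - W) * W' by ring.
exact: lerD.
Qed.

Let sqrt_c_le_envelope j w : Num.sqrt (S c j w) <= envelope j w.
Proof.
have h1 := sum_max_ge0 ub j w; have h3 := running_max_ge0 j w.
by have h4 := sqrtr_ge0 N; rewrite /envelope; lra.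
Qed.

Lemma multiplier_variation w :
  transform_variation f c n multiplier w <= 3 * envelope n w.
Proof.
pose F k := 2 * Num.sqrt (S c k (iter (n - k) f w)) + envelope k (iter (n - k) f w).
apply: (@le_trans _ _ (\sum_(k < n) (F k.+1 - F k))).
  apply: ler_sum => k _.
  have := variation_step k (iter (n - k.+1) f w).
  rewrite -(rev_iter f w (ltn_ord k)) /F => h; apply: (le_trans h).
  by rewrite le_eqVlt; apply/orP; left; apply/eqP; ring.
rewrite -(big_mkord xpredT (fun k => F k.+1 - F k)) telescope_sumr// /F subnn /=.
have h1 := sqrtr_ge0 (S c 0 (iter (n - 0) f w)).
have h2 := envelope_gt0 0 (iter (n - 0) f w).
have := sqrt_c_le_envelope n w; lra.
Qed.

(** The double sum grouped by its earlier index: in reversed time an increment is [ua] times the sum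
    of [ub] accumulated so far, that is, the envelope times the increment of the transform by
    [multiplier]. *)
Fixpoint double_sum j w : R :=
  if j is i.+1 then double_sum i (f w) + ua w * S ub i (f w) else 0.

Local Notation Y := (transform_max f ua multiplier).
Local Notation y := (transform f ua multiplier).

(** Summation by parts against the envelope. The difference between [double_sum] and the envelope
    times the transform changes only by an increment of the envelope times a value of the transform;
    these increments are nonnegative and add up to at most the final envelope. *)
Lemma double_sum_le k w : (k <= n)%N ->
  `|double_sum k (iter (n - k) f w)| <= 2 * (envelope n w * Y n w).
Proof.
move=> kn.
have Y0 : 0 <= Y n w by exact: transform_max_ge0.
have step j : (j <= n)%N ->
   `|double_sum j (iter (n - j) f w) - envelope j (iter (n - j) f w) * y j (iter (n - j) f w)|
   <= envelope j (iter (n - j) f w) * Y n w.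
  elim: j => [_|j ih jn].
    by rewrite /= mulr0 subr0 normr0 mulr_ge0// ltW// envelope_gt0.
  have {}ih := ih (ltnW jn).
  have yn := @transform_le _ _ _ f ua n multiplier j.+1 w jn.
  rewrite (rev_iter f w jn) in ih.
  set x := iter (n - j.+1) f w in ih yn *.
  have mE : envelope j (f x) * multiplier j (f x) = S ub j (f x).
    by rewrite /multiplier mulrC divfK// gt_eqF// envelope_gt0.
  have -> : double_sum j.+1 x - envelope j.+1 x * y j.+1 x =
    (double_sum j (f x) - envelope j (f x) * y j (f x)) -
    (envelope j.+1 x - envelope j (f x)) * y j.+1 x.
    by rewrite /= -mE; ring.
  rewrite (le_trans (ler_normB _ _))//.
  have -> : envelope j.+1 x * Y n w = envelope j (f x) * Y n w +
    (envelope j.+1 x - envelope j (f x)) * Y n w by ring.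
  apply: lerD => //; rewrite normrM.
  have em := envelope_mono j x.
  by rewrite ger0_norm ?subr_ge0// ler_wpM2l// subr_ge0.
have e := rev_mono envelope_mono w kn.
have e0 := envelope_gt0 k (iter (n - k) f w).
have s := step k kn.
have yk := @transform_le _ _ _ f ua n multiplier k w kn.
set x := iter (n - k) f w in e e0 s yk *.
have -> : double_sum k x = (double_sum k x - envelope k x * y k x) + envelope k x * y k x.
  by ring.
rewrite (le_trans (ler_normD _ _))//.
have h1 : `|envelope k x * y k x| <= envelope k x * Y n w.
  by rewrite normrM (gtr0_norm e0) ler_wpM2l// ltW.
have h2 : envelope k x * Y n w <= envelope n w * Y n w by rewrite ler_wpM2r.
lra.
Qed.

Definition iterated k w : R := \sum_(j < k) S ua j w * ub (iter j f w).

Lemma iterated_double_sum k w : iterated k w = double_sum k w.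
Proof.
elim: k w => [|k ih] w; first by rewrite /iterated big_ord0.
rewrite /= -ih /iterated big_ord_recl/= {1}/ergodic_sum big_ord0 mul0r add0r.
rewrite {2}/ergodic_sum mulr_sumr -big_split/=; apply: eq_bigr => j _.
rewrite -[bump 0 j]/(j.+1) ergodic_sumSl -iterS iterSr add0n /ergodic_sum; ring.
Qed.

(** Chen's relation for concatenated orbit segments. It expresses the iterated sum over an initial
    segment by those over the whole orbit and a final segment, which [double_sum_le] controls. *)
Lemma iterated_cat k m w : iterated (k + m) w =
  iterated k w + iterated m (iter k f w) + S ua k w * S ub m (iter k f w).
Proof.
elim: m => [|m ih].
  rewrite addn0 {3}/iterated big_ord0 {2}/ergodic_sum big_ord0 mulr0; ring.
rewrite addnS {1}/iterated big_ord_recr/= -/(iterated (k + m) w) ih.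
rewrite {4}/iterated big_ord_recr/= -/(iterated m (iter k f w)).
rewrite ergodic_sum_cat ergodic_sumS -!iterD (addnC k m); ring.
Qed.

Definition iterated_max w : R :=
  4 * (envelope n w * Y n w) + 2 * (sum_max ua n w * sum_max ub n w).

Lemma iterated_le_max k w : (k <= n)%N -> `|iterated k w| <= iterated_max w.
Proof.
move=> kn.
have -> : iterated k w = iterated n w - iterated (n - k) (iter k f w)
     - S ua k w * S ub (n - k) (iter k f w).
  by have := iterated_cat k (n - k) w; rewrite subnKC// => ->; ring.
have h1 := double_sum_le w (leqnn n); rewrite subnn /= -iterated_double_sum in h1.
have h2 := double_sum_le w (leq_subr k n).
rewrite subKn// -iterated_double_sum in h2.
have mono j x : sum_max ub j (f x) <= sum_max ub j.+1 x by exact: transform_maxS.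
have h3 := le_trans (le_sum_max ub (n - k) (iter k f w)) (orbit_mono mono k (n - k) w).
rewrite subnK// in h3.
have h4 := ergodic_sum_le_max ua w kn.
have h5 : `|S ua k w * S ub (n - k) (iter k f w)| <= 2 * (sum_max ua n w * sum_max ub n w).
  by rewrite normrM mulrA ler_pM.
rewrite (le_trans (ler_normB _ _))//.
have h6 := ler_normB (iterated n w) (iterated (n - k) (iter k f w)).
by rewrite /iterated_max; lra.
Qed.

Let cst := pathwise_const r.
Let cst_ge0 : 0 <= cst.
Proof.
have q1' := q1; rewrite /cst /pathwise_const mulr_ge0 ?addr_ge0 ?mulr_ge0 ?powR_ge0//; lra.
Qed.

Definition envelope_const : R :=
  4 `^ r * (1 + moment_const1 + K + (1 + r) * kappa `^ q * K).

Lemma moment_envelope : E (fun w => envelope n w `^ r) <= envelope_const * N `^ q.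
Proof.
have q1' := q1; have N1' := N1; have r0 : 0 <= r by lra.
have N0 : 0 <= N by lra.
have bS : bm (fun w => S c n w `^ q) by apply: bm_powR => //; exact: bm_ergodic_sum.
have bM : bm (fun w => sum_max ub n w `^ r) by apply: bm_powR => //; exact: bm_sum_max.
have bR : bm (fun w => running_max n w `^ r) by apply: bm_powR => //; exact: bm_running_max.
have b1 : bm (fun w => N `^ q + sum_max ub n w `^ r).
  by apply: bmD => //; exact: bm_cst.
have b2 : bm (fun w => S c n w `^ q + running_max n w `^ r) by exact: bmD.
apply: (@le_trans _ _ (E (fun w => 4 `^ r * ((N `^ q + sum_max ub n w `^ r)
     + (S c n w `^ q + running_max n w `^ r))))).
  apply: expect_le; [exact: bm_powR | by apply: bmZ; exact: bmD |] => w.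
  have h1 := sum_max_ge0 ub n w; have h2 := sqrtr_ge0 (S c n w).
  have h3 := running_max_ge0 n w; have h4 := sqrtr_ge0 N.
  have sqrtN : Num.sqrt N `^ r = N `^ q by rewrite -powR_double// sqr_sqrtr.
  have sqrtS : Num.sqrt (S c n w) `^ r = S c n w `^ q.
    by rewrite -powR_double// sqr_sqrtr// ergodic_sum_ge0.
  rewrite /envelope -addrA (le_trans (powR_addr_le r0 _ _)) ?addr_ge0//.
  have -> : 4 `^ r = 2 `^ r * 2 `^ r :> R by rewrite -powRM//; congr (_ `^ _); ring.
  rewrite -[leRHS]mulrA ler_wpM2l ?powR_ge0// [leRHS]mulrDr; apply: lerD.
    by rewrite -sqrtN powR_addr_le.
  by rewrite -sqrtS powR_addr_le.
rewrite expectZ; last exact: bmD.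
have -> : envelope_const * N `^ q = 4 `^ r * ((N `^ q + moment_const1 * N `^ q) +
  (N `^ q * K + (1 + r) * kappa `^ q * N `^ q * K)) by rewrite /envelope_const; ring.
rewrite ler_wpM2l ?powR_ge0// expectD//; apply: lerD.
  rewrite expectD//; last exact: bm_cst.
  by rewrite expect_cst lerD2l; exact: moment_sum_max.
by rewrite expectD//; apply: lerD; [exact: moment_ergodic_sum | exact: moment_running_max].
Qed.

Definition double_const : R :=
  2 * ((12 * cst) `^ r + (4 * cst * (8 * 4 `^ r + 1)) `^ q).

(** The envelope dominates both terms of [expect_transform_max]: the variation by
    [multiplier_variation], and [n] plus the sum of the costs through the squares of the two square
    roots in its definition. *)
Lemma moment_double : E (fun w => Y n w `^ r) <= double_const * (envelope_const * N `^ q).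
Proof.
have q1' := q1; have N1' := N1; have r2 : 2 <= r by lra.
have bWr : bm (fun w => envelope n w `^ r) by apply: bm_powR => //; lra.
have := expect_transform_max mf fP bua ua1 bc c0 decorrelation_a
  bm_multiplier multiplier_le1 r2.
rewrite -/cst (_ : r / 2 = q); last by field.
move=> h; apply: (le_trans h).
have -> : double_const * (envelope_const * N `^ q) = 2 *
  (((12 * cst) `^ r + (4 * cst * (8 * 4 `^ r + 1)) `^ q) * (envelope_const * N `^ q)).
  by rewrite /double_const; ring.
rewrite ler_wpM2l//.
have c4 : 0 <= 4 * cst by exact: mulr_ge0.
have C0 : 0 <= (12 * cst) `^ r + (4 * cst * (8 * 4 `^ r + 1)) `^ q.
  by rewrite addr_ge0 ?powR_ge0.
apply: (@le_trans _ _ (E (fun w => ((12 * cst) `^ r + (4 * cst * (8 * 4 `^ r + 1)) `^ q)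
   * envelope n w `^ r))); last first.
  by rewrite expectZ// ler_wpM2l// moment_envelope.
apply: expect_le; last 2 first.
- exact: bmZ.
- move=> w; have W1 := envelope_ge1 n w; have W0 := ltW (envelope_gt0 n w).
  have V := multiplier_variation w.
  have V0 : 0 <= transform_variation f c n multiplier w.
    by apply: sumr_ge0 => k _; rewrite mulr_ge0.
  rewrite [leRHS]mulrDl; apply: lerD.
    rewrite -powRM//; last by rewrite mulr_ge0.
    apply: powR_le; [lra | by rewrite mulr_ge0|].
    have -> : 12 * cst * envelope n w = 4 * cst * (3 * envelope n w) by ring.
    by rewrite ler_wpM2l.
  have p4 := powR_ge0 (4 : R) r.
  have A0 : 0 <= 8 * 4 `^ r :> R by lra.
  rewrite -(powR_double _ W0) -powRM; last 2 first.
  + by rewrite mulr_ge0//; lra.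
  + by rewrite exprn_ge0.
  apply: powR_le => //.
    rewrite mulr_ge0// addr_ge0 ?ergodic_sum_ge0// mulr_ge0//; exact: le_trans N1'.
  rewrite -[leRHS]mulrA ler_wpM2l// [leRHS]mulrDl mul1r; apply: lerD.
    rewrite ler_wpM2l// -[leLHS](@sqr_sqrtr _ N); last exact: le_trans N1'.
    rewrite ler_sqr ?nnegrE ?sqrtr_ge0//.
    have h1 := sum_max_ge0 ub n w; have h2 := sqrtr_ge0 (S c n w).
    by have h3 := running_max_ge0 n w; rewrite /envelope; lra.
  rewrite -[leLHS](@sqr_sqrtr _ (S c n w)) ?ergodic_sum_ge0//.
  by rewrite ler_sqr ?nnegrE ?sqrtr_ge0.
- have bV : bm (transform_variation f c n multiplier).
    apply: (@bm_sum _ _ _ n (fun k w => `|multiplier k.+1 (iter (n - k.+1) f w)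
     - multiplier k (iter (n - k) f w)| * c (iter (n - k.+1) f w))) => k.
    by apply: bmM; [apply: bm_norm; apply: bmB; exact: bm_iter | exact: bm_iter].
  apply: bmD; apply: bm_powR; [lra | exact: bmZ | lra |].
  by apply: bmZ; apply: bmD; [exact: bm_cst | exact: bm_ergodic_sum].
Qed.

Definition moment_const2 : R :=
  8 `^ q * (envelope_const + double_const * envelope_const + 2 * moment_const1).

Lemma bm_iterated_max : bm iterated_max.
Proof.
apply: bmD; apply: bmZ; apply: bmM => //; try exact: bm_sum_max.
exact: bm_transform_max.
Qed.

Lemma iterated_max_ge0 w : 0 <= iterated_max w.
Proof.
have W0 := ltW (envelope_gt0 n w).
by rewrite addr_ge0// mulr_ge0// mulr_ge0// ?sum_max_ge0// transform_max_ge0.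
Qed.

Lemma moment_iterated : E (fun w => iterated_max w `^ q) <= moment_const2 * N `^ q.
Proof.
have q1' := q1; have r0 : 0 <= r by lra.
have bW : bm (fun w => envelope n w `^ r) by exact: bm_powR.
have bY : bm (fun w => Y n w `^ r) by apply: bm_powR => //; exact: bm_transform_max.
have bMa : bm (fun w => sum_max ua n w `^ r) by apply: bm_powR => //; exact: bm_sum_max.
have bMb : bm (fun w => sum_max ub n w `^ r) by apply: bm_powR => //; exact: bm_sum_max.
have b1 := bmD bW bY; have b2 := bmD bMa bMb.
apply: (@le_trans _ _ (E (fun w => 8 `^ q * ((envelope n w `^ r + Y n w `^ r)
    + (sum_max ua n w `^ r + sum_max ub n w `^ r))))).
  apply: expect_le; [by apply: bm_powR => //; exact: bm_iterated_max | by apply: bmZ; exact: bmD |].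
  move=> w; have W0 := ltW (envelope_gt0 n w).
  have Y0 : 0 <= Y n w by exact: transform_max_ge0.
  have a0 := sum_max_ge0 ua n w; have b0 := sum_max_ge0 ub n w.
  have WY : 0 <= envelope n w * Y n w by exact: mulr_ge0.
  have ab : 0 <= sum_max ua n w * sum_max ub n w by exact: mulr_ge0.
  apply: (le_trans (powR_addr_le q0 _ _)); try exact: mulr_ge0.
  have -> : 8 = 2 * 4 :> R by ring.
  rewrite (@powRM _ 2 4)// -[leRHS]mulrA ler_wpM2l ?powR_ge0//.
  rewrite [leRHS]mulrDr; apply: lerD.
    by rewrite powRM// ler_wpM2l ?powR_ge0// powR_mul_le.
  rewrite powRM//; apply: ler_pM; rewrite ?powR_ge0//.
    by apply: powR_le => //; lra.
  exact: powR_mul_le.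
rewrite expectZ; last exact: bmD.
have -> : moment_const2 * N `^ q = 8 `^ q * ((envelope_const * N `^ q +
   double_const * (envelope_const * N `^ q)) + (moment_const1 * N `^ q + moment_const1 * N `^ q)).
  by rewrite /moment_const2; ring.
rewrite ler_wpM2l ?powR_ge0// expectD// expectD// expectD//.
apply: lerD; apply: lerD.
- exact: moment_envelope.
- exact: moment_double.
- exact: moment_sum_max.
- exact: moment_sum_max.
Qed.

End SecondOrder.

End Moments.

(** * Regular set functions and coupling *)

Section RealLemmas.
Context {R : realType}.

(** The two inequalities are multiplied and [a' * b] is cancelled. If exactly one of these factors
    is zero, the inequality in which it bounds from above forces [a] or [m2] to vanish; if both are
    zero, this is what the implication supplies. *)
Lemma cancel_chain (a b a' b' m1 m2 e1 e2 : R) :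
  0 <= a -> 0 <= b -> 0 <= a' -> 0 <= b' -> 0 <= m1 -> 0 <= m2 ->
  0 <= e1 -> 0 <= e2 -> (a' = 0 -> b = 0 -> a = 0 \/ m2 = 0) ->
  a * b <= e1 * (a' * b') -> a' * m2 <= e2 * (m1 * b) ->
  a * m2 <= e1 * e2 * (m1 * b').
Proof.
move=> a0 b0 a'0 b'0 m10 m20 e10 e20 ac h1 h2.
have rhs0 : 0 <= e1 * e2 * (m1 * b') by rewrite !mulr_ge0.
have [a'E|a'N] := eqVneq a' 0.
  have [bE|bN] := eqVneq b 0.
    by have [->|->] := ac a'E bE; rewrite ?mul0r ?mulr0.
  move: h1; rewrite a'E mul0r mulr0 pmulr_lle0 ?lt_neqAle 1?eq_sym ?bN// => aE.
  by rewrite (_ : a = 0) ?mul0r//; apply: le_anti; rewrite aE.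
have a'P : 0 < a' by rewrite lt_neqAle eq_sym a'N.
have [bE|bN] := eqVneq b 0.
  move: h2; rewrite bE !mulr0 pmulr_rle0// => m2E.
  by rewrite (_ : m2 = 0) ?mulr0//; apply: le_anti; rewrite m2E.
have bP : 0 < b by rewrite lt_neqAle eq_sym bN.
rewrite -(ler_pM2r (mulr_gt0 a'P bP)).
have := ler_pM (mulr_ge0 a0 b0) (mulr_ge0 a'0 m20) h1 h2.
have -> : a * b * (a' * m2) = a * m2 * (a' * b) by ring.
by have -> : e1 * (a' * b') * (e2 * (m1 * b)) = e1 * e2 * (m1 * b') * (a' * b) by ring.
Qed.

(** Bernoulli's inequality with exponent 1 / (1 - dl). In [coupling_step] it shows that subtracting
    at most a proportion [dl] of a regular set function enlarges its constant at most by this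
    factor. *)
Lemma expR_bernoulli (dl u : R) : 0 <= dl < 1 -> 0 <= u ->
  expR u - 1 <= (1 - dl) * (expR (u / (1 - dl)) - 1).
Proof.
move=> /andP[d0 d1] u0; set s := (1 - dl)^-1.
have dp : 0 < 1 - dl by lra.
have s1 : 1 <= s by rewrite /s invf_ge1//; lra.
have := @powR_tangent R s 1 (expR u) s1 ler01 (expR_ge0 u).
rewrite !powR1 -expRM mulr1 => h.
have h2 : (1 - dl) * (1 - expR (u * s)) <= (1 - dl) * (s * (1 - expR u)).
  by rewrite ler_wpM2l// ltW.
have e : (1 - dl) * (s * (1 - expR u)) = 1 - expR u.
  by rewrite mulrA divff ?mul1r// gt_eqF.
move: h2; rewrite e; lra.
Qed.

End RealLemmas.

Section RegularSetFunctions.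
Context (disp : measure_display) (R : realType) (L : borelMetricType disp R).
Implicit Types (s lam : set L -> R) (E : set L).

(** Stated for real-valued set functions rather than measures, so that a multiple of the invariant
    measure can be subtracted freely. *)
Definition sigma_add s := forall G : nat -> set L,
  (forall i, measurable (G i)) -> trivIset setT G ->
  \sum_(0 <= i < n) s (G i) @[n --> \oo] --> s (\bigcup_i G i).

Definition within_dist (t : R) (E1 E2 : set L) :=
  forall x y, E1 x -> E2 y -> mdist x y <= t.

Variable eta : R.

(* If [s] has a density [phi] with respect to [lam], this expresses that
   [log phi] is [eta]-Hoelder with constant [K]. Unlike the density, this form
   is transported by branches that are bijective only up to null sets. *)
Definition regular lam K s :=
  (forall E, measurable E -> 0 <= s E) /\
  forall t E1 E2, 0 <= t -> measurable E1 -> measurable E2 -> within_dist t E1 E2 ->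
    s E1 * lam E2 <= expR (K * t `^ eta) * (lam E1 * s E2).

Lemma sigma_add_comp s (F : L -> L) : measurable_fun setT F ->
  sigma_add s -> sigma_add (fun E => s (F @^-1` E)).
Proof.
move=> mF sA G mG tG; rewrite preimage_bigcup; apply: (sA (fun i => F @^-1` G i)).
  by move=> i; rewrite -[X in measurable X]setTI; exact: mF.
apply/trivIsetP => i j _ _ ij; rewrite -preimage_setI.
by move/trivIsetP : tG => /(_ _ _ I I ij) ->; rewrite preimage_set0.
Qed.

Lemma sigma_add_sub s1 s2 (k : R) : sigma_add s1 -> sigma_add s2 ->
  sigma_add (fun E => s1 E - k * s2 E).
Proof.
move=> h1 h2 G mG tG.
under eq_fun do rewrite sumrB -mulr_sumr.
by apply: cvgB; [exact: h1 | apply: cvgMl_tmp; exact: h2].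
Qed.

Lemma sigma_add_fine (nu : {measure set L -> \bar R}) : (nu setT < +oo)%E ->
  sigma_add (fun E => fine (nu E)).
Proof.
move=> nufin G mG tG.
have fin E : measurable E -> nu E \is a fin_num.
  by move=> mE; rewrite ge0_fin_numE// (le_lt_trans _ nufin)// le_measure ?inE.
have mU : measurable (\bigcup_i G i) by exact: bigcup_measurable.
have := @measure_semi_sigma_additive _ _ _ nu G mG tG mU.
rewrite -(fineK (fin _ mU)) => /fine_cvgP[_].
apply: cvg_trans; apply: near_eq_cvg; near=> n => /=.
by rewrite sum_fine// => i _; exact: fin.
Unshelve. all: by end_near. Qed.

Variables (D : R) (bound : forall x y : L, mdist x y <= D).

Let D0 : 0 <= D.
Proof. by have := bound point point; rewrite mdistxx. Qed.

Hypotheses (eta01 : 0 < eta <= 1).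

Lemma dist_powR_le : D `^ eta <= 1 + D.
Proof.
have /andP[e0 e1] := eta01.
have h := D0.
apply: (@le_trans _ _ ((1 + D) `^ eta)); first by apply: powR_le; lra.
by apply: ler1_powR => //; lra.
Qed.

Lemma regular_bound lam K s E1 E2 : 0 <= K -> (forall E, measurable E -> 0 <= lam E) ->
  regular lam K s -> measurable E1 -> measurable E2 ->
  s E1 * lam E2 <= expR (K * (1 + D)) * (lam E1 * s E2).
Proof.
move=> K0 lam0 [s0 sr] mE1 mE2.
have := @sr D E1 E2 D0 mE1 mE2 (fun x y _ _ => bound x y) => h.
apply: (le_trans h); rewrite ler_wpM2r ?mulr_ge0 ?lam0 ?s0//.
by rewrite ler_expR ler_wpM2l// dist_powR_le.
Qed.

Lemma regular_le lam K K' s : (forall E, measurable E -> 0 <= lam E) ->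
  K <= K' -> regular lam K s -> regular lam K' s.
Proof.
move=> lam0 KK' [s0 sr]; split=> // t E1 E2 t0 mE1 mE2 tE.
apply: (le_trans (sr t E1 E2 t0 mE1 mE2 tE)).
by rewrite ler_wpM2r ?mulr_ge0 ?lam0 ?s0// ler_expR ler_wpM2r// powR_ge0.
Qed.

Variables (F : L -> L) (A : nat -> set L).
Hypotheses (mF : measurable_fun setT F) (mA : forall i, measurable (A i))
  (tA : trivIset setT A) (coverA : \bigcup_i A i = setT).

Definition branch i E := A i `&` F @^-1` E.

Lemma measurable_preimageF E : measurable E -> measurable (F @^-1` E).
Proof. by move=> mE; rewrite -[X in measurable X]setTI; exact: mF. Qed.

Lemma measurable_branch i E : measurable E -> measurable (branch i E).
Proof. by move=> mE; apply: measurableI => //; exact: measurable_preimageF. Qed.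

Lemma preimage_branch E : F @^-1` E = \bigcup_i branch i E.
Proof. by rewrite /branch -setI_bigcupl coverA setTI. Qed.

Lemma trivIset_branch E : trivIset setT (branch^~ E).
Proof.
apply/trivIsetP => i j _ _ ij; have /trivIsetP/(_ i j I I ij) AA := tA.
by rewrite /branch setIACA AA set0I.
Qed.

Lemma sigma_add_branch s E : sigma_add s -> measurable E ->
  \sum_(0 <= i < n) s (branch i E) @[n --> \oo] --> s (F @^-1` E).
Proof.
move=> sA mE; rewrite preimage_branch; apply: sA.
  by move=> i; exact: measurable_branch.
exact: trivIset_branch.
Qed.

Definition branch_regular lam K s := forall i t E1 E2, 0 <= t ->
  measurable E1 -> measurable E2 -> within_dist t E1 E2 ->
  s (branch i E1) * lam (branch i E2) <=
    expR (K * t `^ eta) * (lam (branch i E1) * s (branch i E2)).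

(* Says that each branch has a log-Hoelder jacobian for [lam]. *)
Definition bounded_distortion lam C := forall i t E1 E2, 0 <= t ->
  measurable E1 -> measurable E2 -> within_dist t E1 E2 ->
  lam (branch i E1) * lam E2 <= expR (C * t `^ eta) * (lam E1 * lam (branch i E2)).

(** The ratio of densities on the branch is multiplied by the ratio of jacobians, and the factors of
    [lam] on the branch cancel. The outcome is linear in [s], so that [push_regular] can sum it over
    the branches. *)
Lemma push_branch lam C K s i t E1 E2 : (forall E, measurable E -> 0 <= lam E) ->
  bounded_distortion lam C ->
  (forall E, measurable E -> 0 <= s E) ->
  (forall E, measurable E -> lam E = 0 -> s E = 0) ->
  branch_regular lam K s -> 0 <= t ->
  measurable E1 -> measurable E2 -> within_dist t E1 E2 ->
  s (branch i E1) * lam E2 <= expR ((K + C) * t `^ eta) * (lam E1 * s (branch i E2)).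
Proof.
move=> lam0 J s0 ac loc t0 mE1 mE2 tE; rewrite mulrDl expRD.
have mb1 := measurable_branch i mE1; have mb2 := measurable_branch i mE2.
apply: (@cancel_chain _ _ (lam (branch i E2)) (lam (branch i E1))) => //;
  rewrite ?expR_ge0 ?s0 ?lam0//; [by move=> h _; left; exact: ac | exact: loc | exact: J].
Qed.

Lemma push_regular lam C K s : (forall E, measurable E -> 0 <= lam E) ->
  bounded_distortion lam C -> sigma_add s ->
  (forall E, measurable E -> 0 <= s E) ->
  (forall E, measurable E -> lam E = 0 -> s E = 0) ->
  branch_regular lam K s -> regular lam (K + C) (fun E => s (F @^-1` E)).
Proof.
move=> lam0 J sA s0 ac loc; split=> [E mE|t E1 E2 t0 mE1 mE2 tE].
  by apply: s0; exact: measurable_preimageF.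
have c1 := sigma_add_branch sA mE1; have c2 := sigma_add_branch sA mE2.
rewrite mulrA.
apply: (ler_cvg_to (cvgMr_tmp (b := lam E2) c1)
  (cvgMl_tmp (a := expR ((K + C) * t `^ eta) * lam E1) c2)).
near=> n => /=; rewrite mulr_suml mulr_sumr; apply: ler_sum => i _.
by rewrite -mulrA; exact: push_branch.
Unshelve. all: by end_near. Qed.

Variable beta : R.
Hypotheses (beta1 : 1 < beta).

Let gamma : R := beta `^ (- eta).

Let gamma_bounds : 0 < gamma < 1.
Proof.
have b1 := beta1; have /andP[e0 _] := eta01; have b0 : 0 < beta by lra.
rewrite /gamma powR_gt0//= powRN invf_lt1 ?powR_gt0//.
by rewrite -(powRr0 beta) /powR gt_eqF// ltr_expR mul0r mulr_gt0// ln_gt0.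
Qed.

(** Null branches are exempt because the complement of [Y] will be one of the sets [A i]. *)
Definition expanding_branches lam := forall i,
  (forall x y, A i x -> A i y -> beta * mdist x y <= mdist (F x) (F y)) \/
  lam (A i) = 0.

Section Reference.
Variables (lam : set L -> R) (C : R).
Hypotheses (lam0 : forall E, measurable E -> 0 <= lam E) (lamT : 0 < lam setT)
  (lam_mono : forall E E', measurable E -> measurable E' -> E `<=` E' -> lam E <= lam E')
  (J : bounded_distortion lam C) (C0 : 0 <= C) (exp_lam : expanding_branches lam).

Lemma regular_null K s E : 0 <= K -> regular lam K s -> measurable E ->
  lam E = 0 -> s E = 0.
Proof.
move=> K0 rs mE lE; have [s0 _] := rs.
have := regular_bound K0 lam0 rs mE measurableT.
rewrite lE mul0r mulr0 pmulr_lle0// => h.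
by apply: le_anti; rewrite h s0.
Qed.

Lemma regular_branch K s : 0 <= K -> regular lam K s ->
  branch_regular lam (K * gamma) s.
Proof.
move=> K0 rs i t E1 E2 t0 mE1 mE2 tE; have [s0 sr] := rs.
have mb1 := measurable_branch i mE1; have mb2 := measurable_branch i mE2.
have b1 := beta1; have b0 : 0 < beta by lra.
have [ex|null] := exp_lam i; last first.
  have n1 : lam (branch i E1) = 0.
    apply: le_anti; rewrite lam0// andbT -null; apply: lam_mono => //.
    exact: subIsetl.
  by rewrite (regular_null K0 rs mb1 n1) mul0r !mulr_ge0 ?expR_ge0 ?lam0 ?s0.
have tb : 0 <= t / beta by rewrite divr_ge0// ltW.
have := sr (t / beta) (branch i E1) (branch i E2) tb mb1 mb2.
have -> : (t / beta) `^ eta = gamma * t `^ eta.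
  by rewrite powRM ?invr_ge0 ?(ltW b0)// mulrC /gamma -(powR_inv1 (ltW b0)) -powRrM mulN1r.
rewrite (mulrA K); apply => x y [Ax Fx] [Ay Fy].
by rewrite ler_pdivlMr// mulrC (le_trans (ex x y Ax Ay))// tE.
Qed.

Lemma push_regular_expanding K s : 0 <= K -> sigma_add s -> regular lam K s ->
  regular lam (K * gamma + C) (fun E => s (F @^-1` E)).
Proof.
move=> K0 sA rs; apply: push_regular => //; first by case: rs.
  by move=> E mE; exact: (regular_null K0 rs).
exact: regular_branch.
Qed.

Lemma preimage_iterS n E : (iter n F @^-1` (F @^-1` E)) = iter n.+1 F @^-1` E.
Proof. by []. Qed.

Lemma sigma_add_iter s n : sigma_add s -> sigma_add (fun E => s (iter n F @^-1` E)).
Proof.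
move=> sA; apply: sigma_add_comp => //; elim: n => [|n ih].
  exact: measurable_id.
exact: measurableT_comp.
Qed.

(** C / (1 - gamma) is the fixed point of the recursion K -> K * gamma + C given by
    [push_regular_expanding]. *)
Lemma push_iter K s n : 0 <= K -> sigma_add s -> regular lam K s ->
  regular lam (gamma ^+ n * K + C / (1 - gamma)) (fun E => s (iter n F @^-1` E)).
Proof.
move=> K0 sA rs; have /andP[g0 g1] := gamma_bounds.
have C0' := C0.
have Cg : 0 <= C / (1 - gamma) by rewrite divr_ge0//; lra.
have Kn m : 0 <= gamma ^+ m * K + C / (1 - gamma).
  by rewrite addr_ge0// mulr_ge0// exprn_ge0// ltW.
elim: n => [|n ih].
  by rewrite expr0 mul1r; apply: regular_le rs => //; rewrite lerDl.
have := push_regular_expanding (Kn n) (@sigma_add_iter _ n sA) ih.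
apply: regular_le => //.
rewrite exprS le_eqVlt; apply/orP; left; apply/eqP; field.
by rewrite subr_eq0 gt_eqF.
Qed.

(* Only [nu] itself is known to be invariant, not to be regular: it is
   approximated by regular set functions, which the dynamics makes uniformly
   regular. *)
Lemma invariant_regular nu : (forall E, measurable E -> 0 <= nu E) ->
  (forall E, measurable E -> nu (F @^-1` E) = nu E) ->
  (forall e : R, 0 < e -> exists K s, [/\ 0 <= K, sigma_add s, regular lam K s &
     forall E, measurable E -> `|nu E - s E| <= e]) ->
  regular lam (C / (1 - gamma) + 1) nu.
Proof.
move=> nu0 nuF approx; split=> // t E1 E2 t0 mE1 mE2 tE.
have /andP[g0 g1] := gamma_bounds.
set K0 := C / (1 - gamma) + 1.
have nuFn n E : measurable E -> nu (iter n F @^-1` E) = nu E.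
  move=> mE; elim: n E mE => [//|n ih] E mE.
  by rewrite -preimage_iterS ih ?nuF//; exact: measurable_preimageF.
have mFn n E : measurable E -> measurable (iter n F @^-1` E).
  move=> mE; elim: n E mE => [//|n ih] E mE.
  by rewrite -preimage_iterS; apply: ih; exact: measurable_preimageF.
set X := expR (K0 * t `^ eta).
have X0 : 0 <= X by exact: expR_ge0.
have l1 := lam0 mE1; have l2 := lam0 mE2.
apply/ler_addgt0Pr => e e0.
set e' := e / (X * lam E1 + lam E2 + 1).
have den : 0 < X * lam E1 + lam E2 + 1 by rewrite ltr_wpDl// addr_ge0// mulr_ge0.
have e'0 : 0 < e' by rewrite divr_gt0.
have [K [s [Kge0 sA rs nus]]] := approx e' e'0.
have gK : gamma ^+ n @[n --> \oo] --> (0 : R).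
  by apply: cvg_expr; rewrite ger0_norm// ltW.
(* However large the constant of the approximant is, after enough iterations it contributes at most
   1; this is the [+ 1] in the statement. The approximation error does not grow meanwhile, [nu]
   being invariant and the error uniform over all sets. *)
have [n _ hn] : \forall n \near \oo, gamma ^+ n <= (K + 1)^-1.
  by apply: (cvgr_le _ gK); rewrite invr_gt0; lra.
have gKn : gamma ^+ n * K <= 1.
  apply: (@le_trans _ _ ((K + 1)^-1 * K)).
    by apply: ler_wpM2r => //; apply: (hn n) => /=.
  by rewrite mulrC ler_pdivrMr ?mul1r; lra.
have KK : gamma ^+ n * K + C / (1 - gamma) <= K0 by rewrite /K0 addrC lerD2l.
have [_ sn] := regular_le lam0 KK (push_iter n Kge0 sA rs).
have h := sn t E1 E2 t0 mE1 mE2 tE.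
have a1 := nus _ (mFn n _ mE1); have a2 := nus _ (mFn n _ mE2).
rewrite !nuFn// in a1 a2.
set s1 := s _ in a1 h; set s2 := s (_ @^-1` E2) in a2 h.
have b1 : nu E1 <= s1 + e' by move: a1; rewrite ler_norml => /andP[_]; lra.
have b2 : s2 <= nu E2 + e' by move: a2; rewrite ler_norml => /andP[+ _]; lra.
have ee : e = e' * (X * lam E1 + lam E2 + 1) by rewrite /e' divfK// gt_eqF.
have c1 : nu E1 * lam E2 <= (s1 + e') * lam E2 by rewrite ler_wpM2r.
have c2 : X * (lam E1 * s2) <= X * (lam E1 * (nu E2 + e')) by rewrite !ler_wpM2l.
rewrite -/X in h.
have c3 : X * (lam E1 * (nu E2 + e')) = X * (lam E1 * nu E2) + e' * (X * lam E1) by ring.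
have c4 : (s1 + e') * lam E2 = s1 * lam E2 + e' * lam E2 by ring.
have c5 : e' * (X * lam E1 + lam E2 + 1) = e' * (X * lam E1) + e' * lam E2 + e' by ring.
rewrite ee c5; rewrite c4 in c1; rewrite c3 in c2.
lra.
Qed.

(** The coupling compares with the invariant measure, so the latter has to replace the reference
    measure. Pushing [nu] along a branch compares it with [lam] on the image at cost [K]; regularity
    of [nu], used with [E1] and [E2] exchanged, replaces [lam] by [nu] at cost [K] again. *)
Lemma distortion_transfer K nu : 0 <= K -> K * gamma + C <= K ->
  regular lam K nu -> bounded_distortion nu (K + K).
Proof.
move=> K0 Kg rnu i t E1 E2 t0 mE1 mE2 tE; have [nu0 nur] := rnu.
have mb1 := measurable_branch i mE1; have mb2 := measurable_branch i mE2.
have h1 : nu (branch i E1) * lam E2 <= expR (K * t `^ eta) * (lam E1 * nu (branch i E2)).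
  have := push_branch i lam0 J nu0 (fun E => @regular_null K nu E K0 rnu)
    (regular_branch K0 rnu) t0 mE1 mE2 tE.
  move/le_trans; apply; rewrite ler_wpM2r ?mulr_ge0 ?lam0 ?nu0//.
  by rewrite ler_expR ler_wpM2r// powR_ge0.
have tE' : within_dist t E2 E1 by move=> x y Ex Ey; rewrite metric_sym; exact: tE.
have h2 := nur t E2 E1 t0 mE2 mE1 tE'.
rewrite mulrDl expRD.
apply: (@cancel_chain _ _ (lam E2) (lam E1)) => //; rewrite ?expR_ge0 ?nu0 ?lam0//.
  by move=> _ l0; right; exact: (regular_null K0 rnu).
by rewrite mulrC (mulrC (nu E1)).
Qed.

End Reference.

(** * Exponential convergence by coupling with the invariant measure *)

Section Coupling.
Variables (mu : set L -> R) (C K : R).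
Hypotheses (mu0 : forall E, measurable E -> 0 <= mu E) (muT : mu setT = 1)
  (mu_mono : forall E E', measurable E -> measurable E' -> E `<=` E' -> mu E <= mu E')
  (mu_add : sigma_add mu) (muF : forall E, measurable E -> mu (F @^-1` E) = mu E)
  (J : bounded_distortion mu C) (C0 : 0 <= C) (exp_mu : expanding_branches mu)
  (KC : 2 * C / (1 - gamma) <= K).

(** The proportion that may be removed at each step: with this value the hypothesis [KC] gives K /
    (1 - delta) * gamma + C <= K, so one application of [F] restores the constant. *)
Let delta : R := (1 - gamma) / 2.

(** [delta] times the lower bound of [mass_le] for the ratio of a regular set function to its total
    mass times [mu]. *)
Definition coupling_rate : R := (1 - beta `^ (- eta)) / 2 * expR (- (K * (1 + D))).

Let kappa := coupling_rate.

Let K_ge0 : 0 <= K.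
Proof.
have /andP[g0 g1] := gamma_bounds; have C0' := C0.
by apply: le_trans KC; rewrite divr_ge0 ?mulr_ge0//; lra.
Qed.

Lemma coupling_rate_bounds : 0 < coupling_rate < 1.
Proof.
have /andP[g0 g1] := gamma_bounds; rewrite /coupling_rate -/gamma.
have e0 := expR_gt0 (- (K * (1 + D))).
have D0' := D0.
have e1 : expR (- (K * (1 + D))) <= 1.
  by rewrite -[leRHS]expR0 ler_expR oppr_le0 mulr_ge0 ?K_ge0//; lra.
rewrite mulr_gt0//=; last lra.
apply: (@le_lt_trans _ _ ((1 - gamma) / 2 * 1)); last lra.
by rewrite ler_wpM2l//; lra.
Qed.

Let mass_le s E : regular mu K s -> measurable E ->
  expR (- (K * (1 + D))) * (s setT * mu E) <= s E.
Proof.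
move=> rs mE; have := regular_bound K_ge0 mu0 rs measurableT mE.
rewrite muT mul1r => h.
rewrite expRN mulrC ler_pdivrMr ?expR_gt0//.
by rewrite (mulrC (s E)).
Qed.

(** The multiple of [mu] is removed before pushing forward. It is at most the proportion [delta] of
    [s], so the rest is regular with constant K / (1 - delta), and pushing forward brings the
    constant back to [K]. Invariance of [mu] then allows the removal to be written after the
    push. *)
Lemma coupling_step s : sigma_add s -> regular mu K s ->
  regular mu K (fun E => s (F @^-1` E) - kappa * s setT * mu E).
Proof.
move=> sA rs; have [s0 sr] := rs.
have /andP[g0 g1] := gamma_bounds; have C0' := C0.
have dl : 0 <= delta < 1 by rewrite /delta; apply/andP; split; lra.
have d1 : 0 < 1 - delta by rewrite /delta; lra.
have d0 : 0 <= delta by case/andP: dl.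
set m := s setT; have m0 : 0 <= m by exact: s0.
have small E : measurable E -> 0 <= kappa * m * mu E <= delta * s E.
  move=> mE; have /andP[/ltW k0 _] := coupling_rate_bounds.
  rewrite (mulr_ge0 (mulr_ge0 k0 m0) (mu0 mE))/=.
  have -> : kappa * m * mu E = delta * (expR (- (K * (1 + D))) * (m * mu E)).
    by rewrite /kappa /coupling_rate -/gamma /delta; ring.
  by rewrite ler_wpM2l// mass_le.
pose s' E := s E - kappa * m * mu E.
have s'0 E : measurable E -> 0 <= s' E.
  move=> mE; have /andP[_ h] := small E mE; rewrite subr_ge0 (le_trans h)//.
  by rewrite ler_piMl ?s0//; lra.
have rs' : regular mu (K / (1 - delta)) s'.
  split=> // t E1 E2 t0 mE1 mE2 tE.
  have /andP[y0 yx] := small E2 mE2.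
  have h := sr t E1 E2 t0 mE1 mE2 tE.
  have u0 : 0 <= K * t `^ eta by rewrite mulr_ge0// powR_ge0.
  have B := expR_bernoulli dl u0.
  have -> : K / (1 - delta) * t `^ eta = K * t `^ eta / (1 - delta) by rewrite mulrAC.
  set X := expR (K * t `^ eta) in h B; set X' := expR _ in B *.
  have X1 : 1 <= X by rewrite /X -[leLHS]expR0 ler_expR.
  have X'1 : 1 <= X'.
    by rewrite /X' -[leLHS]expR0 ler_expR divr_ge0// ltW.
  rewrite /s'; set y := kappa * m * mu E2 in y0 yx *.
  have e1 : (s E1 - kappa * m * mu E1) * mu E2 = s E1 * mu E2 - mu E1 * y.
    by rewrite /y; ring.
  have key : X * s E2 - y <= X' * (s E2 - y).
    have k1 : y * (X' - 1) <= delta * s E2 * (X' - 1) by rewrite ler_wpM2r//; lra.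
    have k2 : s E2 * (X - 1) <= s E2 * ((1 - delta) * (X' - 1)).
      by rewrite ler_wpM2l// s0.
    lra.
  have key2 : mu E1 * (X * s E2 - y) <= mu E1 * (X' * (s E2 - y)).
    by rewrite ler_wpM2l// mu0.
  rewrite e1.
  have -> : X' * (mu E1 * (s E2 - y)) = mu E1 * (X' * (s E2 - y)) by ring.
  apply: le_trans key2.
  have -> : mu E1 * (X * s E2 - y) = X * (mu E1 * s E2) - mu E1 * y by ring.
  by rewrite lerD2r.
have Kd0 : 0 <= K / (1 - delta) by rewrite divr_ge0// ltW.
have s'A : sigma_add s' by exact: sigma_add_sub.
have muT0 : 0 < mu setT by rewrite muT.
have := push_regular_expanding mu0 muT0 mu_mono J exp_mu Kd0 s'A rs'.
rewrite /s' => h.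
have {}h : regular mu K (fun E => s (F @^-1` E) - kappa * m * mu (F @^-1` E)).
  apply: regular_le h => //.
  have KC' := KC; rewrite ler_pdivrMr in KC'; last by lra.
  have -> : 1 - delta = (1 + gamma) / 2 by rewrite /delta; field.
  have e : K / ((1 + gamma) / 2) * gamma = K * (2 * gamma) / (1 + gamma).
    by field; lra.
  rewrite e -lerBrDr ler_pdivrMr; last by lra.
  have Kg : 0 <= (1 - gamma) * C by rewrite mulr_ge0//; lra.
  lra.
have [h0 hr] := h; split=> [E mE|t E1 E2 t0 mE1 mE2 tE].
  by rewrite -[mu E]muF//; exact: h0.
by rewrite -[X in _ - _ * X](muF mE1) -[X in _ * (_ - _ * X)](muF mE2); exact: hr.
Qed.

Lemma coupling_iter s n : sigma_add s -> regular mu K s ->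
  sigma_add (fun E => s (iter n F @^-1` E) - (1 - (1 - kappa) ^+ n) * s setT * mu E) /\
  regular mu K (fun E => s (iter n F @^-1` E) - (1 - (1 - kappa) ^+ n) * s setT * mu E).
Proof.
move=> sA rs; split; first by apply: sigma_add_sub => //; exact: sigma_add_iter.
elim: n => [|n ih].
  have -> : (fun E => s (iter 0 F @^-1` E) - (1 - (1 - kappa) ^+ 0) * s setT * mu E) = s.
    by apply/funext => E; rewrite expr0 subrr !mul0r subr0.
  by [].
have sAn : sigma_add (fun E => s (iter n F @^-1` E) - (1 - (1 - kappa) ^+ n) * s setT * mu E).
  by apply: sigma_add_sub => //; exact: sigma_add_iter.
have [p0 pr] := coupling_step sAn ih.
have eE E : measurable E ->
  s (iter n F @^-1` (F @^-1` E)) - (1 - (1 - kappa) ^+ n) * s setT * mu (F @^-1` E)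
  - kappa * (s (iter n F @^-1` setT) - (1 - (1 - kappa) ^+ n) * s setT * mu setT) * mu E
  = s (iter n.+1 F @^-1` E) - (1 - (1 - kappa) ^+ n.+1) * s setT * mu E.
  by move=> mE; rewrite muF// muT preimage_setT preimage_iterS exprS; ring.
split=> [E mE|t E1 E2 t0 mE1 mE2 tE]; first by rewrite -eE//; exact: p0.
by rewrite -(eE E1)// -(eE E2)//; exact: pr.
Qed.

(** What is left after [n] steps is nonnegative and regular, with total mass (1 - kappa)^n times
    that of [s]. Comparing it on [E] with the whole space makes the error proportional to [mu E],
    and therefore integrable against functions. *)
Lemma coupling s n E : sigma_add s -> regular mu K s -> measurable E ->
  `|s (iter n F @^-1` E) - s setT * mu E| <=
    expR (K * (1 + D)) * (1 - kappa) ^+ n * s setT * mu E.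
Proof.
move=> sA rs mE; have [_ rn] := coupling_iter n sA rs.
have [s0 _] := rs; have [sn0 _] := rn.
have m0 : 0 <= s setT by exact: s0.
have := regular_bound K_ge0 mu0 rn mE measurableT.
rewrite muT preimage_setT => up; have low := sn0 E mE.
have D0' := D0; have /andP[k0 k1] := coupling_rate_bounds.
have X1 : 1 <= expR (K * (1 + D)).
  by rewrite -[leLHS]expR0 ler_expR mulr_ge0 ?K_ge0//; lra.
set X := expR _ in X1 up *; set l := (1 - kappa) ^+ n in up low *.
have l0 : 0 <= l by rewrite exprn_ge0// subr_ge0 ltW.
have q0 : 0 <= l * s setT * mu E by rewrite !mulr_ge0 ?mu0.
have qX : l * s setT * mu E <= X * (l * s setT * mu E) by rewrite ler_peMl.
have e1 : X * (mu E * (s setT - (1 - l) * s setT * 1)) = X * (l * s setT * mu E) by ring.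
rewrite e1 in up.
have e2 : X * l * s setT * mu E = X * (l * s setT * mu E) by ring.
rewrite e2 ler_norml; apply/andP; split; lra.
Qed.

End Coupling.
End RegularSetFunctions.

(** * Approximation of densities by Lipschitz functions *)

Section LipschitzFunctions.
Context (disp : measure_display) (R : realType) (L : borelMetricType disp R).
Implicit Types phi g : L -> R.

Lemma open_measurable_borel (U : set L) : open U -> measurable U.
Proof.
by move=> oU; rewrite (@measurable_borel disp R L); exact: sub_sigma_algebra.
Qed.

Lemma semicontinuous_measurable phi :
  (forall x (e : R), 0 < e -> exists2 dl : R, 0 < dl & forall y, mdist x y < dl ->
     phi x - e < phi y) -> measurable_fun setT phi.
Proof.
move=> sc; apply: (measurability _ (RGenOInfty.measurableE R)).
move=> /= _ [_ [a ->]] <-; rewrite setTI; apply: open_measurable_borel.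
rewrite openE => x /=; rewrite in_itv/= andbT => ax.
have e0 : 0 < phi x - a by rewrite subr_gt0.
have [dl dl0 h] := sc x _ e0.
apply/nbhs_ballP; exists dl => //= y; rewrite ballEmdist/= => xy.
by rewrite in_itv/= andbT; have := h y xy; rewrite subKr.
Qed.

Definition bounded_lipschitz phi :=
  (exists2 k : R, 0 <= k & forall x y, `|phi x - phi y| <= k * mdist x y) /\
  exists B, forall x, `|phi x| <= B.

Lemma lipschitz_measurable phi : bounded_lipschitz phi -> measurable_fun setT phi.
Proof.
move=> [[k k0 kL] _]; apply: semicontinuous_measurable => x e e0.
have k1 : 0 < k + 1 by lra.
exists (e / (k + 1)) => [|y xy]; first by rewrite divr_gt0.
have := kL x y; rewrite ler_norml => /andP[_].
have : k * mdist x y <= (k + 1) * mdist x y by rewrite ler_wpM2r ?mdist_ge0//; lra.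
rewrite ltr_pdivlMr// mulrC in xy; lra.
Qed.

Lemma bounded_lipschitzD phi1 phi2 : bounded_lipschitz phi1 -> bounded_lipschitz phi2 ->
  bounded_lipschitz (fun x => phi1 x + phi2 x).
Proof.
move=> [[k1 k10 h1] [B1 b1]] [[k2 k20 h2] [B2 b2]]; split.
  exists (k1 + k2) => [|x y]; first exact: addr_ge0.
  rewrite opprD addrACA mulrDl (le_trans (ler_normD _ _))//.
  by apply: lerD.
by exists (B1 + B2) => x; rewrite (le_trans (ler_normD _ _))// lerD.
Qed.

Lemma bounded_lipschitzZ (a : R) phi : bounded_lipschitz phi ->
  bounded_lipschitz (fun x => a * phi x).
Proof.
move=> [[k k0 h] [B b]]; split.
  exists (`|a| * k) => [|x y]; first exact: mulr_ge0.
  by rewrite -mulrBr normrM -mulrA ler_wpM2l.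
by exists (`|a| * B) => x; rewrite normrM ler_wpM2l.
Qed.

Lemma bounded_lipschitz_cst (a : R) : bounded_lipschitz (fun=> a).
Proof.
split; last by exists `|a|.
by exists 0 => // x y; rewrite subrr normr0 mul0r.
Qed.

Variable U : set L.

(** The Pasch-Hausdorff envelope of the indicator, its largest [k]-Lipschitz minorant; for an open
    set it converges pointwise to the indicator. *)
Definition lip_indic (k : nat) x : R :=
  inf [set r | exists z : L, r = \1_U z + k%:R * mdist x z].

Let lip_set k x : has_inf [set r : R | exists z : L, r = \1_U z + k%:R * mdist x z].
Proof.
split; first by exists (\1_U x + k%:R * mdist x x); exists x.
by exists 0 => _ [z ->]; rewrite addr_ge0// mulr_ge0// mdist_ge0.
Qed.

Lemma lip_indic_le k x z : lip_indic k x <= \1_U z + k%:R * mdist x z.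
Proof. by apply: ge_inf; [case: (lip_set k x) | exists z]. Qed.

Lemma le_lip_indic k x c :
  (forall z, c <= \1_U z + k%:R * mdist x z) -> c <= lip_indic k x.
Proof.
move=> h; apply: lb_le_inf; first by case: (lip_set k x).
by move=> _ [z ->].
Qed.

Lemma lip_indic_bounds k x : 0 <= lip_indic k x <= 1.
Proof.
apply/andP; split.
  by apply: le_lip_indic => z; rewrite addr_ge0// mulr_ge0// mdist_ge0.
apply: (le_trans (lip_indic_le k x x)); rewrite mdistxx mulr0 addr0.
by rewrite indicE; case: (_ \in _).
Qed.

Lemma bounded_lip_indic k : bounded_lipschitz (lip_indic k).
Proof.
split; last first.
  by exists 1 => x; have /andP[h0 h1] := lip_indic_bounds k x; rewrite ger0_norm.
have half x y : lip_indic k x - lip_indic k y <= k%:R * mdist x y.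
  rewrite lerBlDr -lerBlDl; apply: le_lip_indic => z; rewrite lerBlDl.
  apply: (le_trans (lip_indic_le k x z)).
  have : k%:R * mdist x z <= k%:R * (mdist x y + mdist y z).
    by rewrite ler_wpM2l// metric_triangle.
  lra.
exists k%:R => // x y; rewrite ler_norml half andbT lerNl opprB metric_sym.
exact: half.
Qed.

Lemma lip_indic_cvg x : open U -> lip_indic k x @[k --> \oo] --> (\1_U x : R).
Proof.
move=> oU; have [xU|xU] := boolP (x \in U); last first.
  rewrite indicE (negbTE xU); apply: cvg_near_cst; near=> k; apply/le_anti.
  have /andP[-> _] := lip_indic_bounds k x; rewrite andbT.
  by rewrite (le_trans (lip_indic_le k x x))// mdistxx mulr0 addr0 indicE (negbTE xU).
have /nbhs_ballP[e /= e0 eU] : nbhs x U.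
  by apply: open_nbhs_nbhs; split => //; exact: set_mem.
rewrite indicE xU; apply: cvg_near_cst; near=> k; apply/le_anti.
have /andP[_ -> /=] := lip_indic_bounds k x.
apply: le_lip_indic => z; have [zU|zU] := boolP (z \in U).
  by rewrite indicE zU lerDl mulr_ge0// mdist_ge0.
rewrite indicE (negbTE zU) add0r.
have ez : e <= mdist x z.
  rewrite leNgt; apply: contra zU => xz; rewrite inE; apply: eU.
  by rewrite ballEmdist.
have ke : e^-1 <= k%:R by near: k; exact: nbhs_infty_ger.
have e0' := ltW e0; have ei : 0 <= e^-1 by rewrite invr_ge0.
apply: (@le_trans _ _ (e^-1 * e)); last exact: ler_pM.
by rewrite mulVf ?lt0r_neq0.
Unshelve. all: by end_near. Qed.

End LipschitzFunctions.

Section LipschitzApproximation.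
Context (disp : measure_display) (R : realType) (L : borelMetricType disp R).
Variable rho : {finite_measure set L -> \bar R}.
Implicit Types phi g : L -> R.

Definition l1_dist g phi : \bar R := (\int[rho]_x `|g x - phi x|%:E)%E.

Definition lip_approx g := forall e : R, 0 < e ->
  exists2 phi, bounded_lipschitz phi & (l1_dist g phi <= e%:E)%E.

Lemma l1_dist_triangle g1 g2 g3 : measurable_fun setT g1 -> measurable_fun setT g2 ->
  measurable_fun setT g3 -> (l1_dist g1 g3 <= l1_dist g1 g2 + l1_dist g2 g3)%E.
Proof.
move=> m1 m2 m3.
have mn (a b : L -> R) : measurable_fun setT a -> measurable_fun setT b ->
    measurable_fun setT (fun x => (`|a x - b x|%:E)).
  move=> ma mb; apply/measurable_EFinP; apply: measurableT_comp => //.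
  exact: measurable_funB.
rewrite /l1_dist -ge0_integralD//; [|exact: mn|exact: mn].
apply: ge0_le_integral => //; [exact: mn | |].
  by apply: emeasurable_funD; exact: mn.
by move=> x _; rewrite -EFinD lee_fin ler_distD.
Qed.

Lemma lip_approx_lipschitz phi : bounded_lipschitz phi -> lip_approx phi.
Proof.
move=> lphi e e0; exists phi => //; rewrite /l1_dist.
rewrite integral0_eq ?lee_fin ?ltW// => x _; by rewrite subrr normr0.
Qed.

Lemma lip_approxD g1 g2 : measurable_fun setT g1 -> measurable_fun setT g2 ->
  lip_approx g1 -> lip_approx g2 -> lip_approx (fun x => g1 x + g2 x).
Proof.
move=> m1 m2 h1 h2 e e0; have e20 : 0 < e / 2 by lra.
have [p1 l1 d1] := h1 _ e20; have [p2 l2 d2] := h2 _ e20.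
exists (fun x => p1 x + p2 x); first exact: bounded_lipschitzD.
have mp1 := lipschitz_measurable l1; have mp2 := lipschitz_measurable l2.
have mn (a b : L -> R) : measurable_fun setT a -> measurable_fun setT b ->
    measurable_fun setT (fun x => (`|a x - b x|%:E)).
  move=> ma mb; apply/measurable_EFinP; apply: measurableT_comp => //.
  exact: measurable_funB.
apply: (@le_trans _ _ (l1_dist g1 p1 + l1_dist g2 p2)%E); last first.
  by rewrite (splitr e) EFinD leeD.
rewrite /l1_dist -ge0_integralD//; [|exact: mn|exact: mn].
apply: ge0_le_integral => //.
- by apply: mn; exact: measurable_funD.
- by apply: emeasurable_funD; exact: mn.
- by move=> x _; rewrite -EFinD lee_fin opprD addrACA ler_normD.
Qed.

Lemma lip_approxZ (a : R) g : measurable_fun setT g ->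
  lip_approx g -> lip_approx (fun x => a * g x).
Proof.
move=> mg h e e0.
have ae : 0 < e / (`|a| + 1) by rewrite divr_gt0// ltr_wpDl.
have [p l dp] := h _ ae; exists (fun x => a * p x); first exact: bounded_lipschitzZ.
have mp := lipschitz_measurable l.
have mn : measurable_fun setT (fun x => (`|g x - p x|%:E)).
  apply/measurable_EFinP; apply: measurableT_comp => //; exact: measurable_funB.
rewrite /l1_dist.
under eq_integral => x _ do rewrite -mulrBr normrM EFinM.
rewrite ge0_integralZl_EFin//.
apply: (@le_trans _ _ (`|a|%:E * (e / (`|a| + 1))%:E)%E).
  by apply: lee_wpmul2l; rewrite ?lee_fin.
rewrite -EFinM lee_fin mulrA ler_pdivrMr ?ltr_wpDl// mulrC ler_wpM2l ?(ltW e0)//.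
by rewrite lerDl.
Qed.

Lemma lip_approx_lim (g_ : nat -> L -> R) g (G : L -> R) :
  (forall n, measurable_fun setT (g_ n)) -> measurable_fun setT g ->
  rho.-integrable setT (EFin \o G) -> (forall n x, `|g_ n x| <= G x) ->
  (forall x, g_ n x @[n --> \oo] --> g x) ->
  (forall n, lip_approx (g_ n)) -> lip_approx g.
Proof.
move=> mg_ mg iG gG gg h e e0; have e20 : 0 < e / 2 by lra.
have [_ cv _] := @dominated_convergence _ L R rho setT measurableT
  (fun n => EFin \o g_ n) (EFin \o g) (EFin \o G)
  (fun n => (measurable_EFinP _ _).2 (mg_ n)) ((measurable_EFinP _ _).2 mg)
  (aeW _ (fun x _ => cvg_comp _ _ (gg x) (fun _ h => h))) iG (aeW _ (fun x n _ => gG n x)).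
have /fine_cvgP[nfin ncv] := cv.
have nle := cvgr_le _ ncv _ e20.
have [n [/= n1 n2]] : exists n,
   l1_dist (g_ n) g \is a fin_num /\ fine (l1_dist (g_ n) g) <= e / 2.
  have : \forall n \near \oo, (l1_dist (g_ n) g \is a fin_num /\
      fine (l1_dist (g_ n) g) <= e / 2).
    by near=> n; split; near: n; [exact: nfin | exact: nle].
  by case=> N _ /(_ N (leqnn N)) ?; exists N.
have [p l dp] := h n _ e20; exists p => //.
have mp := lipschitz_measurable l.
apply: (le_trans (l1_dist_triangle mg (mg_ n) mp)).
rewrite (splitr e) EFinD leeD//.
rewrite -(fineK n1) in n2 *; rewrite (_ : l1_dist g (g_ n) = l1_dist (g_ n) g).
  by rewrite -(fineK n1) lee_fin.
by apply: eq_integral => x _; rewrite distrC.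
Unshelve. all: by end_near. Qed.

(** Only open sets are approximated by hand, through [lip_indic]. Dynkin's theorem does the rest,
    because the measurable sets are exactly the Borel sets. *)
Lemma lip_approx_indic (E : set L) : measurable E -> lip_approx (\1_E : L -> R).
Proof.
have int1 : rho.-integrable setT (EFin \o cst (1 : R)).
  apply: measurable_bounded_integrable => //.
    by rewrite ltey_eq fin_num_measure.
  by exists 1; split => // x /ltW x1 y _; rewrite /= normr1.
move=> mE; have : <<s (@open L) >> E by rewrite -(@measurable_borel disp R L).
apply: (dynkin_induction (G := @open L) (P := fun E => lip_approx (\1_E : L -> R))).
- exact: measurable_borel.
- by move=> A B; exact: openI.
- rewrite indicT; apply: lip_approx_lipschitz; exact: bounded_lipschitz_cst.
- move=> U oU; apply: (lip_approx_lim (g_ := lip_indic U) _ _ int1).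
  + by move=> n; apply: lipschitz_measurable; exact: bounded_lip_indic.
  + by apply: measurable_indic; exact: open_measurable_borel.
  + by move=> n x; have /andP[h0 h1] := lip_indic_bounds U n x; rewrite ger0_norm.
  + by move=> x; exact: lip_indic_cvg.
  + by move=> n; apply: lip_approx_lipschitz; exact: bounded_lip_indic.
- move=> A mA hA.
  rewrite (_ : \1_(~` A) = (fun x => 1 + -1 * \1_A x) :> (L -> R)).
    apply: lip_approxD => //; first exact: measurable_funM.
      by apply: lip_approx_lipschitz; exact: bounded_lipschitz_cst.
    exact: lip_approxZ.
  by apply/funext => x; rewrite indicC indicE; case: (x \in A) => /=; ring.
- move=> A mA tA hA.
  have mS n : measurable_fun setT (fun x => \sum_(i < n) (\1_(A i) x : R)).
    by apply: measurable_sum => i; exact: measurable_indic.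
  have SE n x : \sum_(i < n) (\1_(A i) x : R) = \1_(\big[setU/set0]_(i < n) A i) x.
    elim: n => [|n ih]; first by rewrite !big_ord0 indic0.
    rewrite !big_ord_recr/= ih !indicE in_setU.
    case: (boolP (x \in A n)) => [xA|_]; last by rewrite orbF addr0.
    rewrite (_ : (x \in _) = false) ?add0r//; apply/negbTE.
    rewrite notin_setE -bigcup_mkord => -[k /= kn xk].
    move/trivIsetP : tA => /(_ k n I I); rewrite neq_ltn kn => /(_ isT) /seteqP[+ _].
    by move=> /(_ x); apply; split => //; exact: set_mem.
  apply: (lip_approx_lim (g_ := fun n x => \sum_(i < n) (\1_(A i) x : R)) mS _ int1).
  + by apply: measurable_indic; exact: bigcup_measurable.
  + by move=> n x; rewrite SE indicE; case: (_ \in _); rewrite /= ?normr1 ?normr0.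
  + move=> x; apply: cvg_near_cst; have [xU|xU] := pselect ((\bigcup_k A k) x).
      have [k _ xk] := xU; exists k.+1 => // n /= kn.
      rewrite SE !indicE !mem_set//.
      by rewrite -bigcup_mkord; exists k.
    near=> n; rewrite SE !indicE !memNset//.
    by rewrite -bigcup_mkord => -[k _ xk]; apply: xU; exists k.
  + move=> n; elim: n => [|n ih].
      rewrite (_ : (fun x => _) = cst 0); last by apply/funext => x; rewrite big_ord0.
      by apply: lip_approx_lipschitz; exact: bounded_lipschitz_cst.
    rewrite (_ : (fun x => _) = (fun x => \sum_(i < n) (\1_(A i) x : R) + \1_(A n) x)).
      exact: lip_approxD.
    by apply/funext => x; rewrite big_ord_recr.
Unshelve. all: by end_near. Qed.

Import HBNNSimple.

Lemma lip_approx_integrable (h : L -> R) : (forall x, 0 <= h x) ->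
  rho.-integrable setT (EFin \o h) -> lip_approx h.
Proof.
move=> h0 ih; have mh : measurable_fun setT h.
  by apply/measurable_EFinP; case/integrableP: ih.
have [g [gnd gcv]] := approximation measurableT ((measurable_EFinP _ _).2 mh)
  (fun x _ => h0 x : (0 <= (h x)%:E)%E).
apply: (@lip_approx_lim (fun n x => g n x) h h) => //.
- move=> n x.
  have cx : (fun n => g n x) k @[k --> \oo] --> h x.
    exact: (fine_cvg (gcv x I)).
  rewrite ger0_norm// -(cvg_lim (@Rhausdorff R) cx); apply: (@nondecreasing_cvgn_le _ (fun n => g n x)).
    by move=> a b ab; have /lefP := gnd a b ab; apply.
  by apply/cvg_ex; exists (h x).
- by move=> x; exact: (fine_cvg (gcv x I)).
- move=> n; have [m [s sE]] : exists m (s : nat -> R), forall x,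
      g n x = \sum_(i < m) s i * \1_(g n @^-1` [set s i]) x.
    by eexists; eexists (fun i => nth 0 _ i); exact: fimfunEord.
  rewrite (_ : (fun x => g n x) =
    (fun x => \sum_(i < m) s i * \1_(g n @^-1` [set s i]) x)); last exact/funext.
  have mterm i : measurable_fun setT (fun x => s i * (\1_(g n @^-1` [set s i]) x : R)).
    by apply: measurable_funM => //; exact: measurable_indic.
  elim: m {sE} => [|m ihm].
    rewrite (_ : (fun x => _) = cst 0); last by apply/funext => x; rewrite big_ord0.
    by apply: lip_approx_lipschitz; exact: bounded_lipschitz_cst.
  rewrite (_ : (fun x => _) = (fun x => \sum_(i < m) (s i * \1_(g n @^-1` [set s i]) x)
       + s m * \1_(g n @^-1` [set s m]) x)).
    apply: lip_approxD => //; first by apply: measurable_sum.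
    by apply: lip_approxZ; [exact: measurable_indic | exact: lip_approx_indic].
  by apply/funext => x; rewrite big_ord_recr.
Qed.

End LipschitzApproximation.

(** * Measures given by densities, and passage from sets to functions *)

Section Density.
Context d (T : measurableType d) (R : realType) (nu : {measure set T -> \bar R}).
Variables (z : T -> R) (mz : measurable_fun setT z) (z0 : forall x, 0 <= z x).
Local Open Scope ereal_scope.

(** Measurability and nonnegativity are arguments so that the structure of a measure can be attached
    to this set function. *)
Definition mdensity of measurable_fun setT z & (forall x, (0 <= z x)%R) :=
  fun E : set T => \int[nu]_(x in E) (z x)%:E.

Local Notation M := (mdensity mz z0).

Let M0 : M set0 = 0. Proof. exact: integral_set0. Qed.

Let M_ge0 E : 0 <= M E. Proof. by apply: integral_ge0 => x _; rewrite lee_fin. Qed.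

Let M_sigma_additive : semi_sigma_additive M.
Proof.
move=> F mF tF mUF.
have mz' D : measurable_fun D (fun x => (z x)%:E).
  by apply: measurable_funTS; exact/measurable_EFinP.
have z0' x : 0 <= (z x)%:E by rewrite lee_fin.
rewrite /mdensity (ge0_integral_bigcup nu mF (mz' _) (fun x _ => z0' x) tF).
apply: is_cvg_ereal_nneg_natsum => n _.
by apply: integral_ge0 => x _; rewrite lee_fin.
Qed.

HB.instance Definition _ := isMeasure.Build _ _ _ M M0 M_ge0 M_sigma_additive.

Let mzE : measurable_fun setT (fun x => (z x)%:E).
Proof. exact/measurable_EFinP. Qed.

Let integral_mdensity_simple m (s : nat -> R) (E : nat -> set T) :
  (forall i, (0 <= s i)%R) -> (forall i, measurable (E i)) ->
  \int[M]_x (\sum_(i < m) s i * \1_(E i) x)%R%:E =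
  \int[nu]_x ((\sum_(i < m) s i * \1_(E i) x)%R%:E * (z x)%:E).
Proof.
move=> s0 mE.
pose S k x := (\sum_(i < k) s i * \1_(E i) x)%R.
pose I i x := (s i * \1_(E i) x)%R.
have mI i : measurable_fun setT (fun x => (I i x)%:E).
  by apply/measurable_EFinP; apply: measurable_funM => //; exact: measurable_indic.
have mS k : measurable_fun setT (fun x => (S k x)%:E).
  apply/measurable_EFinP; apply: measurable_sum => i; apply/measurable_EFinP; exact: mI.
have I0 i x : (0 <= I i x)%R by rewrite mulr_ge0.
have S0 k x : (0 <= S k x)%R by apply: sumr_ge0 => i _; exact: I0.
have SS k x : S k.+1 x = (S k x + I k x)%R by rewrite /S big_ord_recr.
rewrite -/(S m); elim: m => [|m ih].
  rewrite !integral0_eq// => x _; rewrite /S big_ord0 ?mul0e//.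
transitivity (\int[M]_x ((S m x)%:E + (I m x)%:E)).
  by apply: eq_integral => x _; rewrite -/(S _ x) SS EFinD.
rewrite ge0_integralD//=; [|by move=> *; rewrite lee_fin|by move=> *; rewrite lee_fin].
rewrite ih.
transitivity (\int[nu]_x ((S m x)%:E * (z x)%:E + (I m x)%:E * (z x)%:E)); last first.
  by apply: eq_integral => x _; rewrite -/(S _ x) SS EFinD ge0_muleDl ?lee_fin.
rewrite ge0_integralD//=; first last.
- exact: emeasurable_funM.
- by move=> x _; rewrite -EFinM lee_fin mulr_ge0.
- exact: emeasurable_funM.
- by move=> x _; rewrite -EFinM lee_fin mulr_ge0.
congr (_ + _).
transitivity (\int[M]_x ((s m)%:E * (\1_(E m) x)%:E)).
  by apply: eq_integral => x _; rewrite -EFinM.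
transitivity (\int[nu]_x ((s m)%:E * ((\1_(E m) x)%:E * (z x)%:E))); last first.
  by apply: eq_integral => x _; rewrite muleA -EFinM.
rewrite !ge0_integralZl_EFin//; first last.
- by apply/measurable_EFinP; exact: measurable_indic.
- by apply: emeasurable_funM => //; apply/measurable_EFinP; exact: measurable_indic.
- by move=> x _; rewrite -EFinM lee_fin mulr_ge0.
rewrite integral_indic// setIT; congr (_ * _).
transitivity (\int[nu]_(x in E m) (z x)%:E) => //; rewrite integral_mkcond.
apply: eq_integral => x _; rewrite /patch indicE.
by case: (x \in E m); rewrite ?mul1e ?mul0e.
Qed.

Import HBNNSimple.

Lemma integral_mdensity (f : T -> \bar R) : measurable_fun setT f ->
  (forall x, 0 <= f x) -> \int[M]_x f x = \int[nu]_x (f x * (z x)%:E).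
Proof.
move=> mf f0.
have [g [gnd gcv]] := approximation measurableT mf (fun x _ => f0 x).
have mg n : measurable_fun setT (fun x => (g n x)%:E) by exact/measurable_EFinP.
have gE n : \int[M]_x (g n x)%:E = \int[nu]_x ((g n x)%:E * (z x)%:E).
  have [m [s sE]] : exists m (s : nat -> R), forall x,
      g n x = (\sum_(i < m) s i * \1_(g n @^-1` [set s i]) x)%R.
    by eexists; eexists (fun i => nth 0%R _ i); exact: fimfunEord.
  (* On a nonempty fibre [s i] is a value of [g n], hence nonnegative; the positive part makes the
     coefficients nonnegative for all indices without changing the sum. *)
  have sE' x : g n x = (\sum_(i < m) Num.max (s i) 0 * \1_(g n @^-1` [set s i]) x)%R.
    rewrite sE; apply: eq_bigr => i _; rewrite !indicE.
    case: (boolP (x \in _)); rewrite ?mulr0// inE/= => gx.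
    by rewrite (elimT max_idPl)// -gx.
  transitivity (\int[M]_x (\sum_(i < m) Num.max (s i) 0 * \1_(g n @^-1` [set s i]) x)%R%:E).
    by apply: eq_integral => x _; rewrite -sE'.
  rewrite [LHS](@integral_mdensity_simple m (fun i => Num.max (s i) 0%R)
    (fun i => g n @^-1` [set s i])).
  - by apply: eq_integral => x _; rewrite -sE'.
  - by move=> i; rewrite le_max lexx orbT.
  - by [].
have glim x : limn (fun n => (g n x)%:E) = f x by apply/cvg_lim => //; exact: gcv.
have gzlim x : limn (fun n => (g n x)%:E * (z x)%:E) = f x * (z x)%:E.
  by apply/cvg_lim => //; apply: cvgeZr => //; exact: gcv.
transitivity (limn (fun n => \int[M]_x (g n x)%:E)).
  rewrite -monotone_convergence//.
  - by apply: eq_integral => x _; rewrite glim.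
  - by move=> n x _; rewrite lee_fin.
  - by move=> x _ a b ab; rewrite lee_fin; have /lefP := gnd a b ab; apply.
transitivity (limn (fun n => \int[nu]_x ((g n x)%:E * (z x)%:E))).
  by congr (limn _); apply/funext => n; exact: gE.
rewrite -monotone_convergence//.
- by apply: eq_integral => x _; rewrite gzlim.
- by move=> n; exact: emeasurable_funM.
- by move=> n x _; rewrite -EFinM lee_fin mulr_ge0.
- move=> x _ a b ab; rewrite lee_wpmul2r ?lee_fin//.
  by have /lefP := gnd a b ab; apply.
Qed.

End Density.

Section TransferOfBounds.
Context d (T : measurableType d) (R : realType) (nu : {measure set T -> \bar R}).
Variables (G : T -> T) (z : T -> R).
Hypotheses (mG : measurable_fun setT G) (mz : measurable_fun setT z)
  (z0 : forall x, 0 <= z x).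
Local Open Scope ereal_scope.

Let integral_push h : measurable_fun setT h -> (forall x, 0 <= h x) ->
  \int[pushforward (mdensity nu mz z0) G]_x h x = \int[nu]_x (h (G x) * (z x)%:E).
Proof.
move=> mh h0; have mhG : measurable_fun setT (h \o G) by exact: measurableT_comp.
rewrite (ge0_integral_pushforward mG _ measurableT mh (fun x _ => h0 x)).
by rewrite preimage_setT (integral_mdensity nu mz z0 mhG (fun x => h0 _)).
Qed.

(** An inequality between a pushed-forward measure and [c] times [nu], integrated. This and
    [integral_push_ge] carry the coupling bounds from sets to observables. *)
Lemma integral_push_le (c : R) h : (0 <= c)%R ->
  (forall E, measurable E -> \int[nu]_(x in G @^-1` E) (z x)%:E <= c%:E * nu E) ->
  measurable_fun setT h -> (forall x, 0 <= h x) ->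
  \int[nu]_x (h (G x) * (z x)%:E) <= c%:E * \int[nu]_x h x.
Proof.
move=> c0 le mh h0; rewrite -integral_push//.
rewrite -[c]/((NngNum c0)%:num) -ge0_integral_mscale//.
by apply: ge0_le_measure_integral => // E mE; exact: le.
Qed.

Lemma integral_push_ge (c : R) h : (0 <= c)%R ->
  (forall E, measurable E -> c%:E * nu E <= \int[nu]_(x in G @^-1` E) (z x)%:E) ->
  measurable_fun setT h -> (forall x, 0 <= h x) ->
  c%:E * \int[nu]_x h x <= \int[nu]_x (h (G x) * (z x)%:E).
Proof.
move=> c0 le mh h0; rewrite -integral_push//.
rewrite -[c]/((NngNum c0)%:num) -ge0_integral_mscale//.
by apply: ge0_le_measure_integral => // E mE; exact: le.
Qed.

End TransferOfBounds.

Section IntegralComparison.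
Context d (T : measurableType d) (R : realType) (nu : {measure set T -> \bar R}).
Local Open Scope ereal_scope.

(** The pointwise inequality is integrated over [x] in [A] and [y] in [B]; this turns a bound on the
    ratios of a density into the product form used for regular set functions. *)
Lemma integral_comparison (A B : set T) (z : T -> R) (c : R) :
  measurable A -> measurable B -> measurable_fun A z -> measurable_fun B z ->
  (forall x, A x -> (0 <= z x)%R) -> (forall x, B x -> (0 <= z x)%R) ->
  (0 <= c)%R -> (forall x y, A x -> B y -> (z x <= c * z y)%R) ->
  \int[nu]_(x in A) (z x)%:E * nu B <= c%:E * (nu A * \int[nu]_(x in B) (z x)%:E).
Proof.
move=> mA mB mzA mzB zA zB c0 zz.
have zA' x : A x -> 0 <= (z x)%:E by move=> ?; rewrite lee_fin zA.
have zB' x : B x -> 0 <= (z x)%:E by move=> ?; rewrite lee_fin zB.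
have mA' : measurable_fun A (EFin \o z) by exact/measurable_EFinP.
have mB' : measurable_fun B (EFin \o z) by exact/measurable_EFinP.
rewrite -ge0_integralZr//.
have -> : c%:E * (nu A * \int[nu]_(x in B) (z x)%:E) =
    \int[nu]_(x in A) (cst (c%:E * \int[nu]_(x in B) (z x)%:E)) x.
  by rewrite integral_cst// -muleA [in RHS](muleC _ (nu A)).
apply: ge0_le_integral => //.
- by move=> x Ax; rewrite mule_ge0// zA'.
- by apply: emeasurable_funM.
- move=> x Ax; rewrite -integral_cst// -ge0_integralZl_EFin//.
  apply: ge0_le_integral => //; first by move=> y By; exact: zA'.
    exact: measurable_funeM.
  by move=> y By; rewrite /= -EFinM lee_fin zz.
Qed.

End IntegralComparison.

(** * Approximation of an absolutely continuous measure by regular set functions *)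

Section RegularApproximation.
Context (disp : measure_display) (R : realType) (L : borelMetricType disp R).
Variables (rho : {finite_measure set L -> \bar R}) (nu : {finite_measure set L -> \bar R}).
Variables (eta D : R) (Y : set L).
Hypotheses (eta01 : 0 < eta <= 1) (bound : forall x y : L, mdist x y <= D)
  (mY : measurable Y) (nuY : nu (~` Y) = 0%E) (nurho : nu `<< rho).

Let lam E := fine (rho (E `&` Y)).

(** A Lipschitz function bounded below by [e] has a logarithm with Lipschitz constant k / e. Bounded
    distance makes it Hoelder: d = d^(1-eta) d^eta, and d^(1-eta) is at most 1 + D. *)
Lemma lipschitz_regular (psi : L -> R) (k e : R) : 0 <= k -> 0 < e ->
  bounded_lipschitz psi ->
  (forall x y, `|psi x - psi y| <= k * mdist x y) -> (forall x, e <= psi x) ->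
  sigma_add (fun E => fine (\int[rho]_(x in E `&` Y) (psi x)%:E)%E) /\
  regular eta lam (k / e * (1 + D)) (fun E => fine (\int[rho]_(x in E `&` Y) (psi x)%:E)%E).
Proof.
move=> k0 e0 lpsi psiL psie.
have D0 : 0 <= D by have := bound point point; rewrite mdistxx.
have mpsi := lipschitz_measurable lpsi.
have psi0 x : 0 <= psi x by rewrite (le_trans _ (psie x))// ltW.
have mpsiE E : measurable_fun E psi by exact: measurable_funTS.
have fin E : measurable E -> (\int[rho]_(x in E `&` Y) (psi x)%:E)%E \is a fin_num.
  move=> mE; have mEY := measurableI _ _ mE mY.
  have [_ [B psiB]] := lpsi.
  rewrite ge0_fin_numE; last by apply: integral_ge0 => x _; rewrite lee_fin.
  apply: (@le_lt_trans _ _ (\int[rho]_(x in E `&` Y) B%:E)%E).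
    apply: ge0_le_integral => //.
    + by move=> x _; rewrite lee_fin.
    + by apply/measurable_EFinP.
    + by move=> x _; rewrite lee_fin (le_trans (ler_norm _)).
  rewrite integral_cst//= ltey_eq fin_numM ?fin_num_measure//.
split.
- move=> G mG tG; have mU : measurable (\bigcup_i G i) by exact: bigcup_measurable.
  have mGY i : measurable (G i `&` Y) by exact: measurableI.
  have tGY : trivIset setT (fun i => G i `&` Y) by exact: trivIset_setIr.
  have := @ge0_integral_bigcup _ _ _ rho _ (fun x => (psi x)%:E) mGY _ _ tGY.
  rewrite -setI_bigcupl => h.
  have {}h : (\int[rho]_(x in (\bigcup_i G i) `&` Y) (psi x)%:E =
      \sum_(i <oo) \int[rho]_(x in G i `&` Y) (psi x)%:E)%E.
    by apply: h => [|x _]; [apply/measurable_EFinP | rewrite lee_fin].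
  have cv : (\sum_(0 <= i < n) \int[rho]_(x in G i `&` Y) (psi x)%:E)%E @[n --> \oo]
     --> (\int[rho]_(x in (\bigcup_i G i) `&` Y) (psi x)%:E)%E.
    rewrite h; apply: is_cvg_ereal_nneg_natsum => n _.
    by apply: integral_ge0 => x _; rewrite lee_fin.
  rewrite -(fineK (fin _ mU)) in cv; move/fine_cvgP : cv => [_].
  apply: cvg_trans; apply: near_eq_cvg; near=> n => /=.
  by rewrite sum_fine// => i _; exact: fin.
- split=> [E mE|t E1 E2 t0 mE1 mE2 tE].
    by apply: fine_ge0; apply: integral_ge0 => x _; rewrite lee_fin.
  have m1 := measurableI _ _ mE1 mY; have m2 := measurableI _ _ mE2 mY.
  have tk x y : (E1 `&` Y) x -> (E2 `&` Y) y ->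
     psi x <= expR (k / e * (1 + D) * t `^ eta) * psi y.
    move=> [E1x _] [E2y _].
    set dd := mdist x y; have dd0 : 0 <= dd by exact: mdist_ge0.
    have /andP[et0 et1] := eta01.
    have dt : dd <= (1 + D) * t `^ eta.
      have [->|dn] := eqVneq dd 0; first by rewrite mulr_ge0 ?powR_ge0//; lra.
      have -> : dd = dd `^ (1 - eta) * dd `^ eta.
        rewrite -powRD; last by rewrite dn implybT.
        by rewrite subrK powRr1.
      have dtt : dd <= t by exact: tE.
      apply: ler_pM; rewrite ?powR_ge0//; last by apply: powR_le => //; exact: ltW.
      apply: (@le_trans _ _ ((1 + D) `^ (1 - eta))).
        by apply: powR_le => //; [lra | have := bound x y; rewrite -/dd; lra].
      by apply: ler1_powR; lra.
    have h1 : psi x <= psi y + k * dd.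
      by have := psiL x y; rewrite -/dd ler_norml => /andP[_]; lra.
    have h2 : k * dd <= k / e * (1 + D) * t `^ eta * psi y.
      have -> : k / e * (1 + D) * t `^ eta * psi y =
         (k * ((1 + D) * t `^ eta)) * (psi y / e) by ring.
      apply: (@le_trans _ _ (k * ((1 + D) * t `^ eta))); first by rewrite ler_wpM2l.
      rewrite ler_peMr//; first by rewrite !mulr_ge0 ?powR_ge0//; lra.
      by rewrite ler_pdivlMr// mul1r.
    have h3 := expR_ge1Dx (k / e * (1 + D) * t `^ eta).
    have : (1 + k / e * (1 + D) * t `^ eta) * psi y <=
        expR (k / e * (1 + D) * t `^ eta) * psi y by rewrite ler_wpM2r.
    lra.
  rewrite -lee_fin !EFinM !fineK ?fin_num_measure ?fin//.
  exact: (integral_comparison rho m1 m2 (mpsiE _) (mpsiE _) (fun x _ => psi0 x)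
    (fun x _ => psi0 x) (expR_ge0 _) tk).
Unshelve. all: by end_near. Qed.

(** The constant [K] may blow up as [e] tends to 0. This is harmless, since the bound of
    [invariant_regular] does not involve it. *)
Lemma regular_approximation (e : R) : 0 < e -> exists K s,
  [/\ 0 <= K, sigma_add s, regular eta lam K s &
     forall E, measurable E -> `|fine (nu E) - s E| <= e].
Proof.
move=> e0.
have D0 : 0 <= D by have := bound point point; rewrite mdistxx.
have [h0 [hpos hfin hint hE]] := radon_nikodym_sigma_finite nurho.
pose h x := fine (h0 x).
have hh x : (h x)%:E = h0 x by rewrite fineK.
have hge0 x : 0 <= h x by rewrite -lee_fin hh.
have ih : rho.-integrable setT (EFin \o h).
  by apply: eq_integrable hint => // x _ /=; rewrite hh.
have e20 : 0 < e / 2 by lra.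
have [phi lphi dphi] := lip_approx_integrable hge0 ih e20.
set V := fine (rho setT).
have V0 : 0 <= V by exact: fine_ge0.
(* The shift by [e'] keeps the density away from 0, as its logarithm requires, and changes the mass
   of any set by at most e / 2; the [+ 1] avoids a zero denominator. *)
pose e' := e / 2 / (V + 1).
have e'0 : 0 < e' by rewrite divr_gt0// ltr_wpDl.
pose psi x := Num.max (phi x) 0 + e'.
have [[k k0 kL] [B phiB]] := lphi.
(* Taking positive parts is a contraction: it keeps the Lipschitz constant and, [h] being
   nonnegative, does not increase the distance to [h]. *)
have maxlip (a b : R) : `|Num.max a 0 - Num.max b 0| <= `|a - b|.
  have h1 := ler_norm (a - b); have h2 := ler_norm (b - a); rewrite distrC in h2.
  have h3 := normr_ge0 (a - b); rewrite ler_norml.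
  by case: (leP a 0) => a0; case: (leP b 0) => b0; apply/andP; split; lra.
have psiL x y : `|psi x - psi y| <= k * mdist x y.
  rewrite /psi opprD addrACA subrr addr0.
  exact: le_trans (maxlip _ _) (kL x y).
have psie x : e' <= psi x by rewrite lerDr le_max lexx orbT.
have lpsi : bounded_lipschitz psi.
  split; first by exists k.
  exists (B + e') => x; rewrite (le_trans (ler_normD _ _))// (gtr0_norm e'0) lerD2r.
  rewrite ger0_norm ?le_max ?lexx ?orbT// ge_max (le_trans (ler_norm _) (phiB x))/=.
  exact: le_trans (phiB x).
have [sA sr] := lipschitz_regular k0 e'0 lpsi psiL psie.
exists (k / e' * (1 + D)), (fun E => fine (\int[rho]_(x in E `&` Y) (psi x)%:E)%E).
split => //; first by rewrite !mulr_ge0 ?invr_ge0 ?(ltW e'0)//; lra.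
move=> E mE; have mEY := measurableI _ _ mE mY.
have nuE : nu E = nu (E `&` Y).
  rewrite -[E in LHS](setIT E) -(setUv Y) setIUr measureU//; last 2 first.
  - by apply: measurableI => //; exact: measurableC.
  - by rewrite setIACA setICr setI0.
  rewrite [X in (_ + X)%E](_ : _ = 0%E) ?adde0//.
  apply/eqP; rewrite -measure_le0 -nuY le_measure ?inE//.
  - by apply: measurableI => //; exact: measurableC.
  - exact: measurableC.
have mpsi := lipschitz_measurable lpsi.
have mphi := lipschitz_measurable lphi.
have mh : measurable_fun setT h by apply/measurable_EFinP; case/integrableP: ih.
have ipsi : rho.-integrable setT (EFin \o psi).
  apply: measurable_bounded_integrable => //; first by rewrite ltey_eq fin_num_measure.
  have [_ [B' b']] := lpsi.
  by exists B'; split=> [|x Bx y _]; [exact: num_real | exact: le_trans (b' y) (ltW Bx)].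
have ipsiE : rho.-integrable (E `&` Y) (EFin \o psi) by exact: integrableS ipsi.
have ihE : rho.-integrable (E `&` Y) (EFin \o h) by exact: integrableS ih.
have -> : fine (nu E) = \int[rho]_(x in E `&` Y) h x.
  by rewrite nuE hE// /Rintegral; congr fine; apply: eq_integral => x _; rewrite hh.
rewrite -/(Rintegral rho (E `&` Y) psi) -RintegralB//.
rewrite -lee_fin EFin_normr_Rintegral//; last exact: (integrableB mEY ihE ipsiE).
apply: (le_trans (le_abse_integral _ _ _)) => //.
  by apply/measurable_EFinP; apply: measurable_funB; exact: measurable_funTS.
have mdiff : measurable_fun setT (fun x => `|h x - phi x|%:E).
  apply/measurable_EFinP; apply: measurableT_comp => //; exact: measurable_funB.
apply: (@le_trans _ _ (\int[rho]_(x in setT) (`|h x - phi x|%:E + e'%:E))%E).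
  apply: (@le_trans _ _ (\int[rho]_(x in setT) `|(h x - psi x)%:E|)%E).
    apply: ge0_subset_integral => //.
    by apply: measurableT_comp => //; apply/measurable_EFinP; exact: measurable_funB.
  apply: ge0_le_integral => //.
  - by apply: measurableT_comp => //; apply/measurable_EFinP; exact: measurable_funB.
  - exact: emeasurable_funD.
  - move=> x _; rewrite -EFinD /= lee_fin /psi opprD addrA.
    rewrite (le_trans (ler_normB _ _))// (gtr0_norm e'0) lerD2r.
    by rewrite -[h x in leLHS](elimT max_idPl (hge0 x)); exact: maxlip.
rewrite ge0_integralD//; last by move=> x _; rewrite lee_fin ltW.
rewrite (splitr e) EFinD; apply: leeD; first exact: dphi.
rewrite integral_cst//= -(fineK (fin_num_measure rho _ measurableT)) -EFinM lee_fin.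
rewrite -/V /e' mulrAC ler_pdivrMr ?ltr_wpDl// ler_wpM2l ?(ltW e20)//.
by rewrite lerDl.
Qed.

End RegularApproximation.

(** * Decay of correlations on the base *)

Section NatFamilies.
Context d1 d2 (X : measurableType d1) (Z : measurableType d2).

(** Measurability of the induced map, of the block sums and of functions on the tower reduces to
    this countable case distinction. *)
Lemma measurable_nat_family (N : X -> nat) (g : nat -> X -> Z) :
  measurable_fun setT N -> (forall n, measurable_fun setT (g n)) ->
  measurable_fun setT (fun x => g (N x) x).
Proof.
move=> mN mg _ B mB; rewrite setTI.
have -> : (fun x => g (N x) x) @^-1` B = \bigcup_n ((N @^-1` [set n]) `&` (g n @^-1` B)).
  apply/seteqP; split=> [x /= Bx|x [n _ [/= Nx gx]]]; first by exists (N x).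
  by rewrite /= Nx.
apply: bigcup_measurable => n _; apply: measurableI.
  by rewrite -[X in measurable X]setTI; exact: mN.
by rewrite -[X in measurable X]setTI; exact: mg.
Qed.

End NatFamilies.

Section IteratedMeasurable.
Context d (X : measurableType d) (R : realType).

Lemma measurable_nat_real (N : X -> nat) : measurable_fun setT N ->
  measurable_fun setT (fun x => (N x)%:R : R).
Proof.
move=> mN; apply: (measurable_nat_family (g := fun n _ => n%:R : R) mN) => n.
exact: measurable_cst.
Qed.

Lemma measurable_nat_sum (N : X -> nat) (g : nat -> X -> R) :
  measurable_fun setT N -> (forall n, measurable_fun setT (g n)) ->
  measurable_fun setT (fun x => \sum_(i < N x) g i x).
Proof.
move=> mN mg; apply: (measurable_nat_family (g := fun n x => \sum_(i < n) g i x) mN).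
by move=> n; exact: measurable_sum.
Qed.

End IteratedMeasurable.

Section BaseSystem.
Context (disp : measure_display) (R : realType) (L : borelMetricType disp R).
Variables (mu : probability L R) (T : L -> L) (tau : L -> nat) (A : nat -> set L).
Variables (beta eta C1 C D t2 : R).
Hypotheses (mT : measurable_fun setT T) (mtau : measurable_fun setT tau)
  (tau1 : forall y, (1 <= tau y)%N)
  (mA : forall i, measurable (A i)) (tA : trivIset setT A)
  (coverA : \bigcup_i A i = setT).
Let F := induced_map T tau.
Let m E := fine (mu E).
Hypotheses (muF : forall E, measurable E -> mu (F @^-1` E) = mu E)
  (bound : forall x y : L, mdist x y <= D) (eta01 : 0 < eta <= 1) (beta1 : 1 < beta)
  (C11 : 1 <= C1) (C0 : 0 <= C).
Hypothesis branches : forall i, mu (A i) = 0%E \/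
  [/\ forall x y, A i x -> A i y -> tau x = tau y,
      forall x y, A i x -> A i y -> beta * mdist x y <= mdist (F x) (F y) &
      forall x y, A i x -> A i y -> forall l, (l < tau x)%N ->
         mdist (iter l T x) (iter l T y) <= C1 * mdist (F x) (F y)].
Hypotheses (J : bounded_distortion eta F A m C)
  (tau_sq : (\int[mu]_x ((tau x)%:R ^+ 2)%:E <= t2%:E)%E).

Local Notation E := (expect mu).
Local Notation bm := (@bounded_measurable _ L R).

Lemma measurable_induced : measurable_fun setT F.
Proof.
apply: (measurable_nat_family (g := fun n => iter n T) mtau) => n.
exact: measurable_iter.
Qed.

Let mF := measurable_induced.

Lemma measurable_induced_iter n : measurable_fun setT (iter n F).
Proof. exact: measurable_iter. Qed.

Let mtauR : measurable_fun setT (fun y => (tau y)%:R : R).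
Proof. exact: measurable_nat_real. Qed.

Lemma tau_integrable2 : mu.-integrable setT (fun x => ((tau x)%:R ^+ 2)%:E).
Proof.
apply/integrableP; split; first by apply/measurable_EFinP; exact: measurable_funX.
under eq_integral => x _ do rewrite gee0_abs ?lee_fin ?sqr_ge0//.
exact: le_lt_trans tau_sq (ltry _).
Qed.

Let le_tau_sq x : (tau x)%:R <= (tau x)%:R ^+ 2 :> R.
Proof. by rewrite expr2 ler_peMl// ler1n. Qed.

Lemma le_tau_integrable (g : L -> R) (B : R) : measurable_fun setT g ->
  (forall x, `|g x| <= B * (tau x)%:R ^+ 2) -> mu.-integrable setT (EFin \o g).
Proof.
move=> mg gB.
have i2 : mu.-integrable setT (fun x => (B%:E * ((tau x)%:R ^+ 2)%:E)%E).
  by apply: integrableZl => //; exact: tau_integrable2.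
apply: (le_integrable measurableT _ _ i2); first exact/measurable_EFinP.
by move=> x _ /=; rewrite lee_fin (le_trans (gB x))// ler_norm.
Qed.

Definition tau_mean : R := E (fun y => (tau y)%:R).

Lemma tau_integrable : mu.-integrable setT (EFin \o (fun x => (tau x)%:R : R)).
Proof.
by apply: (le_tau_integrable (B := 1)) => // x; rewrite mul1r normr_nat.
Qed.

Lemma tau_mean_ge1 : 1 <= tau_mean.
Proof.
rewrite -[leLHS](expect_cst mu); apply: le_Rintegral => //.
- by apply: bm_integrable; exact: bm_cst.
- exact: tau_integrable.
- by move=> x _; rewrite ler1n.
Qed.

Lemma tau_mean_le : tau_mean <= t2.
Proof.
rewrite -lee_fin; apply: le_trans tau_sq; rewrite /tau_mean /expect /Rintegral.
rewrite fineK; last exact: (integrable_fin_num _ tau_integrable).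
apply: ge0_le_integral => //; try by move=> x _; rewrite lee_fin.
- exact/measurable_EFinP.
- by apply/measurable_EFinP; exact: measurable_funX.
Qed.

Let m0 B : measurable B -> 0 <= m B. Proof. by move=> _; exact: fine_ge0. Qed.

Let mT1 : m setT = 1.
Proof. exact: (congr1 fine (probability_setT mu)). Qed.

Let mfin B : measurable B -> mu B \is a fin_num.
Proof. exact: fin_num_measure. Qed.

Let mmono B B' : measurable B -> measurable B' -> B `<=` B' -> m B <= m B'.
Proof. by move=> mB mB' BB'; rewrite fine_le ?mfin// le_measure// inE. Qed.

Let madd : sigma_add m.
Proof. by apply: sigma_add_fine; rewrite ltey_eq fin_num_measure. Qed.

Let mFm B : measurable B -> m (F @^-1` B) = m B.
Proof. by move=> mB; rewrite /m muF. Qed.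

Let exp_m : expanding_branches F A beta m.
Proof. by move=> i; case: (branches i) => [n|[_ ex _]]; [right; rewrite /m n|left]. Qed.

Let gamma := beta `^ (- eta).

(** It must exceed both 2 C / (1 - gamma), the condition of the coupling, and C1 + C, the constant
    of a weight after one push; see [KC] and [KCC]. *)
Definition coupling_const : R := 2 * (C + C1) / (1 - beta `^ (- eta)).

Definition decay_rate : R := 1 - coupling_rate eta D beta coupling_const.

Definition decay_const : R := expR (coupling_const * (1 + D)).

Let gamma01 : 0 < gamma < 1.
Proof.
have b1 := beta1; have /andP[e0 _] := eta01; have b0 : 0 < beta by lra.
rewrite /gamma powR_gt0//= powRN invf_lt1 ?powR_gt0//.
by rewrite -(powRr0 beta) /powR gt_eqF// ltr_expR mul0r mulr_gt0// ln_gt0.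
Qed.

Let KC : 2 * C / (1 - beta `^ (- eta)) <= coupling_const.
Proof.
have /andP[g0 g1] := gamma01; have C11' := C11.
rewrite /coupling_const ler_wpM2r// ?invr_ge0 ?subr_ge0 ?(ltW g1)//; lra.
Qed.

Let KCC : C1 + C <= coupling_const.
Proof.
have /andP[g0 g1] := gamma01; have C11' := C11; have C0' := C0.
rewrite /coupling_const -/gamma ler_pdivlMr ?subr_gt0//.
have : 0 <= (C1 + C) * gamma by rewrite mulr_ge0 ?addr_ge0// ?(ltW g0)//; lra.
lra.
Qed.

Lemma decay_rate_bounds : 0 <= decay_rate < 1.
Proof.
have /andP[k0 k1] := coupling_rate_bounds bound eta01 beta1 C0 KC.
by rewrite /decay_rate; apply/andP; split; lra.
Qed.

Section WeightDecay.
Variable psi : L -> R.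
Hypotheses (mpsi : measurable_fun setT psi) (psi0 : forall y, 0 <= psi y)
  (psi3 : forall y, psi y <= 3 * (tau y)%:R)
  (psi_holder : forall i t x y, mu (A i) <> 0%E -> 0 <= t -> A i x -> A i y ->
     mdist (F x) (F y) <= t -> psi x <= expR (C1 * t `^ eta) * psi y).

Let ipsi : mu.-integrable setT (EFin \o psi).
Proof.
apply: (le_tau_integrable (B := 3)) => // x; rewrite ger0_norm//.
by rewrite (le_trans (psi3 x))// ler_wpM2l.
Qed.

Let M : {measure set L -> \bar R} := mdensity mu mpsi psi0.

Let MT : (M setT < +oo)%E.
Proof.
have /integrableP[_] := ipsi; apply: le_lt_trans.
rewrite le_eqVlt; apply/orP; left; apply/eqP; apply: eq_integral => x _ /=.
by rewrite ger0_norm.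
Qed.

Let s B := fine (M B).

Let ME B : M B = (\int[mu]_(x in B) (psi x)%:E)%E. Proof. by []. Qed.

Let sfin B : measurable B -> M B \is a fin_num.
Proof.
by move=> mB; rewrite ge0_fin_numE// (le_lt_trans _ MT)// le_measure// inE.
Qed.

(** The weight is controlled only within each branch, and in terms of distances between images. One
    application of [F] turns this into regularity, which is why the decay estimates start with
    [iter n.+1 F]. *)
Let s_push_regular : regular eta m coupling_const (fun B => s (F @^-1` B)).
Proof.
have sadd : sigma_add s by exact: sigma_add_fine.
have s0 B : measurable B -> 0 <= s B by move=> _; exact: fine_ge0.
have snull B : measurable B -> m B = 0 -> s B = 0.
  move=> mB mB0; rewrite /s ME.
  have mu0 : mu B = 0%E by rewrite -(fineK (mfin mB)) -/(m B) mB0.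
  have -> : (\int[mu]_(x in B) (psi x)%:E = \int[mu]_(x in B) cst 0 x)%E.
    apply: ge0_ae_eq_integral => //.
    + by apply/measurable_EFinP; exact: measurable_funTS.
    + by move=> x _; rewrite lee_fin.
    + exists B; split => // x /=; apply: contra_notP => nBx Bx.
      by exfalso; exact: nBx.
  by rewrite integral0.
have loc : branch_regular eta F A m C1 s.
  move=> i t B1 B2 t0 mB1 mB2 tB.
  have mb1 := measurable_branch mF mA i mB1; have mb2 := measurable_branch mF mA i mB2.
  have [null|nn] := pselect (mu (A i) = 0%E).
    have b0 : m (branch F A i B1) = 0.
      apply: le_anti; rewrite m0// andbT.
      have -> : 0 = m (A i) by rewrite /m null.
      by apply: mmono => //; exact: subIsetl.
    by rewrite (snull _ mb1 b0) b0 mul0r mul0r mulr0.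
  rewrite -lee_fin !EFinM /s /m !fineK ?mfin ?sfin//.
  apply: (integral_comparison mu mb1 mb2) => //; try exact: measurable_funTS.
  move=> x y [Ax Fx] [Ay Fy]; apply: (psi_holder nn t0 Ax Ay).
  exact: tB.
apply: (regular_le m0 KCC).
exact: (push_regular mF mA tA coverA m0 J sadd s0 snull loc).
Qed.

Let mass := s setT.

Let mass_ge0 : 0 <= mass. Proof. exact: fine_ge0. Qed.

Let s_coupling n B : measurable B ->
  `|s (iter n.+1 F @^-1` B) - mass * m B| <= decay_const * decay_rate ^+ n * mass * m B.
Proof.
move=> mB.
have sadd : sigma_add s by exact: sigma_add_fine.
have := coupling bound eta01 mF mA tA coverA beta1 m0 mT1 mmono madd mFm J C0 exp_m KC
  n (sigma_add_comp mF sadd) s_push_regular mB.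
rewrite preimage_setT (_ : iter n.+1 F @^-1` B = F @^-1` (iter n F @^-1` B))//.
by apply/seteqP; split=> x; rewrite /preimage/= -iterSr.
Qed.

Lemma weight_mass : mass = E psi. Proof. by []. Qed.

Lemma weight_decay n h : bm h -> (forall y, 0 <= h y) ->
  `|E (fun y => h (iter n.+1 F y) * psi y) - E psi * E h| <=
    decay_const * decay_rate ^+ n * E psi * E h.
Proof.
move=> bh h0; rewrite -weight_mass.
have [mh [B hB]] := bh.
have /andP[d0 d1] := decay_rate_bounds.
have e0 : 0 <= decay_const * decay_rate ^+ n.
  by rewrite mulr_ge0 ?expR_ge0// exprn_ge0.
set eps := decay_const * decay_rate ^+ n in e0 *.
have mFn := measurable_induced_iter n.+1.
have mhE : measurable_fun setT (fun y => (h y)%:E) by exact/measurable_EFinP.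
have h0E y : (0 <= (h y)%:E)%E by rewrite lee_fin.
have sc B' : measurable B' -> (1 - eps) * mass * m B' <= s (iter n.+1 F @^-1` B') /\
   s (iter n.+1 F @^-1` B') <= (1 + eps) * mass * m B'.
  move=> mB'; have := s_coupling n mB'; rewrite -/eps ler_norml => /andP[].
  by move=> ? ?; split; lra.
have mpre B' : measurable B' -> measurable (iter n.+1 F @^-1` B').
  by move=> mB'; rewrite -[X in measurable X]setTI; exact: mFn.
have ihp : mu.-integrable setT (EFin \o (fun y => h (iter n.+1 F y) * psi y)).
  apply: (le_tau_integrable (B := `|B| * 3)).
    by apply: measurable_funM => //; exact: (measurableT_comp mh mFn).
  move=> x; rewrite normrM -mulrA ler_pM// ?(le_trans (hB _))// ?ler_norm//.
  by rewrite ger0_norm// (le_trans (psi3 x))// ler_wpM2l.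
have EhE : (\int[mu]_y (h y)%:E = (E h)%:E)%E.
  by rewrite /expect /Rintegral fineK// (integrable_fin_num _ (bm_integrable mu bh)).
have EpE : (\int[mu]_y ((h (iter n.+1 F y))%:E * (psi y)%:E) =
    (E (fun y => h (iter n.+1 F y) * psi y))%:E)%E.
  by rewrite /expect /Rintegral fineK// (integrable_fin_num _ ihp).
have Eh0 : 0 <= E h by exact: expect_ge0.
have up : E (fun y => h (iter n.+1 F y) * psi y) <= (1 + eps) * mass * E h.
  rewrite -lee_fin EFinM -EhE -EpE.
  apply: (integral_push_le mFn mpsi psi0 (c := (1 + eps) * mass)) => //.
    by rewrite mulr_ge0// addr_ge0.
  move=> B' mB'; have [_] := sc B' mB'; rewrite -lee_fin EFinM /m (fineK (mfin mB')).
  by rewrite /s (fineK (sfin (mpre _ mB'))).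
have low : (1 - eps) * mass * E h <= E (fun y => h (iter n.+1 F y) * psi y).
  (* For [eps > 1] the constant 1 - eps is negative, outside the scope of [integral_push_ge], and
     positivity of the integral suffices. *)
  have [e1|e1] := leP eps 1; last first.
    apply: (@le_trans _ _ 0).
      by rewrite -mulrA nmulr_rle0 ?subr_lt0// mulr_ge0.
    by apply: expect_ge0 => y; rewrite mulr_ge0.
  rewrite -lee_fin EFinM -EhE -EpE.
  apply: (integral_push_ge mFn mpsi psi0 (c := (1 - eps) * mass)) => //.
    by rewrite mulr_ge0// subr_ge0.
  move=> B' mB'; have [+ _] := sc B' mB'; rewrite -lee_fin EFinM /m (fineK (mfin mB')).
  by rewrite /s (fineK (sfin (mpre _ mB'))).
by rewrite ler_norml; apply/andP; split; lra.
Qed.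

End WeightDecay.

Section ObservableDecay.
Variable v : L -> R.
Hypotheses (mv : measurable_fun setT v) (v1 : forall x, `|v x| <= 1)
  (v_holder : forall x y, `|v x - v y| <= mdist x y `^ eta).

Definition block_sum y : R := \sum_(l < tau y) v (iter l T y).

Let V := block_sum.

Lemma measurable_block_sum : measurable_fun setT block_sum.
Proof.
apply: (measurable_nat_sum (g := fun l y => v (iter l T y)) mtau) => l.
by apply: (measurableT_comp mv); exact: measurable_iter.
Qed.

Lemma block_sum_le y : `|block_sum y| <= (tau y)%:R.
Proof.
apply: (le_trans (ler_norm_sum _ _ _)); rewrite -[leRHS]mulr1n.
apply: (@le_trans _ _ (\sum_(l < tau y) 1)); first by apply: ler_sum => l _.
by rewrite sumr_const card_ord.
Qed.

Lemma block_sum_integrable : mu.-integrable setT (EFin \o block_sum).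
Proof.
apply: (le_tau_integrable (B := 1)) => [|x]; first exact: measurable_block_sum.
by rewrite mul1r (le_trans (block_sum_le x)).
Qed.

Hypothesis V_mean0 : E V = 0.

(* [V] is a difference of two positive weights whose logarithms are Hoelder on
   the branches. *)
Let psi1 y := V y + 2 * (tau y)%:R.
Let psi2 y := 2 * (tau y)%:R : R.

Let psi1_bounds y : (tau y)%:R <= psi1 y <= 3 * (tau y)%:R.
Proof. by have := block_sum_le y; rewrite /psi1 /V ler_norml => /andP[? ?]; apply/andP; split; lra. Qed.

(** The block sums at [x] and [y] differ by at most C1 t^eta for each of the [tau y] terms, while
    [psi1 y] is at least [tau y]; so the relative change is bounded independently of [tau]. This
    uses (C1 t)^eta <= C1 t^eta, valid as [C1 >= 1] and [eta <= 1]. *)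
Let psi1_holder i t x y : mu (A i) <> 0%E -> 0 <= t -> A i x -> A i y ->
  mdist (F x) (F y) <= t -> psi1 x <= expR (C1 * t `^ eta) * psi1 y.
Proof.
move=> nn t0 Ax Ay dt; have [//|[tauE _ back]] := branches i.
have C11' := C11; have /andP[et0 et1] := eta01.
have tE := tauE x y Ax Ay.
have dV : V x - V y <= (tau y)%:R * (C1 * t `^ eta).
  rewrite /V /block_sum tE -sumrB.
  apply: (@le_trans _ _ (\sum_(l < tau y) (C1 * t `^ eta))); last first.
    by rewrite sumr_const card_ord mulr_natl.
  apply: ler_sum => l _; apply: le_trans (ler_norm _) _.
  apply: le_trans (v_holder _ _) _.
  apply: (@le_trans _ _ ((C1 * t) `^ eta)).
    apply: powR_le; rewrite ?mdist_ge0// ?(ltW et0)//.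
    apply: le_trans (back x y Ax Ay l _) _; first by rewrite tE.
    by rewrite ler_wpM2l//; lra.
  rewrite powRM//; last lra.
  by rewrite ler_wpM2r ?powR_ge0// ler1_powR.
have /andP[p1 _] := psi1_bounds y.
have h : psi1 x - psi1 y <= C1 * t `^ eta * psi1 y.
  have -> : psi1 x - psi1 y = V x - V y by rewrite /psi1 tE; ring.
  apply: (le_trans dV); rewrite mulrC ler_wpM2l// mulr_ge0 ?powR_ge0//; lra.
have : (1 + C1 * t `^ eta) * psi1 y <= expR (C1 * t `^ eta) * psi1 y.
  by rewrite ler_wpM2r ?expR_ge1Dx// (le_trans _ p1).
lra.
Qed.

Lemma block_sum_decay n h : bm h -> (forall y, 0 <= h y) ->
  `|E (fun y => h (iter n.+1 F y) * block_sum y)| <=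
    4 * tau_mean * decay_const * decay_rate ^+ n * E h.
Proof.
move=> bh h0; have [mh [B hB]] := bh.
have mpsi2 : measurable_fun setT psi2 by exact: measurable_funM.
have mpsi1 : measurable_fun setT psi1.
  by apply: measurable_funD => //; exact: measurable_block_sum.
have psi10 y : 0 <= psi1 y by have /andP[+ _] := psi1_bounds y; apply: le_trans.
have psi13 y : psi1 y <= 3 * (tau y)%:R by case/andP: (psi1_bounds y).
have psi20 y : 0 <= psi2 y by rewrite mulr_ge0.
have psi23 y : psi2 y <= 3 * (tau y)%:R by rewrite ler_wpM2r// ler_nat.
have psi2h i t x y : mu (A i) <> 0%E -> 0 <= t -> A i x -> A i y ->
  mdist (F x) (F y) <= t -> psi2 x <= expR (C1 * t `^ eta) * psi2 y.
  move=> nn t0 Ax Ay dt; have [//|[tauE _ _]] := branches i.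
  rewrite /psi2 (tauE x y Ax Ay) ler_peMl// -[leLHS]expR0 ler_expR.
  by rewrite mulr_ge0 ?powR_ge0// (le_trans ler01 C11).
have w1 := weight_decay mpsi1 psi10 psi13 psi1_holder n bh h0.
have w2 := weight_decay mpsi2 psi20 psi23 psi2h n bh h0.
have mFn := measurable_induced_iter n.+1.
have int (z : L -> R) : measurable_fun setT z -> (forall y, `|z y| <= 3 * (tau y)%:R) ->
  mu.-integrable setT (EFin \o (fun y => h (iter n.+1 F y) * z y)).
  move=> mz z3; apply: (le_tau_integrable (B := `|B| * 3)).
    by apply: measurable_funM => //; exact: (measurableT_comp mh mFn).
  move=> x; rewrite normrM -mulrA ler_pM// ?(le_trans (hB _))// ?ler_norm//.
  by rewrite (le_trans (z3 x))// ler_wpM2l.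
have i1 : mu.-integrable setT (EFin \o (fun y => h (iter n.+1 F y) * psi1 y)).
  by apply: int => // y; rewrite ger0_norm.
have i2 : mu.-integrable setT (EFin \o (fun y => h (iter n.+1 F y) * psi2 y)).
  by apply: int => // y; rewrite ger0_norm.
(* Both weights have the same mass because [V] has mean zero, so their limits cancel in the
   difference and the two errors add up to the factor 4. *)
have e2 : E psi2 = 2 * tau_mean.
  by rewrite /E /expect /psi2 RintegralZl//; exact: tau_integrable.
have e1 : E psi1 = 2 * tau_mean.
  rewrite -e2 -[RHS]add0r -V_mean0 /expect -RintegralD//.
    exact: block_sum_integrable.
  apply: (le_tau_integrable (B := 2)) => // x.
  by rewrite ger0_norm ?psi20// /psi2 ler_wpM2l.
have -> : E (fun y => h (iter n.+1 F y) * block_sum y) =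
   E (fun y => h (iter n.+1 F y) * psi1 y) - E (fun y => h (iter n.+1 F y) * psi2 y).
  rewrite /expect -RintegralB//; apply: eq_Rintegral => y _.
  by rewrite /psi1 /psi2 -/V; ring.
move: w1 w2; rewrite e1 e2 !ler_norml => /andP[? ?] /andP[? ?].
by apply/andP; split; lra.
Qed.

End ObservableDecay.

Definition mixing_const : R := expR (C * (1 + D)).

(** Bounded distortion with the whole space as second set: the branch and the image under [F] are
    independent up to a constant factor. *)
Let branch_mixing i B : measurable B ->
  m (branch F A i B) <= mixing_const * m (A i) * m B.
Proof.
move=> mB; have D0 : 0 <= D by have := bound point point; rewrite mdistxx.
have := J i D0 mB measurableT (fun x y _ _ => bound x y).
rewrite mT1 mulr1 {2}/branch preimage_setT setIT => /le_trans; apply.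
rewrite (mulrC (m B)) mulrA ler_wpM2r ?m0// ler_wpM2r ?m0// ler_expR ler_wpM2l//.
exact: dist_powR_le bound eta01.
Qed.

Section QuasiIndependence.
Variables (w : nat -> R) (w0 : forall k, 0 <= w k) (wle : forall k, w k <= k%:R).

Let mw : measurable_fun setT (fun y => w (tau y)).
Proof. by apply: (measurable_nat_family (g := fun k _ => w k) mtau) => k; exact: measurable_cst. Qed.

Let w0E x : (0 <= (w (tau x))%:E)%E. Proof. by rewrite lee_fin. Qed.

Let mwE B : measurable_fun B (fun x => (w (tau x))%:E).
Proof. by apply/measurable_EFinP; exact: measurable_funTS. Qed.

Lemma return_weight_integrable : mu.-integrable setT (EFin \o (fun y => w (tau y))).
Proof.
apply: (le_tau_integrable (B := 1)) => // x; rewrite mul1r ger0_norm//.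
by rewrite (le_trans (wle _)).
Qed.

Local Open Scope ereal_scope.

Let branch_integral i B : measurable B -> \int[mu]_(x in branch F A i B) (w (tau x))%:E <=
  mixing_const%:E * mu B * \int[mu]_(x in A i) (w (tau x))%:E.
Proof.
move=> mB; have mbr := measurable_branch mF mA i mB.
have mix : mu (branch F A i B) <= mixing_const%:E * mu (A i) * mu B.
  rewrite -(fineK (mfin mbr)) -(fineK (mfin (mA i))) -(fineK (mfin mB)) -!EFinM lee_fin.
  exact: branch_mixing.
have [null|[tauE _ _]] := branches i.
  rewrite null_set_integral//; last first.
  - apply: subset_measure0 null => //; exact: subIsetl.
  by rewrite !mule_ge0 ?lee_fin ?expR_ge0//; apply: integral_ge0.
have [A0|/set0P[x0 Ax0]] := eqVneq (A i) set0.
  by rewrite /branch A0 set0I !integral_set0 mule0.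
have cstE B' : measurable B' -> B' `<=` A i ->
    \int[mu]_(x in B') (w (tau x))%:E = (w (tau x0))%:E * mu B'.
  move=> mB' sB'; rewrite -integral_cst//; apply: eq_integral => x; rewrite inE => /sB' Ax.
  by rewrite (tauE x x0).
rewrite (cstE (branch F A i B))//; last exact: subIsetl.
rewrite (cstE (A i))// muleCA muleAC.
by rewrite lee_wpmul2l// lee_fin.
Qed.

(** Since [tau] is constant on each non-null branch, the bound for a branch applies to the weight as
    well, and the sum over the branches separates functions of [tau] from functions of [F]. *)
Lemma quasi_independence h : measurable_fun setT h -> (forall x, 0 <= h x) ->
  \int[mu]_y (h (F y) * (w (tau y))%:E) <=
  (mixing_const * E (fun y => w (tau y)))%:E * \int[mu]_y h y.
Proof.
move=> mh h0; apply: (integral_push_le mF mw (fun y => w0 (tau y))) => //.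
  by rewrite mulr_ge0 ?expR_ge0//; apply: Rintegral_ge0.
move=> B mB.
have EE : (E (fun y => w (tau y)))%:E = \int[mu]_y (w (tau y))%:E.
  by rewrite /expect /Rintegral fineK// (integrable_fin_num _ return_weight_integrable).
rewrite EFinM EE (preimage_branch F coverA) ge0_integral_bigcup//; first last.
- exact: trivIset_branch.
- by move=> i; exact: measurable_branch.
rewrite -[in leRHS]coverA ge0_integral_bigcup//.
have muB : mu B = (m B)%:E by rewrite /m (fineK (mfin mB)).
rewrite muleAC [X in _ * X * _](muB : _ = _) -EFinM -nneseriesZl; last by move=> *; apply: integral_ge0.
apply: lee_nneseries => [i _ _|i _]; first exact: integral_ge0.
by rewrite EFinM -muB; exact: branch_integral.
Qed.

End QuasiIndependence.
End BaseSystem.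

(** * The tower *)

HB.instance Definition _ (R : realType) := isSFinite.Build _ nat R (@counting nat R)
  (sfinite_measure_sigma_finite (sigma_finite_counting R)).

Section Preserving.
Context d (X : measurableType d) (R : realType) (P : probability X R) (f : X -> X).
Hypotheses (mf : measurable_fun setT f)
  (fP : forall A, measurable A -> P (f @^-1` A) = P A).

Lemma integrable_preserving g : P.-integrable setT (EFin \o g) ->
  P.-integrable setT (EFin \o (fun x => g (f x))) /\
  expect P (fun x => g (f x)) = expect P g.
Proof.
move=> ig; have /integrableP[mg ig'] := ig.
have pE (h : X -> \bar R) : (\int[pushforward P f]_x h x = \int[P]_x h x)%E.
  by apply: eq_measure_integral => A mA _; exact: fP.
have igf : P.-integrable setT (EFin \o (fun x => g (f x))).
  apply/integrableP; split.
    by apply/measurable_EFinP; apply: measurableT_comp => //; exact/measurable_EFinP.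
  move: ig'; rewrite -pE ge0_integral_pushforward//.
  exact: measurableT_comp.
split => //; rewrite /expect /Rintegral; congr fine; rewrite -[in RHS]pE.
by rewrite (integral_pushforward mf mg) ?preimage_setT.
Qed.

Lemma expect_sum_integrable n (G : nat -> X -> R) :
  (forall i, P.-integrable setT (EFin \o G i)) ->
  P.-integrable setT (EFin \o (fun x => \sum_(i < n) G i x)) /\
  expect P (fun x => \sum_(i < n) G i x) = \sum_(i < n) expect P (G i).
Proof.
move=> iG; elim: n => [|n [ih1 ih2]].
  have -> : (fun x => \sum_(i < 0) G i x) = (fun=> 0).
    by apply/funext => x; rewrite big_ord0.
  by split; [apply: bm_integrable; exact: bm_cst | rewrite expect_cst big_ord0].
have -> : (fun x => \sum_(i < n.+1) G i x) = (fun x => \sum_(i < n) G i x + G n x).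
  by apply/funext => x; rewrite big_ord_recr.
split; first exact: (integrableD measurableT ih1 (iG n)).
by rewrite big_ord_recr/= -ih2 /expect RintegralD.
Qed.

Lemma expect_le_integrable g h : P.-integrable setT (EFin \o g) ->
  P.-integrable setT (EFin \o h) -> (forall x, g x <= h x) -> expect P g <= expect P h.
Proof. by move=> ig ih gh; apply: le_Rintegral. Qed.

End Preserving.

Section OrdinalSums.
Context {R : realType}.

Lemma big_ord_split (phi : nat -> R) n p q : n = (p + q)%N ->
  \sum_(i < n) phi i = \sum_(i < p) phi i + \sum_(i < q) phi (p + i)%N.
Proof. by move=> ->; rewrite big_split_ord. Qed.

Lemma count_returns m t : \sum_(k < m) (m - k <= t)%N%:R <= t%:R :> R.
Proof.
rewrite -natr_sum ler_nat (reindex_inj rev_ord_inj)/=.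
rewrite (eq_bigr (fun k : 'I_m => (k < t)%N : nat)); last first.
  by move=> k _; congr nat_of_bool; have := ltn_ord k; lia.
suff -> : (\sum_(k < m) (k < t) = minn m t)%N by exact: geq_minr.
elim: m => [|m ih]; first by rewrite big_ord0 min0n.
by rewrite big_ord_recr/= ih; case: (ltnP m t); rewrite /= => h; lia.
Qed.

End OrdinalSums.

Ltac nat_lia :=
  repeat match goal with
  | H : ?A |- _ => lazymatch type of A with Prop =>
      lazymatch A with is_true (leq _ _) => fail | @eq nat _ _ => fail | _ => clear H end end
  end; lia.

Section TowerMeasure.
Context (disp : measure_display) (R : realType) (L : borelMetricType disp R).
Variables (mu : probability L R) (tau : L -> nat) (F : L -> L) (t2 : R).
Hypotheses (mtau : measurable_fun setT tau) (tau1 : forall y, (1 <= tau y)%N)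
  (tau_sq : (\int[mu]_x ((tau x)%:R ^+ 2)%:E <= t2%:E)%E)
  (mF : measurable_fun setT F)
  (muF : forall E, measurable E -> mu (F @^-1` E) = mu E).

Local Notation E := (expect mu).
Local Notation tm := (tau_mean mu tau).
Local Notation Om := (L * nat)%type.

Let tm1 : 1 <= tm. Proof. exact: tau_mean_ge1 mtau tau1 tau_sq. Qed.
Let tm0 : 0 < tm. Proof. exact: lt_le_trans ltr01 tm1. Qed.

Lemma measurable_levels d' (Z : measurableType d') (G : Om -> Z) :
  (forall l, measurable_fun setT (fun y => G (y, l))) -> measurable_fun setT G.
Proof.
move=> mG.
have -> : G = (fun w => (fun l (w : Om) => G (w.1, l)) w.2 w).
  by apply/funext => -[].
apply: (measurable_nat_family (N := fun w : Om => w.2) (g := fun l (w : Om) => G (w.1, l))).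
  exact: measurable_snd.
by move=> l; apply: (measurableT_comp (mG l)); exact: measurable_fst.
Qed.

(** Total on [L * nat]: a point above its column is sent to the base like the top point. Such points
    carry no mass, as [tower_density] vanishes there. *)
Definition tower_map (w : Om) : Om :=
  if (w.2.+1 < tau w.1)%N then (w.1, w.2.+1) else (F w.1, 0%N).

Lemma measurable_tau_lt n : measurable_fun setT (fun y => (n < tau y)%N).
Proof.
apply: (measurable_nat_family (g := fun k _ => (n < k)%N) mtau) => k.
exact: measurable_cst.
Qed.

Lemma measurable_tower_map : measurable_fun setT tower_map.
Proof.
apply: measurable_levels => l; rewrite /tower_map /=.
apply: measurable_fun_ifT; first exact: measurable_tau_lt.
  by apply: measurable_fun_pair => //; exact: measurable_cst.
by apply: measurable_fun_pair => //; exact: measurable_cst.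
Qed.

Definition tower_density (w : Om) : R := (w.2 < tau w.1)%N%:R / tm.

Lemma measurable_tower_density : measurable_fun setT tower_density.
Proof.
apply: measurable_levels => l; rewrite /tower_density /=.
apply: measurable_funM => //.
apply: (measurableT_comp (f := fun b : bool => b%:R : R)) => //.
exact: measurable_tau_lt.
Qed.

Lemma tower_density_ge0 w : 0 <= tower_density w.
Proof. by rewrite /tower_density divr_ge0// ltW. Qed.

Definition tower_prob := mdensity (mu \x @counting nat R)%E
  measurable_tower_density tower_density_ge0.

HB.instance Definition _ := Measure.on tower_prob.

Definition block (G : Om -> R) y : R := \sum_(l < tau y) G (y, nat_of_ord l).

Lemma measurable_block (G : Om -> R) : measurable_fun setT G -> measurable_fun setT (block G).
Proof.
move=> mG; apply: (measurable_nat_sum (g := fun l y => G (y, l)) mtau) => l.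
exact: measurable_fun_pair1.
Qed.

Lemma integral_tower (G : Om -> R) : measurable_fun setT G -> (forall w, 0 <= G w) ->
  (\int[tower_prob]_w (G w)%:E = \int[mu]_y (block G y / tm)%:E)%E.
Proof.
move=> mG G0.
have mGE : measurable_fun setT (fun w => (G w)%:E) by exact/measurable_EFinP.
rewrite (integral_mdensity _ _ _ mGE); last by move=> w; rewrite lee_fin.
rewrite fubini_tonelli1; first last.
- by move=> w; rewrite -EFinM lee_fin mulr_ge0// tower_density_ge0.
- apply: emeasurable_funM => //; apply/measurable_EFinP.
  exact: measurable_tower_density.
apply: eq_integral => y _; rewrite /fubini_F ge0_integral_count; last first.
  by move=> k; rewrite -EFinM lee_fin mulr_ge0// tower_density_ge0.
rewrite (nneseries_split 0 (tau y)); last first.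
  by move=> k _; rewrite -EFinM lee_fin mulr_ge0// tower_density_ge0.
rewrite add0n eseries0 ?adde0; last first.
  by move=> k kt _; rewrite /tower_density /= ltnNge kt/= mul0r mule0.
rewrite big_mkord /block mulr_suml -sumEFin; apply: eq_bigr => l _.
by rewrite -EFinM /tower_density /= ltn_ord mul1r.
Qed.

Let tower_probT : tower_prob setT = 1%E.
Proof.
have := @integral_tower (fun=> 1) (measurable_cst _) (fun=> ler01).
rewrite integral_cst// mul1e => ->.
transitivity ((E (fun y => (tau y)%:R / tm))%:E).
  rewrite /expect /Rintegral fineK.
    by apply: eq_integral => y _; rewrite /block sumr_const card_ord.
  apply: integrable_fin_num => //; apply: (le_tau_integrable mtau tau_sq (B := 1)).
    by apply: measurable_funM => //; exact: measurable_nat_real.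
  move=> x; rewrite mul1r ger0_norm; last by rewrite divr_ge0// ltW.
  rewrite ler_pdivrMr// -[leLHS]mulr1 ler_pM//.
  by rewrite expr2 ler_peMl// ler1n.
congr EFin; rewrite /expect RintegralZr//; last exact: tau_integrable mtau tau1 tau_sq.
by rewrite -/(expect mu _) -/(tau_mean mu tau) divff// gt_eqF.
Qed.

HB.instance Definition _ := Measure_isProbability.Build _ _ _ tower_prob tower_probT.

Local Notation P := tower_prob.
Local Notation EP := (expect [the probability _ _ of P]).

Local Notation f := tower_map.
Local Notation bm := (@bounded_measurable _ Om R).
Local Notation bmL := (@bounded_measurable _ L R).

(** The height and the transfer function of the coboundary are unbounded. Domination by the return
    time is enough for integrability, since the sum over a column is then at most a multiple of the
    square of [tau]. *)
Definition dominated (G : Om -> R) :=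
  measurable_fun setT G /\ exists B, forall w, `|G w| <= B * (tau w.1)%:R.

Lemma bm_dominated G : bm G -> dominated G.
Proof.
move=> [mG [B GB]]; split => //; exists `|B| => w; apply: (le_trans (GB w)).
by rewrite (le_trans (ler_norm _))// ler_peMr// ler1n.
Qed.

Lemma dominatedD G H : dominated G -> dominated H -> dominated (fun w => G w + H w).
Proof.
move=> [mG [B GB]] [mH [C HC]]; split; first exact: measurable_funD.
by exists (B + C) => w; rewrite (le_trans (ler_normD _ _))// mulrDl lerD.
Qed.

Lemma dominatedM G H : bm G -> dominated H -> dominated (fun w => G w * H w).
Proof.
move=> [mG [B GB]] [mH [C HC]]; split; first exact: measurable_funM.
by exists (B * C) => w; rewrite normrM -mulrA ler_pM.
Qed.

Lemma dominated_norm G : dominated G -> dominated (fun w => `|G w|).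
Proof.
move=> [mG [B GB]]; split; first exact: measurableT_comp.
by exists B => w; rewrite normr_id.
Qed.

Lemma dominated_tau : dominated (fun w => (tau w.1)%:R).
Proof.
split; last by exists 1 => w; rewrite mul1r normr_nat.
by apply: measurable_levels => l /=; exact: measurable_nat_real.
Qed.

Lemma block_integrable G : dominated G -> mu.-integrable setT (EFin \o block G).
Proof.
move=> [mG [B GB]]; apply: (le_tau_integrable mtau tau_sq (B := B)).
  exact: measurable_block.
move=> y; apply: (le_trans (ler_norm_sum _ _ _)).
apply: (@le_trans _ _ (\sum_(l < tau y) B * (tau y)%:R)).
  by apply: ler_sum => l _; exact: GB.
by rewrite sumr_const card_ord -[leLHS]mulr_natr expr2 mulrA.
Qed.

Lemma dominated_integrable G : dominated G -> P.-integrable setT (EFin \o G).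
Proof.
move=> dG; have [mG _] := dG; apply/integrableP; split; first exact/measurable_EFinP.
have dN := dominated_norm dG; have [mN _] := dN.
rewrite (integral_tower mN)//.
have := integrable_fin_num measurableT (integrableZr measurableT tm^-1 (block_integrable dN)).
rewrite ge0_fin_numE//.
by apply: integral_ge0 => y _; rewrite lee_fin mulr_ge0 ?invr_ge0 ?(ltW tm0)//; apply: sumr_ge0.
Qed.

Lemma blockD G H y : block (fun w => G w + H w) y = block G y + block H y.
Proof. by rewrite /block big_split. Qed.

Lemma expect_tower G : dominated G -> EP G = E (block G) / tm.
Proof.
have ge0 H : dominated H -> (forall w, 0 <= H w) -> EP H = E (block H) / tm.
  move=> dH H0; have [mH _] := dH.
  rewrite /expect -RintegralZr//; last exact: block_integrable.
  by rewrite /Rintegral integral_tower.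
move=> dG; have [mG [B GB]] := dG.
(* Adding a multiple of [tau] reduces the signed case to the nonnegative one, where Tonelli
   applies. *)
pose K (w : Om) : R := `|B| * (tau w.1)%:R.
have dK : dominated K by apply: dominatedM dominated_tau; exact: bm_cst.
have K0 w : 0 <= K w by rewrite mulr_ge0.
pose H w := G w + K w.
have H0 w : 0 <= H w.
  rewrite /H -lerBlDr sub0r; have := GB w; rewrite ler_norml => /andP[h _].
  by apply: le_trans h; rewrite lerN2 ler_wpM2r// ler_norm.
have dH : dominated H by exact: dominatedD.
have := ge0 H dH H0; rewrite /expect RintegralD//; try exact: dominated_integrable.
rewrite (_ : block H = fun y => block G y + block K y); last first.
  by apply/funext => y; rewrite -blockD.
rewrite RintegralD//; try exact: block_integrable.
by have := ge0 K dK K0; rewrite /expect => ->; rewrite mulrDl => /addIr.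
Qed.

Lemma block_map G y : block (fun w => G (f w)) y = block G y - G (y, 0%N) + G (F y, 0%N).
Proof.
rewrite /block; case E: (tau y) (tau1 y) => [//|k] _.
rewrite big_ord_recr [in RHS]big_ord_recl /= (eq_bigr (fun l : 'I_k => G (y, l.+1))).
  by rewrite {1}/tower_map/= E ltnn; set X := \sum_(_ < _) _; ring.
by move=> l _; rewrite /tower_map/= E ltnS ltn_ord.
Qed.

(** By [block_map], composition with the tower map changes the sum over a column only by its value
    at the base over [F y] minus that over [y], and this has mean zero by invariance under [F]. *)
Lemma tower_invariant A : measurable A -> P (f @^-1` A) = P A.
Proof.
move=> mA.
have mfA : measurable (f @^-1` A).
  by rewrite -[X in measurable X]setTI; exact: measurable_tower_map.
have bA : bm (\1_A : Om -> R).
  by split; [exact: measurable_indic | exists 1 => w; rewrite indicE normr_nat lern1; case: (_ \in _)].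
have bfA : bm (fun w => \1_A (f w) : R).
  by apply: (bm_preim measurable_tower_map bA).
have bl (H : Om -> R) k : bm H -> bmL (fun y => H (y, k)).
  by move=> [mH [B HB]]; split; [exact: measurable_fun_pair1|exists B].
have PE B : measurable B -> P B = (EP (\1_B))%:E.
  move=> mB; rewrite /expect /Rintegral integral_indic// setIT fineK//.
  exact: fin_num_measure.
rewrite !PE//; congr EFin.
have -> : \1_(f @^-1` A) = (fun w => \1_A (f w) : R) by [].
rewrite !expect_tower; try exact: bm_dominated.
congr (_ / _).
have -> : block (fun w => \1_A (f w)) = fun y => block \1_A y - \1_A (y, 0%N) + \1_A (F y, 0%N).
  by apply/funext => y; rewrite block_map.
have i1 := bm_integrable mu (bl _ 0%N bA).
have bF : bmL (fun y => \1_A (F y, 0%N) : R) by exact: (bm_preim mF (bl _ 0%N bA)).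
have i2 := bm_integrable mu bF.
have i3 := block_integrable (bm_dominated bA).
rewrite /expect RintegralD//; last exact: (integrableB measurableT i3 i1).
rewrite RintegralB//.
have := expect_preserving mF (fun E mE => muF mE) (bl _ 0%N bA).
by rewrite /expect => ->; rewrite subrK.
Qed.

Lemma iter_tower_up m y l : (l + m < tau y)%N -> iter m f (y, l) = (y, l + m)%N.
Proof.
elim: m => [|m ih] h; first by rewrite addn0.
by rewrite iterS ih; [rewrite /tower_map /= -addnS h | nat_lia].
Qed.

Lemma iter_tower_return m y l : (l < tau y)%N -> (tau y <= l + m)%N ->
  iter m f (y, l) = iter (m - (tau y - l)) f (F y, 0%N).
Proof.
move=> lt tle.
have -> : m = ((m - (tau y - l)) + (tau y - l).-1.+1)%N by nat_lia.
rewrite iterD iterS iter_tower_up; last nat_lia.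
rewrite /tower_map /=.
have -> : ((l + (tau y - l).-1).+1 < tau y)%N = false by nat_lia.
by congr iter; nat_lia.
Qed.

(** * The correlation estimate on the tower *)

Section KeyEstimate.
Variables (vv : nat -> L -> R) (K1 lam B0 : R).
Hypotheses (mvv : forall l, measurable_fun setT (vv l)) (vv1 : forall l y, `|vv l y| <= 1).
Let V y := \sum_(l < tau y) vv l y.
Hypotheses (K10 : 0 <= K1) (lam01 : 0 <= lam < 1) (B00 : 0 <= B0).
Hypothesis decay : forall n h, bmL h -> (forall y, 0 <= h y) ->
  `|E (fun y => h (iter n.+1 F y) * V y)| <= K1 * lam ^+ n * E h.
Hypothesis mixing : forall w : nat -> R, (forall k, 0 <= w k) -> (forall k, w k <= k%:R) ->
  forall h : L -> \bar R, measurable_fun setT h -> (forall x, (0 <= h x)%E) ->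
  (\int[mu]_y (h (F y) * (w (tau y))%:E) <=
    (B0 * E (fun y => w (tau y)))%:E * \int[mu]_y h y)%E.

(** Truncation at the top of the column makes the cohomological equation hold on all of
    [L * nat]. *)
Let lvl (w : Om) := minn w.2 (tau w.1).-1.

Definition tower_obs (w : Om) : R := vv (lvl w) w.1.

Definition height (w : Om) : nat := (lvl w).+1.

Let psi (w : Om) : R := \sum_(k < lvl w) vv k w.1.
Let W (w : Om) : R := if (w.2.+1 < tau w.1)%N then 0 else V w.1.

(* The observable is cohomologous to [W], which is supported by the top of the
   tower and takes there the values of the block sum. *)
Let coboundary w : tower_obs w = psi (f w) - psi w + W w.
Proof.
case: w => y l; rewrite /tower_obs /W /psi /lvl /tower_map /=.
have t1 := tau1 y; case: ltnP => h /=.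
  have -> : minn l (tau y).-1 = l by nat_lia.
  have -> : minn l.+1 (tau y).-1 = l.+1 by nat_lia.
  by rewrite big_ord_recr /= addr0 addrAC subrr add0r.
rewrite min0n big_ord0 sub0r /V.
have -> : minn l (tau y).-1 = (tau y).-1 by nat_lia.
by case: (tau y) t1 => [//|k] _ /=; rewrite big_ord_recr /= addKr.
Qed.

Let measurable_lvl l : measurable_fun setT (fun y => minn l (tau y).-1).
Proof.
apply: (measurable_nat_family (g := fun k _ => minn l k.-1) mtau) => k.
exact: measurable_cst.
Qed.

Let mV : measurable_fun setT V.
Proof. exact: (measurable_nat_sum (g := fun l y => vv l y) mtau). Qed.

Let V_le y : `|V y| <= (tau y)%:R.
Proof.
apply: (le_trans (ler_norm_sum _ _ _)).
apply: (@le_trans _ _ (\sum_(l < tau y) 1)); first by apply: ler_sum.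
by rewrite sumr_const card_ord.
Qed.

Lemma bm_tower_obs : bm tower_obs.
Proof.
split; last by exists 1 => w; exact: vv1.
apply: measurable_levels => l.
exact: (measurable_nat_family (g := fun k y => vv k y) (measurable_lvl l)).
Qed.

Lemma tower_obs_le1 w : `|tower_obs w| <= 1. Proof. exact: vv1. Qed.

Lemma height_le w : (height w <= tau w.1)%N.
Proof. by rewrite /height /lvl; have := tau1 w.1; nat_lia. Qed.

Let psi_le w : `|psi w| <= (height w)%:R.
Proof.
apply: (le_trans (ler_norm_sum _ _ _)).
apply: (@le_trans _ _ (\sum_(l < lvl w) 1)); first by apply: ler_sum.
by rewrite sumr_const card_ord ler_nat.
Qed.

Let dominated_psi : dominated psi.
Proof.
split; last by exists 1 => w; rewrite mul1r (le_trans (psi_le w))// ler_nat height_le.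
apply: measurable_levels => l.
exact: (measurable_nat_sum (g := fun k y => vv k y) (measurable_lvl l)).
Qed.

Let dominated_W : dominated W.
Proof.
split; last first.
  by exists 1 => w; rewrite mul1r /W; case: ifP => _; rewrite ?normr0.
apply: measurable_levels => l; rewrite /W /=; apply: measurable_fun_ifT => //.
exact: measurable_tau_lt.
Qed.

Lemma dominated_height : dominated (fun w => (height w)%:R).
Proof.
split; last by exists 1 => w; rewrite mul1r normr_nat ler_nat height_le.
apply: measurable_levels => l.
apply: (measurable_nat_real (N := fun y => (minn l (tau y).-1).+1)).
apply: (measurable_nat_family (g := fun k _ => (minn l k.-1).+1) mtau) => k.
exact: measurable_cst.
Qed.

Lemma height_step w : (height (f w) <= (height w).+1)%N.
Proof.
case: w => y l; rewrite /height /lvl /tower_map /=; have t1 := tau1 y.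
by case: (ltnP l.+1 (tau y)) => h /=; nat_lia.
Qed.

Section Correlation.
Variable g : Om -> R.
Hypotheses (bg : bm g) (g0 : forall w, 0 <= g w).

Let h k y := g (iter k f (y, 0%N)).

Let bm_giter k : bm (fun w => g (iter k f w)).
Proof. exact: (bm_iter measurable_tower_map). Qed.

Let bm_h k : bmL (h k).
Proof.
have [m [B hB]] := bm_giter k.
by split; [exact: (measurable_fun_pair1 0%N m) | exists B => y; exact: hB].
Qed.

Let h0 k y : 0 <= h k y. Proof. exact: g0. Qed.

Let expect_h k : E (h k) <= tm * EP g.
Proof.
have <- : EP (fun w => g (iter k f w)) = EP g.
  exact: (expect_iter measurable_tower_map tower_invariant).
have dg := bm_dominated (bm_giter k).
rewrite (expect_tower dg) mulrC divfK ?gt_eqF//.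
apply: expect_le_integrable; [exact: bm_integrable | exact: block_integrable |].
move=> y; rewrite /block; case: (tau y) (tau1 y) => [//|t] _.
by rewrite big_ord_recl /= lerDl sumr_ge0.
Qed.

(** Contribution of the orbits of length [m] that leave the column over [y]: [k] is the time elapsed
    since the first return, so the return takes [m - k] steps, at most the height [tau y] of the
    column. *)
Let returns (w : nat -> R) m y :=
  \sum_(k < m) h k (F y) * (w (tau y) * (m - k <= tau y)%N%:R).

Let tau_fun (w : nat -> R) : measurable_fun setT (fun y => w (tau y)).
Proof.
by apply: (measurable_nat_family (g := fun k _ => w k) mtau) => k; exact: measurable_cst.
Qed.

Let weight_integrable (w : nat -> R) : (forall k, 0 <= w k) -> (forall k, w k <= k%:R) ->
  mu.-integrable setT (EFin \o (fun y => w (tau y))).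
Proof.
move=> w0 w1; apply: (le_tau_integrable mtau tau_sq (B := 1)) => // y.
by rewrite mul1r ger0_norm// (le_trans (w1 _))// expr2 ler_peMl// ler1n.
Qed.

Let mixing_real k (w : nat -> R) : (forall k, 0 <= w k) -> (forall k, w k <= k%:R) ->
  mu.-integrable setT (EFin \o (fun y => h k (F y) * w (tau y))) /\
  E (fun y => h k (F y) * w (tau y)) <= B0 * E (fun y => w (tau y)) * E (h k).
Proof.
move=> w0 w1; have [mh [B hB]] := bm_h k.
have i : mu.-integrable setT (EFin \o (fun y => h k (F y) * w (tau y))).
  apply: (le_tau_integrable mtau tau_sq (B := `|B|)).
    apply: measurable_funM => //; exact: measurableT_comp.
  move=> y; rewrite normrM ler_pM ?(le_trans (hB _)) ?ler_norm//.
  by rewrite ger0_norm// (le_trans (w1 _))// expr2 ler_peMl// ler1n.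
split => //.
have e1 : (E (fun y => h k (F y) * w (tau y)))%:E =
    (\int[mu]_y ((h k (F y))%:E * (w (tau y))%:E))%E.
  by rewrite /expect /Rintegral fineK// (integrable_fin_num _ i).
have e2 : (E (h k))%:E = (\int[mu]_y (h k y)%:E)%E.
  by rewrite /expect /Rintegral fineK// (integrable_fin_num _ (bm_integrable mu (bm_h k))).
rewrite -lee_fin EFinM e1 e2; apply: (mixing w0 w1 (h := fun y => (h k y)%:E)).
  exact/measurable_EFinP.
by move=> x; rewrite lee_fin.
Qed.

(** Quasi-independence splits each term into a factor in [tau] and the mean of [h k], which is
    bounded independently of [k]. For a given return time at most [tau] values of [k] are possible,
    by [count_returns]; hence the bound does not depend on [m]. *)
Let expect_returns (w : nat -> R) m : (forall k, 0 <= w k) -> (forall k, (1 <= k)%N -> w k <= k%:R) ->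
  mu.-integrable setT (EFin \o returns w m) /\
  E (returns w m) <= B0 * E (fun y => w (tau y) * (tau y)%:R) * (tm * EP g).
Proof.
move=> w0 w1.
(* The factor [(k < m)] makes [m - k] positive, so that [w' k 0] is 0 even when [w 0] is 1, as the
   hypothesis of [mixing_real] demands. *)
pose w' k t := w t * (k < m)%N%:R * (m - k <= t)%N%:R.
have w'0 k t : 0 <= w' k t by rewrite !mulr_ge0.
have w'1 k t : w' k t <= t%:R.
  rewrite /w'; case: t => [|t].
    by case: ltnP => km; rewrite ?mulr0 ?mul0r// (_ : (m - k <= 0)%N = false) ?mulr0//; nat_lia.
  have h1 : w t.+1 <= t.+1%:R by exact: w1.
  by case: (k < m)%N; case: (m - k <= t.+1)%N; rewrite ?mulr1 ?mulr0.
have retE : returns w m = fun y => \sum_(k < m) h k (F y) * w' k (tau y).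
  by apply/funext => y; apply: eq_bigr => k _; rewrite /w' ltn_ord mulr1.
have mr k := mixing_real k (w'0 k) (w'1 k).
have [ri re] := expect_sum_integrable m (fun k => (mr k).1).
rewrite retE; split => //; rewrite re.
have tE0 : 0 <= tm * EP g by rewrite mulr_ge0 ?(ltW tm0)//; exact: expect_ge0.
apply: (@le_trans _ _ (\sum_(k < m) B0 * E (fun y => w' k (tau y)) * (tm * EP g))).
  apply: ler_sum => k _; apply: (le_trans (mr k).2).
  by rewrite ler_wpM2l ?expect_h// mulr_ge0//; apply: Rintegral_ge0.
rewrite -mulr_suml ler_wpM2r// -mulr_sumr ler_wpM2l//.
have wi k := weight_integrable (w'0 k) (w'1 k).
have [si <-] := expect_sum_integrable m wi.
have wt y : w (tau y) <= (tau y)%:R by exact: w1.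
apply: expect_le_integrable => //.
  apply: (le_tau_integrable mtau tau_sq (B := 1)).
    by apply: measurable_funM => //; exact: measurable_nat_real.
  by move=> y; rewrite mul1r ger0_norm ?mulr_ge0// expr2 ler_wpM2r.
move=> y; rewrite (eq_bigr (fun k : 'I_m => w (tau y) * (m - k <= tau y)%N%:R)).
  by rewrite -mulr_sumr ler_wpM2l// count_returns.
by move=> k _; rewrite /w' ltn_ord mulr1.
Qed.
Let EP_ge0 : 0 <= EP g. Proof. exact: expect_ge0. Qed.

(* Orbits that have not returned to the base before time [m] gain height; the
   others are described by their first return. *)
Let block_height m y :
  block (fun w => g (iter m f w) * (height w)%:R) y <=
  block (fun w => g w * (height w)%:R) y + returns (fun t => t%:R) m y.
Proof.
have hE l : (l < tau y)%N -> height (y, l) = l.+1.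
  by move=> lt; rewrite /height /lvl /=; nat_lia.
have -> : block (fun w => g (iter m f w) * (height w)%:R) y =
    \sum_(l < tau y) g (iter m f (y, nat_of_ord l)) * l.+1%:R.
  by apply: eq_bigr => l _; rewrite hE.
have -> : block (fun w => g w * (height w)%:R) y = \sum_(l < tau y) g (y, nat_of_ord l) * l.+1%:R.
  by apply: eq_bigr => l _; rewrite hE.
have B0' : 0 <= \sum_(l < tau y) g (y, nat_of_ord l) * l.+1%:R.
  by apply: sumr_ge0 => l _; rewrite mulr_ge0.
have ret k a : (m - k <= tau y)%N -> (a < tau y)%N -> h k (F y) * a.+1%:R <=
    h k (F y) * ((tau y)%:R * (m - k <= tau y)%N%:R).
  by move=> kt at'; rewrite kt mulr1 ler_wpM2l// ler_nat.
have [mt|tm'] := leqP m (tau y).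
  have tE : tau y = (tau y - m + m)%N by nat_lia.
  rewrite (big_ord_split (fun l => g (iter m f (y, l)) * l.+1%:R) tE) lerD//.
    rewrite addnC in tE; rewrite (big_ord_split (fun l => g (y, l) * l.+1%:R) tE).
    rewrite -[leLHS]add0r lerD//; first by apply: sumr_ge0 => l _; rewrite mulr_ge0.
    apply: ler_sum => l _; have ll := ltn_ord l.
    by rewrite iter_tower_up ?(addnC m) ?ler_wpM2l ?ler_nat//; nat_lia.
  apply: ler_sum => i _; have ii := ltn_ord i.
  rewrite iter_tower_return; [|nat_lia|nat_lia].
  have -> : (m - (tau y - (tau y - m + i)) = i)%N by nat_lia.
  by apply: ret; nat_lia.
rewrite -[leLHS]add0r lerD// /returns.
have mE : m = (m - tau y + tau y)%N by nat_lia.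
rewrite (big_ord_split (fun k => h k (F y) *
  ((tau y)%:R * (m - k <= tau y)%N%:R)) mE) -[leLHS]add0r lerD//.
  by apply: sumr_ge0 => k _; rewrite !mulr_ge0.
apply: ler_sum => l _; have ll := ltn_ord l.
rewrite iter_tower_return//; last nat_lia.
have -> : (m - (tau y - l) = m - tau y + l)%N by nat_lia.
apply: ret; nat_lia.
Qed.

Let potential m y := \sum_(j < m) h j y.

Let bm_potential m : bmL (potential m).
Proof. exact: (@bm_sum _ _ _ m (fun j y => h j y)). Qed.

(** The two potentials sum [g] over windows of length [m] in one orbit, shifted by [tau y]. The
    common part cancels: the first [tau y] terms make up the block and the last [tau y] terms are
    among the returns. If [m <= tau y], each window is bounded separately. *)
Let potential_step m y : `|potential m y - potential m (F y)| <=
  block g y + returns (fun=> 1) m y.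
Proof.
have b0 : 0 <= block g y by apply: sumr_ge0.
have r0 : 0 <= returns (fun=> 1) m y by apply: sumr_ge0 => k _; rewrite !mulr_ge0.
suff [a [b [-> /andP[a0 a1] /andP[b0' b1]]]] : exists a b,
    [/\ potential m y - potential m (F y) = a - b, 0 <= a <= block g y &
     0 <= b <= returns (fun=> 1) m y].
  by rewrite ler_norml; apply/andP; split; lra.
have [mt|tm'] := leqP m (tau y).
  exists (potential m y), (potential m (F y)); split => //; apply/andP; split.
  - exact: sumr_ge0.
  - have tE : tau y = (m + (tau y - m))%N by nat_lia.
    rewrite /block (big_ord_split (fun l => g (y, l)) tE) -[leLHS]addr0 lerD ?sumr_ge0//.
    by apply: ler_sum => l _; have ll := ltn_ord l; rewrite /h iter_tower_up ?add0n//; nat_lia.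
  - exact: sumr_ge0.
  - apply: ler_sum => k _; rewrite (_ : (m - k <= tau y)%N) ?mulr1//; nat_lia.
exists (block g y), (\sum_(i < tau y) h (m - tau y + i)%N (F y)); split.
- have -> : potential m y = block g y + \sum_(i < m - tau y) h i (F y).
    have mE : m = (tau y + (m - tau y))%N by nat_lia.
    rewrite /potential (big_ord_split (h^~ y) mE); congr (_ + _).
      by apply: eq_bigr => l _; rewrite /h iter_tower_up ?add0n.
    apply: eq_bigr => i _; rewrite /h iter_tower_return ?tau1//; last nat_lia.
    by congr (g (iter _ _ _)); nat_lia.
  have -> : potential m (F y) = \sum_(i < m - tau y) h i (F y) +
      \sum_(i < tau y) h (m - tau y + i)%N (F y).
    have mE : m = (m - tau y + tau y)%N by nat_lia.
    exact: (big_ord_split (h^~ (F y)) mE).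
  by set X := \sum_(_ < m - _) _; set Z := \sum_(_ < _) _; ring.
- by rewrite b0 lexx.
rewrite sumr_ge0//= /returns; have mE : m = (m - tau y + tau y)%N by nat_lia.
rewrite (big_ord_split (fun k => h k (F y) * (1 * (m - k <= tau y)%N%:R)) mE) -[leLHS]add0r lerD//.
  by apply: sumr_ge0 => k _; rewrite !mulr_ge0.
apply: ler_sum => i _; have ii := ltn_ord i.
by rewrite (_ : (_ - _ <= tau y)%N) ?mulr1//; nat_lia.
Qed.

Let V_integrable q : bmL q -> mu.-integrable setT (EFin \o (fun y => q y * V y)).
Proof.
move=> [mq [B qB]]; apply: (le_tau_integrable mtau tau_sq (B := `|B|)).
  exact: measurable_funM.
move=> y; rewrite normrM ler_pM ?(le_trans (qB _)) ?ler_norm//.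
by rewrite (le_trans (V_le y))// expr2 ler_peMl// ler1n.
Qed.

Let bm_Fiter n q : bmL q -> bmL (fun y => q (iter n F y)).
Proof. exact: bm_iter. Qed.

Let decay_signed n q : bmL q ->
  `|E (fun y => q (iter n.+1 F y) * V y)| <= K1 * lam ^+ n * E (fun y => `|q y|).
Proof.
move=> bq; pose qp y := Num.max (q y) 0; pose qn y := Num.max (- q y) 0.
have bqp : bmL qp by apply: bm_max => //; exact: bm_cst.
have bqn : bmL qn.
  apply: bm_max; last exact: bm_cst.
  by apply: (bm_ext (g := fun y => -1 * q y)) => [y|]; [rewrite mulN1r | exact: bmZ].
have qp0 y : 0 <= qp y by rewrite le_max lexx orbT.
have qn0 y : 0 <= qn y by rewrite le_max lexx orbT.
have qE y : q y = qp y - qn y.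
  by rewrite /qp /qn; case: (leP (q y) 0) => q0; case: (leP (- q y) 0) => q1; lra.
have qNE y : `|q y| = qp y + qn y.
  rewrite /qp /qn; have [q0|q0] := leP 0 (q y).
    by rewrite ger0_norm// max_r ?addr0// oppr_le0.
  by rewrite ltr0_norm// max_l ?add0r// oppr_ge0 ltW.
rewrite (_ : (fun y => q (iter n.+1 F y) * V y) =
  (fun y => qp (iter n.+1 F y) * V y - qn (iter n.+1 F y) * V y)); last first.
  by apply/funext => y; rewrite qE mulrBl.
rewrite (_ : (fun y => `|q y|) = (fun y => qp y + qn y)); last exact/funext.
rewrite (expectD mu bqp bqn) /expect RintegralB//; first last.
- by apply: (V_integrable (q := fun y => qn (iter n.+1 F y))); exact: bm_Fiter.
- by apply: (V_integrable (q := fun y => qp (iter n.+1 F y))); exact: bm_Fiter.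
rewrite (le_trans (ler_normB _ _))// mulrDr lerD//; exact: decay.
Qed.

(** Decay applied directly to the potential would bring in its mean, whose natural bound grows with
    [m]. It is applied instead to the differences in the telescoping of the potential along [F],
    giving a geometric series; the remainder disappears as its length tends to infinity for fixed
    [m]. *)
Let potential_decay m :
  `|E (fun y => potential m (F y) * V y)| <=
  K1 / (1 - lam) * E (fun y => `|potential m y - potential m (F y)|).
Proof.
have /andP[l0 l1] := lam01.
set G := potential m; pose e y := G y - G (F y).
have bG : bmL G by exact: bm_potential.
have be : bmL e by apply: bmB => //; exact: (bm_Fiter 1).
have e0 : 0 <= E (fun y => `|e y|) by exact: expect_ge0.
have part N : `|E (fun y => G (F y) * V y)| <=
    K1 / (1 - lam) * E (fun y => `|e y|) + K1 * lam ^+ N * E G.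
  have tel : (fun y => G (F y) * V y) = (fun y =>
      \sum_(i < N) e (iter i.+1 F y) * V y + G (iter N.+1 F y) * V y).
    apply/funext => y; elim: (N) => [|k ih]; first by rewrite big_ord0 add0r.
    rewrite ih big_ord_recr/= /e !mulrBl; set X := \sum_(_ < _) _; ring.
  have ie i : mu.-integrable setT (EFin \o (fun y => e (iter i.+1 F y) * V y)).
    by apply: (V_integrable (q := fun y => e (iter i.+1 F y))); exact: bm_Fiter.
  have iG : mu.-integrable setT (EFin \o (fun y => G (iter N.+1 F y) * V y)).
    by apply: (V_integrable (q := fun y => G (iter N.+1 F y))); exact: bm_Fiter.
  have [si se] := expect_sum_integrable N ie.
  rewrite tel /expect RintegralD//.
  rewrite (le_trans (ler_normD _ _))// lerD//; last first.
    by apply: decay => // y; apply: sumr_ge0.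
  move: se; rewrite {1}/expect => ->.
  apply: (le_trans (ler_norm_sum _ _ _)).
  apply: (@le_trans _ _ (\sum_(i < N) K1 * lam ^+ i * E (fun y => `|e y|))).
    by apply: ler_sum => i _; exact: decay_signed.
  rewrite -mulr_suml ler_wpM2r// -mulr_sumr ler_wpM2l//.
  have geo : (1 - lam) * \sum_(i < N) lam ^+ i = 1 - lam ^+ N.
    rewrite mulr_sumr; elim: (N) => [|k ih]; first by rewrite big_ord0 subrr.
    by rewrite big_ord_recr/= ih exprS; ring.
  rewrite -[leRHS]mul1r ler_pdivlMr ?subr_gt0// mulrC geo.
  by rewrite gerBl exprn_ge0.
have lim : K1 / (1 - lam) * E (fun y => `|e y|) + K1 * lam ^+ N * E G @[N --> \oo] -->
    K1 / (1 - lam) * E (fun y => `|e y|) + K1 * 0 * E G.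
  apply: cvgD; first exact: cvg_cst.
  apply: cvgMr_tmp; apply: cvgMl_tmp; apply: cvg_expr; by rewrite ger0_norm.
rewrite mulr0 mul0r addr0 in lim.
by apply: (ler_cvg_to (cvg_cst _) lim); exact: nearW.
Qed.

Let u := tower_obs.

Let obs_sumSl m w : ergodic_sum f u m.+1 w = u w + ergodic_sum f u m (f w).
Proof.
rewrite /ergodic_sum big_ord_recl/=; congr (_ + _).
by apply: eq_bigr => i _; rewrite -iterSr.
Qed.

Let expect_W j : EP (fun w => g (iter j.+1 f w) * W w) = E (fun y => h j (F y) * V y) / tm.
Proof.
rewrite (expect_tower (dominatedM (bm_giter j.+1) dominated_W)); congr (E _ / _).
apply/funext => y; rewrite /block /h; case tE: (tau y) (tau1 y) => [//|k] _.
rewrite big_ord_recr big1 /= => [|l _]; last by rewrite /W /= tE ltnS ltn_ord mulr0.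
by rewrite add0r -iterS iterSr /W /tower_map /= tE ltnn.
Qed.

(** The coboundary telescopes to two terms in [psi]. [W] lives on the top of the tower, from which
    one step leads to the base over [F y], so its contributions add up to the correlation of the
    potential with the block sum. *)
Let correlation m : EP (fun w => g (iter m f w) * ergodic_sum f u m w) =
  EP (fun w => g w * psi w) - EP (fun w => g (iter m f w) * psi w)
  + E (fun y => potential m (F y) * V y) / tm.
Proof.
have fP := tower_invariant; have mf := measurable_tower_map.
have dgp k : dominated (fun w => g (iter k f w) * psi w) by exact: dominatedM.
elim: m => [|m ih].
  rewrite subrr add0r (_ : (fun w => _) = (fun=> 0)); last first.
    by apply/funext => w; rewrite /ergodic_sum big_ord0 mulr0.
  rewrite expect_cst (_ : (fun y => _) = (fun=> 0)) ?expect_cst ?mul0r//.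
  by apply/funext => y; rewrite /potential big_ord0 mul0r.
have bS : bm (ergodic_sum f u m) by apply: bm_ergodic_sum => //; exact: bm_tower_obs.
have bgS : bm (fun w => g (iter m f w) * ergodic_sum f u m w) by exact: bmM.
have [ip ep] := integrable_preserving mf fP (dominated_integrable (dgp m)).
have i1 := bm_integrable P (bm_preim mf bgS).
have i2 := dominated_integrable (dgp m.+1).
have i3 := dominated_integrable (dominatedM (bm_giter m.+1) dominated_W).
have -> : (fun w => g (iter m.+1 f w) * ergodic_sum f u m.+1 w) =
   (fun w => g (iter m f (f w)) * psi (f w) - g (iter m.+1 f w) * psi w
     + g (iter m.+1 f w) * W w + g (iter m f (f w)) * ergodic_sum f u m (f w)).
  by apply/funext => w; rewrite obs_sumSl /u coboundary -!iterSr; ring.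
have e1 : EP (fun w => g (iter m f (f w)) * ergodic_sum f u m (f w)) =
    EP (fun w => g (iter m f w) * ergodic_sum f u m w).
  exact: (expect_preserving mf fP bgS).
have iB := integrableB measurableT ip i2.
have iBD := integrableD measurableT iB i3.
rewrite {1}/expect RintegralD// RintegralD// RintegralB//.
rewrite -/(expect P _) -/(expect P _) -/(expect P _) -/(expect P _).
rewrite e1 ih ep expect_W.
have -> : E (fun y => potential m.+1 (F y) * V y) =
    E (fun y => potential m (F y) * V y) + E (fun y => h m (F y) * V y).
  rewrite /expect -RintegralD//; first last.
  - exact: (V_integrable (bm_preim mF (bm_h m))).
  - exact: (V_integrable (bm_preim mF (bm_potential m))).
  by apply: eq_Rintegral => y _; rewrite /potential big_ord_recr mulrDl.
by rewrite mulrDl; ring.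
Qed.

(** The three terms of [correlation] contribute 1, 1 + B0 * t2 and the last summand, each relative
    to the mean of [g] times the height. *)
Definition key_const : R := 2 + B0 * t2 + K1 / (1 - lam) * (1 + B0 * t2).

Lemma key_estimate_ge0 m : `|EP (fun w => g (iter m f w) * ergodic_sum f u m w)| <=
  key_const * EP (fun w => g w * (height w)%:R).
Proof.
have /andP[l0 l1] := lam01.
have tmt2 : tm <= t2 := tau_mean_le mtau tau1 tau_sq.
have tne : tm != 0 by rewrite gt_eqF.
have t20 : 0 <= t2 by rewrite (le_trans _ tmt2)// ltW.
set H := EP (fun w => g w * (height w)%:R).
have dgh k : dominated (fun w => g (iter k f w) * (height w)%:R).
  exact: dominatedM dominated_height.
have [ri1 re1] : mu.-integrable setT (EFin \o returns (fun=> 1) m) /\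
    E (returns (fun=> 1) m) <= B0 * E (fun y => 1 * (tau y)%:R) * (tm * EP g).
  by apply: expect_returns => // k k1; rewrite ler1n.
have [ri2 re2] : mu.-integrable setT (EFin \o returns (fun t => t%:R) m) /\
    E (returns (fun t => t%:R) m) <= B0 * E (fun y => (tau y)%:R * (tau y)%:R) * (tm * EP g).
  by apply: expect_returns.
have gH : EP g <= H.
  apply: expect_le_integrable; [exact: bm_integrable | exact: dominated_integrable (dgh 0%N)|].
  by move=> w; rewrite ler_peMr// ler1n.
have tausq : E (fun y => (tau y)%:R * (tau y)%:R) <= t2.
  rewrite -lee_fin; apply: le_trans tau_sq; rewrite /expect /Rintegral fineK//.
  exact: integrable_fin_num (tau_integrable2 mtau tau_sq).
have b0 : `|EP (fun w => g w * psi w)| <= H.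
  have iN := dominated_integrable (dominatedM bg dominated_psi).
  rewrite (le_trans (le_normr_Rintegral _ _))//.
  apply: expect_le_integrable.
  - exact: dominated_integrable (dominated_norm (dominatedM bg dominated_psi)).
  - exact: dominated_integrable (dgh 0%N).
  - by move=> w; rewrite normrM ger0_norm// ler_wpM2l.
have bm' : `|EP (fun w => g (iter m f w) * psi w)| <= (1 + B0 * t2) * H.
  have iN := dominated_integrable (dominatedM (bm_giter m) dominated_psi).
  apply: (@le_trans _ _ (EP (fun w => g (iter m f w) * (height w)%:R))).
    rewrite (le_trans (le_normr_Rintegral _ _))//.
    apply: expect_le_integrable.
    - exact: dominated_integrable (dominated_norm (dominatedM (bm_giter m) dominated_psi)).
    - exact: dominated_integrable (dgh m).
    - by move=> w; rewrite normrM ger0_norm// ler_wpM2l.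
  rewrite (expect_tower (dgh m)) ler_pdivrMr//.
  apply: (@le_trans _ _ (E (fun y => block (fun w => g w * (height w)%:R) y
      + returns (fun t => t%:R) m y))).
    apply: expect_le_integrable; [exact: block_integrable (dgh m) | | exact: block_height].
    exact: (integrableD measurableT (block_integrable (dgh 0%N)) ri2).
  rewrite /expect RintegralD//; last exact: block_integrable (dgh 0%N).
  have HE : E (block (fun w => g w * (height w)%:R)) = H * tm.
    by rewrite /H (expect_tower (dgh 0%N)) divfK.
  rewrite -/(expect mu _) -/(expect mu _) HE mulrDl mul1r mulrDl lerD2l.
  apply: (le_trans re2); rewrite -!mulrA ler_wpM2l// ler_pM//.
  - by apply: expect_ge0 => y; rewrite mulr_ge0.
  - by rewrite mulr_ge0// ltW.
  - by rewrite mulrC ler_wpM2r// ltW.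
have b3 : `|E (fun y => potential m (F y) * V y) / tm| <= K1 / (1 - lam) * (1 + B0 * t2) * H.
  have kl : 0 <= K1 / (1 - lam) by rewrite divr_ge0// subr_ge0 ltW.
  rewrite normrM (ger0_norm (x := tm^-1)) ?invr_ge0 ?(ltW tm0)// ler_pdivrMr//.
  apply: (le_trans (potential_decay m)).
  rewrite -!(mulrA (K1 / (1 - lam))) ler_wpM2l//.
  apply: (@le_trans _ _ (E (fun y => block g y + returns (fun=> 1) m y))).
    apply: expect_le_integrable; last exact: potential_step.
      apply: bm_integrable; apply: bm_norm; apply: bmB => //.
      exact: (bm_preim mF (bm_potential m)).
    exact: (integrableD measurableT (block_integrable (bm_dominated bg)) ri1).
  rewrite /expect RintegralD//; last exact: block_integrable (bm_dominated bg).
  have gE : E (block g) = EP g * tm by rewrite (expect_tower (bm_dominated bg)) divfK.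
  rewrite -/(expect mu _) -/(expect mu _) gE mulrDl mul1r mulrDl lerD//.
    by rewrite ler_wpM2r// ltW.
  apply: (le_trans re1).
  have -> : E (fun y => 1 * (tau y)%:R) = tm.
    by congr (E _); apply/funext => y; rewrite mul1r.
  rewrite -!mulrA ler_wpM2l// ler_pM// ?(ltW tm0)// ?mulr_ge0 ?(ltW tm0)//.
  by rewrite mulrC ler_wpM2r// ltW.
rewrite correlation (le_trans (ler_normD _ _))//.
have := ler_normB (EP (fun w => g w * psi w)) (EP (fun w => g (iter m f w) * psi w)).
rewrite /key_const; lra.
Qed.

End Correlation.
Let kap1 : 1 <= key_const.
Proof.
have /andP[l0 l1] := lam01; have B0' := B00.
have t20 : 0 <= t2.
  by rewrite (le_trans (ltW tm0))//; exact: tau_mean_le mtau tau1 tau_sq.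
have h1 : 0 <= B0 * t2 by rewrite mulr_ge0.
have h2 : 0 <= K1 / (1 - lam) * (1 + B0 * t2).
  by rewrite mulr_ge0 ?addr_ge0// divr_ge0// subr_ge0 ltW.
rewrite /key_const; lra.
Qed.

Let kap0 : 0 <= key_const. Proof. exact: le_trans ler01 kap1. Qed.

Section Horizon.
Variable n : nat.

Definition cost (w : Om) : R := key_const * (minn (height w) n)%:R.

Lemma cost_ge0 w : 0 <= cost w. Proof. by rewrite mulr_ge0. Qed.

Lemma cost_top w : cost w <= key_const * n%:R.
Proof. by rewrite ler_wpM2l// ler_nat geq_minr. Qed.

Lemma cost_step w : cost (f w) <= cost w + key_const.
Proof.
rewrite /cost -{3}(mulr1 key_const) -mulrDr ler_wpM2l// natr1 ler_nat.
have := height_step w; nat_lia.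
Qed.

Let measurable_height (phi : nat -> R) : measurable_fun setT (fun w => phi (height w)).
Proof.
apply: measurable_levels => l.
apply: (measurable_nat_family (N := fun y => (minn l (tau y).-1).+1) (g := fun k _ => phi k)) => [|k].
  apply: (measurable_nat_family (g := fun k _ => (minn l k.-1).+1) mtau) => k.
  exact: measurable_cst.
exact: measurable_cst.
Qed.

Let bm_height (phi : nat -> R) B : (forall k, `|phi k| <= B) -> bm (fun w => phi (height w)).
Proof. by move=> pB; split; [exact: measurable_height | exists B]. Qed.

Lemma bm_cost : bm cost.
Proof.
apply: bmZ; apply: (bm_height (phi := fun k => (minn k n)%:R) (B := n%:R)) => k.
by rewrite normr_nat ler_nat geq_minr.
Qed.

(* Where the height exceeds [n], the trivial bound [m <= n] on the sum is used
   instead of [key_estimate_ge0], so that the cost is bounded. *)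
Lemma tower_decorrelation m g : (m <= n)%N -> bm g ->
  `|EP (fun w => g (iter m f w) * ergodic_sum f tower_obs m w)| <=
  EP (fun w => `|g w| * cost w).
Proof.
move=> mn bg; have fP := tower_invariant; have mf := measurable_tower_map.
have [mg [B gB]] := bg.
pose low k : R := (k <= n)%N%:R; pose high k : R := (n < k)%N%:R.
have blow : bm (fun w => low (height w)).
  by apply: (bm_height (B := 1)) => k; rewrite /low normr_nat lern1 leq_b1.
have bhigh : bm (fun w => high (height w)).
  by apply: (bm_height (B := 1)) => k; rewrite /high normr_nat lern1 leq_b1.
pose gp w := Num.max (g w) 0 * low (height w).
pose gn w := Num.max (- g w) 0 * low (height w).
pose gh w := g w * high (height w).
have bneg : bm (fun w => - g w).
  by apply: (bm_ext (g := fun y => -1 * g y)) => [y|]; [rewrite mulN1r | exact: bmZ].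
have bgp : bm gp by apply: bmM => //; apply: bm_max => //; exact: bm_cst.
have bgn : bm gn by apply: bmM => //; apply: bm_max => //; exact: bm_cst.
have bgh : bm gh by exact: bmM.
have gp0 w : 0 <= gp w by rewrite mulr_ge0// le_max lexx orbT.
have gn0 w : 0 <= gn w by rewrite mulr_ge0// le_max lexx orbT.
have gE w : g w = gp w - gn w + gh w.
  rewrite /gp /gn /gh /low /high.
  case: leqP => _ /=; rewrite ?mulr1 ?mulr0; last by rewrite subrr add0r.
  have [q0|q0] := leP 0 (g w).
    by rewrite max_r ?subr0 ?addr0// oppr_le0.
  by rewrite max_l ?sub0r ?opprK ?addr0// oppr_ge0 ltW.
have gNE w : `|g w| * cost w = key_const * (gp w * (height w)%:R)
    + key_const * (gn w * (height w)%:R) + key_const * (`|gh w| * n%:R).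
  rewrite /cost /gp /gn /gh /low /high; case: leqP => hn /=.
    rewrite !mulr1 mulr0 normr0 mul0r mulr0 addr0 -mulrDr -mulrDl.
    rewrite mulrCA; congr (_ * (_ * _)).
    have [q0|q0] := leP 0 (g w).
      by rewrite ger0_norm// max_r ?addr0// oppr_le0.
    by rewrite ltr0_norm// max_l ?add0r// oppr_ge0 ltW.
  by rewrite !mulr0 !mul0r mulr0 !add0r mulr1 mulrCA.
have bS : bm (ergodic_sum f tower_obs m) by apply: bm_ergodic_sum => //; exact: bm_tower_obs.
have bq q : bm q -> bm (fun w => q (iter m f w) * ergodic_sum f tower_obs m w).
  by move=> b; apply: bmM => //; exact: (bm_iter mf).
have bh0 (q : Om -> R) : bm q -> bm (fun w => q w * low (height w)) by move=> b; exact: bmM.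
have bmh (q : Om -> R) : bm q -> (forall w, q w = q w * low (height w)) ->
    bm (fun w => key_const * (q w * (height w)%:R)).
  move=> b qq; apply: bmZ.
  apply: (bm_ext (g := fun w => q w * (low (height w) * (height w)%:R))).
    by move=> w; rewrite mulrA -qq.
  apply: bmM => //; apply: (bm_height (phi := fun k => low k * k%:R) (B := n%:R)) => k.
  by rewrite /low; case: leqP => kn; rewrite ?mul0r ?mul1r ?normr0 ?normr_nat ?ler_nat.
have lowlow w : low (height w) = low (height w) * low (height w).
  by rewrite /low; case: leqP => _; rewrite ?mulr1 ?mulr0.
have b1 : bm (fun w => key_const * (gp w * (height w)%:R)).
  by apply: bmh => // w; rewrite /gp -mulrA -lowlow.
have b2 : bm (fun w => key_const * (gn w * (height w)%:R)).
  by apply: bmh => // w; rewrite /gn -mulrA -lowlow.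
have b3 : bm (fun w => `|gh w| * n%:R) by apply: bmM; [exact: bm_norm|exact: bm_cst].
rewrite (funext gNE).
rewrite (expectD _ (bmD b1 b2) (bmZ key_const b3)) (expectD _ b1 b2).
rewrite (_ : (fun w => g (iter m f w) * _) = (fun w =>
    (gp (iter m f w) * ergodic_sum f tower_obs m w - gn (iter m f w) * ergodic_sum f tower_obs m w)
    + gh (iter m f w) * ergodic_sum f tower_obs m w)); last first.
  by apply/funext => w; rewrite gE mulrDl mulrBl.
rewrite (expectD _ (bmB (bq _ bgp) (bq _ bgn)) (bq _ bgh)) (expectB _ (bq _ bgp) (bq _ bgn)).
rewrite (le_trans (ler_normD _ _))// lerD//.
  rewrite (le_trans (ler_normB _ _))// lerD//.
    by rewrite /expect RintegralZl ?key_estimate_ge0//; apply: dominated_integrable;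
       exact: dominatedM dominated_height.
  by rewrite /expect RintegralZl ?key_estimate_ge0//; apply: dominated_integrable;
       exact: dominatedM dominated_height.
have bhi : bm (fun w => `|gh (iter m f w)| * n%:R).
  exact: (bm_iter mf m b3).
apply: (@le_trans _ _ (EP (fun w => `|gh w| * n%:R))).
  rewrite -(expect_iter mf fP m b3) (le_trans (le_norm_expect _ (bq _ bgh)))//.
  apply: expect_le => //; first exact: bm_norm (bq _ bgh).
  move=> w; rewrite normrM ler_wpM2l//.
  apply: (le_trans (ler_norm_sum _ _ _)).
  apply: (@le_trans _ _ (\sum_(i < m) 1)); first by apply: ler_sum => i _; exact: tower_obs_le1.
  by rewrite sumr_const card_ord ler_nat.
rewrite (expectZ _ key_const b3) ler_peMl//.
by apply: expect_ge0 => w; rewrite mulr_ge0.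
Qed.

(** The column over [y] has [tau y] levels, each of cost at most [key_const] times [tau y]; the
    number of levels uses up one power of the return time. The normalization by the mean return
    time, which is at least 1, is simply dropped. *)
Lemma cost_moment (q M : R) : 1 <= q ->
  (\int[mu]_y ((tau y)%:R `^ (q + 1))%:E <= M%:E)%E ->
  EP (fun w => cost w `^ q) <= key_const `^ q * M.
Proof.
move=> q1 tq; have q0 : 0 <= q by exact: le_trans ler01 q1.
have bc : bm (fun w => cost w `^ q) by apply: bm_powR => //; exact: bm_cost.
have [mc _] := bc.
rewrite -lee_fin /expect /Rintegral fineK; last first.
  exact: (integrable_fin_num measurableT (bm_integrable P bc)).
rewrite (integral_tower mc); last by move=> w; exact: powR_ge0.
have mtq : measurable_fun setT (fun y => ((tau y)%:R `^ (q + 1))%:E).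
  apply/measurable_EFinP.
  apply: (measurable_nat_family (g := fun k _ => k%:R `^ (q + 1) : R) mtau) => k.
  exact: measurable_cst.
apply: (@le_trans _ _ (\int[mu]_y ((key_const `^ q)%:E * ((tau y)%:R `^ (q + 1))%:E))%E).
  apply: ge0_le_integral => //.
  - move=> y _; rewrite lee_fin divr_ge0 ?(ltW tm0)//; apply: sumr_ge0 => l _; exact: powR_ge0.
  - apply/measurable_EFinP; apply: measurable_funM => //; exact: measurable_block.
  - exact: measurable_funeM.
  - move=> y _; rewrite -EFinM lee_fin ler_pdivrMr//.
    apply: (@le_trans _ _ (key_const `^ q * (tau y)%:R `^ (q + 1))); last first.
      by rewrite ler_peMr// mulr_ge0 ?powR_ge0.
    apply: (@le_trans _ _ (\sum_(l < tau y) (key_const * (tau y)%:R) `^ q)).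
      apply: ler_sum => l _; apply: powR_le => //; first exact: cost_ge0.
      rewrite ler_wpM2l// ler_nat; apply: leq_trans (geq_minl _ _) _.
      exact: (height_le (y, nat_of_ord l)).
    rewrite sumr_const card_ord -[leLHS]mulr_natr powRM// -mulrA ler_wpM2l ?powR_ge0//.
    by rewrite powRD ?powRr1// gt_eqF// ltr_wpDl.
rewrite ge0_integralZl_EFin ?powR_ge0//.
by rewrite EFinM lee_wpmul2l// lee_fin powR_ge0.
Qed.

End Horizon.
End KeyEstimate.
End TowerMeasure.

(** * Reduction of a nonuniformly expanding map *)

Section Enumeration.
Context d (X : measurableType d).

(** The complement of [Y] becomes the branch of index 0, so that the branches cover the whole space,
    and codes taken by no element of the partition give empty branches. *)
Lemma countable_partition_enum (alpha : set (set X)) (Y : set X) :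
  countable alpha -> partition alpha id Y -> (forall a, alpha a -> measurable a) ->
  measurable Y -> exists A : nat -> set X,
    [/\ forall i, measurable (A i), trivIset setT A, \bigcup_i A i = setT,
      A 0%N = ~` Y & forall i, A i.+1 = set0 \/ alpha (A i.+1)].
Proof.
move=> /countable_injP[c cinj] [covY tal _] mal mY.
pose B i := \bigcup_(a in [set a | alpha a /\ c a = i]) a.
have BE i : B i = set0 \/ (alpha (B i) /\ c (B i) = i).
  have [[a [aa ca]]|none] := pselect (exists a, alpha a /\ c a = i).
    right; have -> : B i = a; last by [].
    apply/seteqP; split=> [x [b [ab cb] bx]|x ax]; last by exists a.
    by rewrite (cinj a b) ?inE// ca cb.
  left; apply/seteqP; split=> // x [a aa _]; exact: none (ex_intro _ a aa).
have mB i : measurable (B i).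
  by have [->|[/mal]] := BE i.
have BY : \bigcup_i B i = Y.
  rewrite -covY; apply/seteqP; split=> [x [i _ [a [aa _] ax]]|x [a aa ax]]; first by exists a.
  by exists (c a) => //; exists a.
exists (fun i => if i is j.+1 then B j else ~` Y); split => //.
- by case=> [|i]; [exact: measurableC | exact: mB].
- have BsubY i x : B i x -> Y x by rewrite -BY => Bx; exists i.
  apply/trivIsetP => -[|i] [|j] _ _ // ij.
  + by apply/seteqP; split=> // x [nY /BsubY].
  + by apply/seteqP; split=> // x [/BsubY Yx /(_ Yx)].
  + have [->|[ai ci]] := BE i; first by rewrite set0I.
    have [->|[aj cj]] := BE j; first by rewrite setI0.
    move/trivIsetP : tal => /(_ _ _ ai aj); apply.
    by apply: contra ij => /eqP e; rewrite -ci -cj e.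
- apply/seteqP; split=> // x _; have [Yx|nYx] := pselect (Y x); last by exists 0%N.
  by move: Yx; rewrite -BY => -[i _ Bx]; exists i.+1.
- by move=> i; have [->|[]] := BE i; [left|right].
Qed.

Lemma measurable_piecewise (A : nat -> set X) (N : X -> nat) :
  (forall i, measurable (A i)) -> \bigcup_i A i = setT ->
  (forall i x y, A i x -> A i y -> N x = N y) -> measurable_fun setT N.
Proof.
move=> mA cA cst _ B _; rewrite setTI.
have -> : N @^-1` B = \bigcup_(i in [set i | exists2 x, A i x & B (N x)]) A i.
  apply/seteqP; split=> [x Bx|x [i [y Ay By] Ax]]; last by rewrite /preimage/= (cst i x y).
  have : (\bigcup_i A i) x by rewrite cA.
  by move=> [i _ Ax]; exists i => //; exists x.
by apply: bigcup_measurable => i _; exact: mA.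
Qed.

End Enumeration.

Section BaseReduction.
Context (disp : measure_display) (R : realType) (L : borelMetricType disp R).
Variables (rho : {finite_measure set L -> \bar R}) (T : L -> L) (Y : set L)
  (alpha : set (set L)) (tau : L -> nat) (beta eta C1 : R) (muY : probability L R).
Hypotheses (nue : nonuniformly_expanding rho T Y alpha tau beta eta C1)
  (acip : is_acip rho Y (induced_map T tau) muY).

(** Extended by 1 off [Y] to make the induced map total with return times at least 1; the complement
    of [Y] is null for [muY]. *)
Definition total_return y : nat := if y \in Y then tau y else 1.

Local Notation tau' := total_return.
Local Notation F := (induced_map T total_return).
Local Notation D := (diameter L).

Lemma total_returnE y : Y y -> total_return y = tau y.
Proof. by move=> Yy; rewrite /total_return mem_set. Qed.

Lemma total_return_ge1 y : (1 <= total_return y)%N.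
Proof. by rewrite /total_return; case: ifPn => // /set_mem; exact: (nue_tau_ge1 nue). Qed.

Lemma induced_mapE y : Y y -> F y = induced_map T tau y.
Proof. by move=> Yy; rewrite /induced_map total_returnE. Qed.

Lemma le_diameter (x y : L) : mdist x y <= D.
Proof.
have [M hM] := nue_bounded nue.
by apply: ub_le_sup; [exists M => _ [a [b ->]]; exact: hM | exists x, y].
Qed.

Lemma diameter_ge0 : 0 <= D.
Proof. by have := le_diameter point point; rewrite mdistxx. Qed.

Lemma alpha_sub a : alpha a -> a `<=` Y.
Proof. by have [<- _ _] := nue_partition nue => aa x ax; exists a. Qed.

Let mY := nue_measurable_base nue.

Lemma acip_complement : muY (~` Y) = 0%E.
Proof.
have [Y1 T1 _ _] := acip.
by rewrite probability_setC// [X in (_ - X)%E](Y1 : _ = _) subee.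
Qed.

Lemma acip_restrict E : measurable E -> muY E = muY (Y `&` E).
Proof.
move=> mE; rewrite setIC -[in LHS](setIT E) -(setUv Y) setIUr measureU//; last 3 first.
- exact: measurableI.
- by apply: measurableI => //; exact: measurableC.
- by rewrite setIACA setICr setI0.
rewrite [X in (_ + X)%E](_ : _ = 0%E) ?adde0//.
apply: subset_measure0 acip_complement; [|exact: measurableC | exact: subIsetr].
by apply: measurableI => //; exact: measurableC.
Qed.

Section Branches.
Variable A : nat -> set L.
Hypotheses (mA : forall i, measurable (A i)) (tA : trivIset setT A)
  (coverA : \bigcup_i A i = setT) (A0 : A 0%N = ~` Y)
  (AS : forall i, A i.+1 = set0 \/ alpha (A i.+1)).

Lemma total_return_cst i x y : A i x -> A i y -> tau' x = tau' y.
Proof.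
case: i => [|i]; rewrite ?A0.
  by move=> nx ny; rewrite /total_return !memNset.
have [->//|aa] := AS i => Ax Ay.
rewrite !total_returnE; first exact: (nue_tau_cst nue aa Ax Ay).
- exact: alpha_sub aa _ Ay.
- exact: alpha_sub aa _ Ax.
Qed.

Lemma measurable_total_return : measurable_fun setT tau'.
Proof. exact: measurable_piecewise mA coverA total_return_cst. Qed.

Lemma branch_cases i : muY (A i) = 0%E \/
  [/\ forall x y, A i x -> A i y -> tau' x = tau' y,
      forall x y, A i x -> A i y -> beta * mdist x y <= mdist (F x) (F y) &
      forall x y, A i x -> A i y -> forall l, (l < tau' x)%N ->
         mdist (iter l T x) (iter l T y) <= C1 * mdist (F x) (F y)].
Proof.
case: i => [|i]; first by left; rewrite A0 acip_complement.
have [->|aa] := AS i; first by left; rewrite measure0.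
have aY := alpha_sub aa; right; split.
- by move=> x y; exact: total_return_cst.
- by move=> x y Ax Ay; rewrite !induced_mapE; [exact: (nue_expanding nue aa Ax Ay)|exact: aY..].
- move=> x y Ax Ay l; rewrite total_returnE; last exact: aY.
  by move=> lt; rewrite !induced_mapE; [exact: (nue_backward nue aa Ax Ay lt)|exact: aY..].
Qed.

Let mT : measurable_fun setT T. Proof. by have [] := nue_nonsingular nue. Qed.

Lemma measurable_total_induced : measurable_fun setT F.
Proof. exact: measurable_induced mT measurable_total_return. Qed.

Lemma acip_invariant E : measurable E -> muY (F @^-1` E) = muY E.
Proof.
move=> mE; have [_ _ _ inv] := acip.
rewrite acip_restrict; last by rewrite -[X in measurable X]setTI; exact: measurable_total_induced.
rewrite -[RHS]inv//; congr (muY _); apply/seteqP; split=> x [Yx]; rewrite /preimage/= induced_mapE//.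
Qed.

Let lam E := fine (rho (E `&` Y)).

Let lam0 E : measurable E -> 0 <= lam E. Proof. by move=> _; exact: fine_ge0. Qed.

Let rhofin E : measurable E -> rho (E `&` Y) \is a fin_num.
Proof. by move=> mE; apply: fin_num_measure; exact: measurableI. Qed.

Let lamT : 0 < lam setT.
Proof.
rewrite /lam setTI fine_gt0// (nue_base_gt0 nue)/= ltey_eq.
by rewrite fin_num_measure.
Qed.

Let lam_mono E E' : measurable E -> measurable E' -> E `<=` E' -> lam E <= lam E'.
Proof.
move=> mE mE' EE'; rewrite fine_le ?rhofin// le_measure ?inE//; try exact: measurableI.
exact: setSI.
Qed.

Let lam_expanding : expanding_branches F A beta lam.
Proof.
case=> [|i]; first by right; rewrite /lam A0 setICl measure0.
have [e|aa] := AS i; first by right; rewrite e /lam set0I measure0.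
left=> x y Ax Ay; have aY := alpha_sub aa.
by rewrite !induced_mapE; [exact: (nue_expanding nue aa Ax Ay)|exact: aY..].
Qed.

(** For a part of the branch, [nu] is the mass of its image, up to the null set omitted by [Y'], and
    [rho] is the integral of [zeta] against [nu]. The log-Hoelder bound on [zeta] therefore
    integrates to the product form by [integral_comparison]. *)
Let lam_distortion : bounded_distortion eta F A lam C1.
Proof.
move=> i t E1 E2 t0 mE1 mE2 tE.
have mF := measurable_total_induced.
have C11 := nue_C1 nue; have /andP[eta0 _] := nue_eta nue.
have rhs0 : 0 <= expR (C1 * t `^ eta) * (lam E1 * lam (branch F A i E2)).
  by rewrite !mulr_ge0 ?expR_ge0 ?lam0//; exact: measurable_branch.
have [e|[j [-> aa]]] : A i `&` Y = set0 \/ exists j, i = j.+1 /\ alpha (A j.+1).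
  case: i {rhs0} => [|i]; first by left; rewrite A0 setICl.
  by have [->|aa] := AS i; [left; rewrite set0I | right; exists i].
  have -> : lam (branch F A i E1) = 0; last by rewrite mul0r.
  by rewrite /lam /branch setIAC e set0I measure0.
set a := A j.+1 in aa *.
have aY := alpha_sub aa; have ma : measurable a := mA j.+1.
have [a' [Y' [[[ma' mY'] [a'a Y'Y] [na nY] bij mbij] [zeta [mz z0 [nu [nuE rhoE]] lz]]]]] :=
  nue_full_branch_distortion nue aa.
set G := induced_map T tau in bij mbij nuE lz.
have GF x : a x -> F x = G x by move=> ax; rewrite induced_mapE//; exact: aY.
have mb1 := measurable_branch mF mA j.+1 mE1; have mb2 := measurable_branch mF mA j.+1 mE2.
have brY E : branch F A j.+1 E `&` Y = branch F A j.+1 E.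
  by apply/setIidPl => x [ax _]; exact: aY.
have bra E : branch F A j.+1 E `<=` a by move=> x [].
have nub E : measurable E -> nu (branch F A j.+1 E) = rho (E `&` Y).
  move=> mE; rewrite nuE; last exact: measurable_branch.
  have -> : G @` (branch F A j.+1 E `&` a') = E `&` Y'.
    have [fun_ab _ surj] := bij.
    apply/seteqP; split=> [_ [x [[ax Ex] a'x] <-]|y [Ey Y'y]].
      by split; [rewrite -GF | exact: fun_ab].
    have [x a'x xy] := surj y Y'y; exists x => //; split => //; split; first exact: a'a.
    by rewrite /preimage/= GF ?xy//; exact: a'a.
  have -> : E `&` Y = (E `&` Y') `|` (E `&` (Y `\` Y')).
    by rewrite -setIUr setDUK.
  rewrite measureU//; last 3 first.
  - exact: measurableI.
  - by apply: measurableI => //; exact: measurableD.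
  - by rewrite setIACA setDIK setI0.
  rewrite [X in (_ + X)%E](_ : _ = 0%E) ?adde0//.
  apply: subset_measure0 nY; [|exact: measurableD|exact: subIsetr].
  by apply: measurableI => //; exact: measurableD.
have b0 x : a x -> 0 <= zeta x by move=> ax; rewrite ltW// z0.
rewrite /lam !brY -lee_fin !EFinM !fineK ?rhofin//; last 2 first.
- by rewrite -brY rhofin.
- by rewrite -brY rhofin.
rewrite (rhoE _ mb1 (bra _)) (rhoE _ mb2 (bra _)) -nub// -(nub E1)//.
apply: integral_comparison => //.
- exact: measurable_funS mz.
- exact: measurable_funS mz.
- by move=> x /bra; exact: b0.
- by move=> x /bra; exact: b0.
move=> x y [ax Ex] [ay Ey].
rewrite -ler_pdivrMr ?z0// -[leLHS]lnK ?posrE ?divr_gt0 ?z0// ler_expR.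
rewrite lnM ?posrE ?invr_gt0 ?z0// lnV ?posrE ?z0//.
apply: le_trans (ler_norm _) _; apply: (le_trans (lz x y ax ay)).
rewrite ler_wpM2l//; first exact: le_trans ler01 C11.
apply: powR_le; rewrite ?mdist_ge0 ?(ltW eta0)// -!GF//.
exact: tE.
Qed.

(** Twice the constant of [invariant_regular], the doubling being that of [distortion_transfer]. *)
Definition acip_distortion : R := 2 * (C1 / (1 - beta `^ (- eta)) + 1).

Lemma acip_bounded_distortion :
  bounded_distortion eta F A (fun E => fine (muY E)) acip_distortion.
Proof.
have [_ _ muYrho _] := acip.
have C11 := nue_C1 nue; have eta01 := nue_eta nue; have beta1 := nue_beta nue.
have gamma1 : beta `^ (- eta) < 1.
  have /andP[e0 _] := eta01; have b0 : 0 < beta by exact: lt_trans beta1.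
  rewrite powRN invf_lt1 ?powR_gt0//.
  by rewrite -(powRr0 beta) /powR gt_eqF// ltr_expR mul0r mulr_gt0// ln_gt0.
have g1 : 0 < 1 - beta `^ (- eta) by rewrite subr_gt0.
have C10 : 0 <= C1 by exact: le_trans C11.
have approx (e : R) : 0 < e -> exists K s, [/\ 0 <= K, sigma_add s, regular eta lam K s &
    forall E, measurable E -> `|fine (muY E) - s E| <= e].
  exact: (regular_approximation eta01 le_diameter mY acip_complement muYrho).
have reg := invariant_regular le_diameter eta01 measurable_total_induced mA tA coverA beta1
  lam0 lamT lam_mono lam_distortion C10 lam_expanding
  (nu := fun E => fine (muY E)) (fun E _ => fine_ge0 (measure_ge0 _ _))
  (fun E mE => congr1 fine (acip_invariant mE)) approx.
rewrite /acip_distortion mulr2n mulrDl !mul1r.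
apply: (distortion_transfer le_diameter eta01 measurable_total_induced mA beta1
  lam0 lamT lam_mono lam_distortion lam_expanding _ _ reg).
  by rewrite addr_ge0// divr_ge0// ltW.
set g := beta `^ (- eta) in g1 *; set q := C1 / (1 - g).
have qE : q * (1 - g) = C1 by rewrite /q divfK// gt_eqF.
rewrite -qE; lra.
Qed.

End Branches.
End BaseReduction.

(** * Moment bounds for the original map *)

Section Norms.
Context {R : realType}.

Lemma sum_sqr_le n (x : 'I_n -> R) : (forall i, 0 <= x i) ->
  \sum_i x i ^+ 2 <= (\sum_i x i) ^+ 2.
Proof.
move=> x0; elim: n x x0 => [|n ih] x x0; first by rewrite !big_ord0 expr0n.
rewrite !big_ord_recr /= sqrrD lerD2r.
apply: (le_trans (ih _ (fun i => x0 _))); rewrite lerDl mulrn_wge0// mulr_ge0//.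
exact: sumr_ge0.
Qed.

Lemma frobenius_le m n (M : 'M[R]_(m, n)) : frobenius M <= \sum_i \sum_j `|M i j|.
Proof.
have S0 : 0 <= \sum_i \sum_j `|M i j| by apply: sumr_ge0 => i _; exact: sumr_ge0.
rewrite /frobenius -[leRHS](ger0_norm S0) -sqrtr_sqr ler_wsqrtr//.
apply: (le_trans _ (sum_sqr_le _)); last by move=> i; exact: sumr_ge0.
apply: ler_sum => i _.
rewrite (eq_bigr (fun j => `|M i j| ^+ 2)); first exact: sum_sqr_le.
by move=> j _; rewrite real_normK// num_real.
Qed.

Lemma frobenius_ge0 m n (M : 'M[R]_(m, n)) : 0 <= frobenius M.
Proof. exact: sqrtr_ge0. Qed.

Lemma le_frobenius m n (M : 'M[R]_(m, n)) i j : `|M i j| <= frobenius M.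
Proof.
rewrite /frobenius -sqrtr_sqr ler_wsqrtr// (bigD1 i)//= (bigD1 j)//=.
rewrite -addrA lerDl addr_ge0// ?sumr_ge0// => k _; rewrite ?sqr_ge0//.
by apply: sumr_ge0 => l _; exact: sqr_ge0.
Qed.

Lemma powR_sum_ord n (x : 'I_n -> R) (s : R) : 1 <= s -> (forall i, 0 <= x i) ->
  (\sum_i x i) `^ s <= n%:R `^ (s - 1) * \sum_i x i `^ s.
Proof.
move=> s1 x0.
pose y k := if insub k is Some i then x i else 0.
have yE (i : 'I_n) : y i = x i by rewrite /y valK.
have y0 k : 0 <= y k by rewrite /y; case: insub.
have e1 : \sum_(i < n) y i = \sum_i x i by apply: eq_bigr => i _; exact: yE.
have e2 : \sum_(i < n) y i `^ s = \sum_i x i `^ s by apply: eq_bigr => i _; rewrite yE.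
by rewrite -e1 -e2; exact: powR_sum_le.
Qed.

Lemma powR_natM n (s : R) : 1 <= s -> n%:R * n%:R `^ (s - 1) = n%:R `^ s :> R.
Proof. by move=> s1; rewrite mulr_powRB1// (lt_le_trans ltr01). Qed.

Context d (X : measurableType d).

Lemma measurable_sqrt_fun (g : X -> R) : (forall x, 0 <= g x) ->
  measurable_fun setT g -> measurable_fun setT (fun x => Num.sqrt (g x)).
Proof.
move=> g0 mg; rewrite (_ : (fun x => _) = (fun x => g x `^ 2^-1)); last first.
  by apply/funext => x; rewrite powR12_sqrt.
exact: (measurableT_comp (measurable_powR _)).
Qed.

Lemma measurable_frobenius m n (M : X -> 'M[R]_(m, n)) :
  (forall i j, measurable_fun setT (fun x => M x i j)) ->
  measurable_fun setT (fun x => frobenius (M x)).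
Proof.
move=> mM; apply: measurable_sqrt_fun.
  by move=> x; apply: sumr_ge0 => i _; apply: sumr_ge0 => j _; exact: sqr_ge0.
apply: measurable_sum => i; apply: measurable_sum => j; exact: measurable_funX.
Qed.

Lemma measurable_bigmax n (g : nat -> X -> R) : (forall k, measurable_fun setT (g k)) ->
  measurable_fun setT (fun x => \big[Num.max/0]_(k < n) g k x).
Proof.
move=> mg; elim: n g mg => [|n ih] g mg.
  by under eq_fun do rewrite big_ord0; exact: measurable_cst.
under eq_fun do rewrite big_ord_recl.
by apply: measurable_maxr => //; apply: (ih (fun k => g k.+1)) => k.
Qed.

Lemma bm_sum_ord n (g : 'I_n -> X -> R) : (forall i, bounded_measurable (g i)) ->
  bounded_measurable (fun x => \sum_i g i x).
Proof.
elim: n g => [|n ih] g bg.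
  by under eq_fun do rewrite big_ord0; exact: bm_cst.
under eq_fun do rewrite big_ord_recr.
by apply: bmD => //; exact: ih.
Qed.

Lemma expect_sum_ord (P : probability X R) n (g : 'I_n -> X -> R) :
  (forall i, bounded_measurable (g i)) ->
  expect P (fun x => \sum_i g i x) = \sum_i expect P (g i).
Proof.
elim: n g => [|n ih] g bg.
  by rewrite big_ord0 -[RHS](expect_cst P); congr expect; apply/funext => x; rewrite big_ord0.
rewrite big_ord_recr /= -ih// -expectD//; last exact: bm_sum_ord.
by congr expect; apply/funext => x; rewrite big_ord_recr.
Qed.

(** For every [r >= 1] the number [1 + c] exceeds the [r]-th root of [c]. It replaces this root in
    the final constants, which avoids roots of quantities that might vanish. *)
Lemma power_bound (a b c r : R) : 0 <= a -> 0 <= b -> 0 <= c -> 1 <= r ->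
  a `^ r * (c * b `^ r) <= (a * (1 + c) * b) `^ r.
Proof.
move=> a0 b0 c0 r1; have c1 : 0 <= 1 + c by rewrite addr_ge0.
rewrite !powRM ?mulr_ge0// -mulrA ler_wpM2l ?powR_ge0// ler_wpM2r ?powR_ge0//.
apply: (@le_trans _ _ ((1 + c) `^ 1)); first by rewrite powRr1// lerDr.
by apply: ler_powR => //; rewrite lerDl.
Qed.

Lemma expect_power_sum (P : probability X R) n (g : 'I_n -> X -> R) (r K : R) :
  1 <= r -> (forall i, bounded_measurable (g i)) -> (forall i x, 0 <= g i x) ->
  (forall i, expect P (fun x => g i x `^ r) <= K) ->
  expect P (fun x => (\sum_i g i x) `^ r) <= n%:R `^ r * K.
Proof.
move=> r1 bg g0 gK; have r0 : 0 <= r by exact: le_trans r1.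
have bgr i : bounded_measurable (fun x => g i x `^ r) by exact: bm_powR.
apply: (@le_trans _ _ (expect P (fun x => n%:R `^ (r - 1) * \sum_i g i x `^ r))).
  apply: expect_le.
  - by apply: bm_powR => //; exact: bm_sum_ord.
  - by apply: bmZ; exact: bm_sum_ord.
  - by move=> x; exact: powR_sum_ord.
rewrite expectZ; last exact: bm_sum_ord.
rewrite expect_sum_ord// -(powR_natM n r1) mulrAC [leLHS]mulrC ler_wpM2r ?powR_ge0//.
rewrite mulr_natl -[n in leRHS]card_ord -sumr_const; exact: ler_sum.
Qed.

End Norms.

Section Constants.
Context {R : realType}.
Variables (D C1 beta eta p t : R).

(** As [tau >= 1] and [p >= 2], t^p bounds the mean, the second moment and the moment of order [p]
    of the return time; it stands for all three in these constants. *)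
Definition correlation_const : R :=
  4 * t `^ p * decay_const beta eta C1 (acip_distortion beta eta C1) D.

Definition correlation_rate : R := decay_rate beta eta C1 (acip_distortion beta eta C1) D.

Definition cost_const : R := key_const (t `^ p) correlation_const correlation_rate
  (mixing_const (acip_distortion beta eta C1) D).

Definition cost_moment_const : R := cost_const `^ (p - 1) * t `^ p.

Definition first_const : R := moment_const1 (p - 1) cost_moment_const.

Definition second_const : R := moment_const2 (p - 1) cost_const cost_moment_const.

End Constants.

Section SystemBound.
Context (disp : measure_display) (R : realType) (L : borelMetricType disp R).
Variables (rho : {finite_measure set L -> \bar R}) (T : L -> L) (Y : set L)
  (alpha : set (set L)) (tau : L -> nat) (beta eta C1 p t : R) (muY : probability L R).
Hypotheses (nue : nonuniformly_expanding rho T Y alpha tau beta eta C1)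
  (acip : is_acip rho Y (induced_map T tau) muY).
Variable A : nat -> set L.
Hypotheses (mA : forall i, measurable (A i)) (tA : trivIset setT A)
  (coverA : \bigcup_i A i = setT) (A0 : A 0%N = ~` Y)
  (AS : forall i, A i.+1 = set0 \/ alpha (A i.+1)).

Local Notation tau' := (total_return Y tau).
Local Notation F := (induced_map T tau').
Local Notation D := (diameter L).

Hypotheses (p2 : 2 <= p)
  (tau_p : (\int[muY]_y ((tau' y)%:R `^ p)%:E <= (t `^ p)%:E)%E).

Let mtau : measurable_fun setT tau' := measurable_total_return nue mA coverA A0 AS.
Let tau1 : forall y, (1 <= tau' y)%N := total_return_ge1 nue.
Let mT : measurable_fun setT T. Proof. by have [] := nue_nonsingular nue. Qed.
Let mF : measurable_fun setT F := measurable_total_induced nue mA coverA A0 AS.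
Let muF E (mE : measurable E) : muY (F @^-1` E) = muY E :=
  acip_invariant nue acip mA coverA A0 AS mE.

Lemma return_square : (\int[muY]_y ((tau' y)%:R ^+ 2)%:E <= (t `^ p)%:E)%E.
Proof.
apply: le_trans tau_p; apply: ge0_le_integral => //.
- apply/measurable_EFinP; apply: measurable_funX; exact: measurable_nat_real.
- apply/measurable_EFinP.
  apply: (measurable_nat_family (g := fun k _ => k%:R `^ p : R) mtau) => k.
  exact: measurable_cst.
- move=> y _; rewrite lee_fin -powR_mulrn//.
  by apply: ler_powR => //; rewrite ler1n.
Qed.

Let C0 : 0 <= acip_distortion beta eta C1.
Proof.
have C11 := nue_C1 nue; have eta01 := nue_eta nue; have beta1 := nue_beta nue.
have gamma1 : beta `^ (- eta) < 1.
  have /andP[e0 _] := eta01; have b0 : 0 < beta by exact: lt_trans beta1.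
  rewrite powRN invf_lt1 ?powR_gt0//.
  by rewrite -(powRr0 beta) /powR gt_eqF// ltr_expR mul0r mulr_gt0// ln_gt0.
by rewrite mulr_ge0// addr_ge0// divr_ge0 ?subr_ge0 ?(ltW gamma1)// (le_trans _ C11).
Qed.

Local Notation f := (tower_map tau' F).
Local Notation P := (tower_prob mtau tau1 return_square).
Local Notation EP := (expect [the probability _ _ of P]).

Let lam01 : 0 <= correlation_rate D C1 beta eta < 1.
Proof.
exact: (decay_rate_bounds (le_diameter nue) (nue_eta nue) (nue_beta nue) (nue_C1 nue) C0).
Qed.

Let tp0 : 0 <= t `^ p. Proof. exact: powR_ge0. Qed.

Let K10 : 0 <= correlation_const D C1 beta eta p t.
Proof. by rewrite !mulr_ge0 ?expR_ge0. Qed.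

Let B00 : 0 <= mixing_const (acip_distortion beta eta C1) D. Proof. exact: expR_ge0. Qed.

Section Observable.
Variable v : L -> R.
Hypotheses (mv : measurable_fun setT v) (v1 : forall x, `|v x| <= 1)
  (v_holder : forall x y, `|v x - v y| <= mdist x y `^ eta)
  (v_mean0 : expect muY (block_sum T tau' v) = 0).

Definition orbit_values l y : R := v (iter l T y).

Local Notation u := (tower_obs tau' orbit_values).
Local Notation cost_n := (cost tau' (t `^ p) (correlation_const D C1 beta eta p t)
  (correlation_rate D C1 beta eta) (mixing_const (acip_distortion beta eta C1) D)).

Let mvv l : measurable_fun setT (orbit_values l).
Proof. by apply: (measurableT_comp mv); exact: measurable_iter. Qed.

Let vv1 l y : `|orbit_values l y| <= 1. Proof. exact: v1. Qed.

Let decay n h : bounded_measurable h -> (forall y, 0 <= h y) ->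
  `|expect muY (fun y => h (iter n.+1 F y) * \sum_(l < tau' y) orbit_values l y)| <=
  correlation_const D C1 beta eta p t * correlation_rate D C1 beta eta ^+ n * expect muY h.
Proof.
move=> bh h0.
have := block_sum_decay mT mtau tau1 mA tA coverA muF (le_diameter nue) (nue_eta nue)
  (nue_beta nue) (nue_C1 nue) C0 (branch_cases nue acip A0 AS)
  (acip_bounded_distortion nue acip mA tA coverA A0 AS) return_square mv v1 v_holder
  v_mean0 n bh h0.
move=> /le_trans; apply; rewrite ler_wpM2r//; first exact: expect_ge0.
have /andP[l0 _] := lam01; rewrite ler_wpM2r ?exprn_ge0//.
rewrite ler_wpM2r ?expR_ge0// ler_wpM2l//.
exact: tau_mean_le mtau tau1 return_square.
Qed.

Let mixing (w : nat -> R) (w0 : forall k, 0 <= w k) (w1 : forall k, w k <= k%:R) :=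
  quasi_independence mT mtau tau1 mA tA coverA (le_diameter nue) (nue_eta nue)
  C0 (branch_cases nue acip A0 AS)
  (acip_bounded_distortion nue acip mA tA coverA A0 AS) return_square w0 w1.

Lemma observable_bm : bounded_measurable u.
Proof. exact: bm_tower_obs. Qed.

Lemma observable_le1 w : `|u w| <= 1. Proof. exact: v1. Qed.

Lemma observable_decorrelation n m g : (m <= n)%N -> bounded_measurable g ->
  `|EP (fun w => g (iter m f w) * ergodic_sum f u m w)| <= EP (fun w => `|g w| * cost_n n w).
Proof.
exact: (tower_decorrelation mtau tau1 return_square mF muF mvv vv1 K10 lam01 B00 decay mixing).
Qed.

End Observable.
Let q1 : 1 <= p - 1. Proof. have p2' := p2; lra. Qed.

Let kap1 : 1 <= cost_const D C1 beta eta p t.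
Proof.
have /andP[l0 l1] := lam01.
rewrite /cost_const /key_const -addrA.
have h1 : 0 <= mixing_const (acip_distortion beta eta C1) D * t `^ p by rewrite mulr_ge0.
have h2 : 0 <= correlation_const D C1 beta eta p t / (1 - correlation_rate D C1 beta eta)
    * (1 + mixing_const (acip_distortion beta eta C1) D * t `^ p).
  by rewrite mulr_ge0 ?addr_ge0// divr_ge0// subr_ge0 ltW.
lra.
Qed.

Let mf : measurable_fun setT f := measurable_tower_map mtau mF.

Let fP B (mB : measurable B) : P (f @^-1` B) = P B :=
  tower_invariant mtau tau1 return_square mF muF mB.

Local Notation cost_n := (cost tau' (t `^ p) (correlation_const D C1 beta eta p t)
  (correlation_rate D C1 beta eta) (mixing_const (acip_distortion beta eta C1) D)).
Local Notation u v := (tower_obs tau' (orbit_values v)).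

Let bc n : bounded_measurable (cost_n n).
Proof. exact: bm_cost. Qed.

Let c0 n w : 0 <= cost_n n w.
Proof. exact: (cost_ge0 mtau tau1 return_square K10 lam01 B00). Qed.

Let c_moment n : EP (fun w => cost_n n w `^ (p - 1)) <= cost_moment_const D C1 beta eta p t.
Proof.
apply: (cost_moment mtau tau1 return_square K10 lam01 B00 n q1).
by rewrite subrK.
Qed.

(** The class of normalized coordinates of the observable, for which the constants are universal;
    the Hoelder norm comes back by homogeneity. *)
Definition admissible (v : L -> R) := [/\ measurable_fun setT v, forall x, `|v x| <= 1,
  forall x y, `|v x - v y| <= mdist x y `^ eta & expect muY (block_sum T tau' v) = 0].

Lemma observable_first_moment n v : (1 <= n)%N -> admissible v ->
  EP (fun w => sum_max f (u v) n w `^ (2 * (p - 1))) <=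
  first_const D C1 beta eta p t * n%:R `^ (p - 1).
Proof.
move=> n1 [mv v1 vh v0].
apply: (moment_sum_max mf fP (bc n) (c0 n) q1 n1 (c_moment n)).
- exact: observable_bm.
- exact: observable_le1.
- by move=> m g mn bg; exact: observable_decorrelation.
Qed.

Lemma observable_second_moment n va vb : (1 <= n)%N -> admissible va -> admissible vb ->
  EP (fun w => iterated_max f (cost_n n) n (u va) (u vb) w `^ (p - 1)) <=
  second_const D C1 beta eta p t * n%:R `^ (p - 1).
Proof.
move=> n1 [mva va1 vah va0] [mvb vb1 vbh vb0].
apply: (moment_iterated mf fP (bc n) (c0 n) q1 kap1 n1 _ _ (c_moment n)).
- move=> w; exact: (cost_step _ mtau tau1 return_square K10 lam01 B00).
- move=> w; exact: (cost_top mtau tau1 return_square K10 lam01 B00).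
- exact: observable_bm.
- exact: observable_le1.
- exact: observable_bm.
- exact: observable_le1.
- by move=> m g mn bg; exact: observable_decorrelation.
- by move=> m g mn bg; exact: observable_decorrelation.
Qed.

Section Projection.
Variable mu : probability L R.
Hypothesis mu_tower : forall B, measurable B ->
  mu B = pushforward (tower_measure Y tau muY) (tower_proj T) B.

(* Truncating the level makes the projection a semiconjugacy on all of
   [L * nat], and not only on the tower. *)
Definition orbit_point (w : L * nat) : L := iter (minn w.2 (tau' w.1).-1) T w.1.

Lemma orbit_point_map w : orbit_point (f w) = T (orbit_point w).
Proof.
case: w => y l; rewrite /orbit_point /tower_map /=; have t1 := tau1 y.
case: ltnP => h /=.
  have -> : minn l.+1 (tau' y).-1 = l.+1 by nat_lia.
  by have -> : minn l (tau' y).-1 = l by nat_lia.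
rewrite min0n /= -iterS /induced_map; congr iter; nat_lia.
Qed.

Lemma orbit_point_iter k w : orbit_point (iter k f w) = iter k T (orbit_point w).
Proof. by elim: k => [//|k ih]; rewrite !iterS orbit_point_map ih. Qed.

Lemma measurable_orbit_point : measurable_fun setT orbit_point.
Proof.
apply: measurable_levels => l; rewrite /orbit_point /=.
apply: (measurable_nat_family (N := fun y => minn l (tau' y).-1) (g := fun k => iter k T)).
  apply: (measurable_nat_family (g := fun k _ => minn l k.-1) mtau) => k.
  exact: measurable_cst.
by move=> k; exact: measurable_iter.
Qed.

Let tower' : set (L * nat) := [set w | (w.2 < tau' w.1)%N].

Let mtower' : measurable tower'.
Proof.
have : measurable_fun setT (fun w : L * nat => (w.2 < tau' w.1)%N).
  by apply: measurable_levels => l; exact: measurable_tau_lt.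
by move=> /(_ measurableT [set true] I); rewrite setTI.
Qed.

Let mY := nue_measurable_base nue.

Let integral_Y (g : L -> \bar R) : measurable_fun setT g -> (forall x, (0 <= g x)%E) ->
  (\int[muY]_x g x = \int[muY]_(x in Y) g x)%E.
Proof.
move=> mg g0; rewrite (@ge0_negligible_integral _ _ _ muY setT (~` Y))//.
- by rewrite setTD setCK.
- exact: measurableC.
- exact: (acip_complement nue acip).
Qed.

Local Notation tm := (tau_mean muY tau').

Let tm0 : 0 < tm.
Proof. exact: lt_le_trans ltr01 (tau_mean_ge1 mtau tau1 return_square). Qed.

(** The two descriptions of the tower measure differ only over the complement of [Y], which is null;
    over [Y] and within the column the truncation of the level does nothing. *)
Lemma orbit_point_law B : measurable B -> mu B = P (orbit_point @^-1` B).
Proof.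
move=> mB; rewrite mu_tower// /pushforward /tower_measure.
have mpB : measurable (orbit_point @^-1` B).
  by rewrite -[X in measurable X]setTI; exact: measurable_orbit_point.
have mB2 := measurableI _ _ mtower' mpB.
have -> : (\int[muY]_(y in Y) (tau y)%:R%:E = tm%:E)%E.
  rewrite /tau_mean /expect /Rintegral fineK; last first.
    exact: (integrable_fin_num measurableT (tau_integrable mtau tau1 return_square)).
  rewrite integral_Y//; last first.
    by apply/measurable_EFinP; exact: measurable_nat_real.
  by apply: eq_integral => y /set_mem Yy; rewrite total_returnE.
rewrite inver gt_eqF//.
have -> : P (orbit_point @^-1` B) =
   ((muY \x @counting nat R) (tower' `&` orbit_point @^-1` B) * (tm^-1)%:E)%E.
  transitivity (\int[muY \x @counting nat R]_(w in orbit_point @^-1` B)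
     ((\1_tower' w)%:E * (tm^-1)%:E))%E.
    apply: eq_integral => w _; rewrite -EFinM /tower_density indicE.
    have -> // : (w \in tower') = (w.2 < tau' w.1)%N.
    by apply/idP/idP => [/set_mem//|h]; exact: mem_set.
  rewrite ge0_integralZr//.
  - by rewrite integral_indic.
  - by apply/measurable_EFinP; exact: measurable_indic.
  - by rewrite lee_fin invr_ge0 ltW.
congr (_ * _)%E.
set B2 := tower' `&` _ in mB2 *.
have mYT : measurable (Y `*` [set: nat]) by exact: measurableX.
have -> : tower_proj T @^-1` B `&` tower Y tau = B2 `&` (Y `*` [set: nat]).
  apply/seteqP; split=> -[y l] /=; rewrite /B2 /tower' /orbit_point /tower_proj /tower /=.
    move=> [Bw [Yy lt]]; rewrite total_returnE//.
    by have -> : minn l (tau y).-1 = l by nat_lia.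
  move=> [[lt Bw] [Yy _]]; move: lt Bw; rewrite total_returnE// => lt.
  by have -> : minn l (tau y).-1 = l by nat_lia.
rewrite -[in RHS](setIT B2) -(setUv (Y `*` [set: nat])) setIUr measureU//; last 3 first.
- exact: measurableI.
- by apply: measurableI => //; exact: measurableC.
- by rewrite setIACA setICr setI0.
rewrite [X in (_ + X)%E](_ : _ = 0%E) ?adde0//.
have mnY : measurable (~` Y) by exact: measurableC.
apply: (@subset_measure0 _ _ _ (muY \x @counting nat R)%E _ (~` Y `*` [set: nat])).
- by apply: measurableI => //; exact: measurableC.
- exact: measurableX.
- by move=> [y l] [_ nYl]; split => // Yy; apply: nYl.
- rewrite [LHS]product_measure1E//.
  by rewrite [X in (X * _)%E](acip_complement nue acip : _ = _) mul0e.
Qed.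

Lemma integral_orbit_point (G : L -> R) : measurable_fun setT G -> (forall x, 0 <= G x) ->
  (\int[mu]_x (G x)%:E = \int[P]_w (G (orbit_point w))%:E)%E.
Proof.
move=> mG G0; have mGE : measurable_fun setT (EFin \o G) by exact/measurable_EFinP.
have -> : (\int[mu]_x (G x)%:E = \int[pushforward P orbit_point]_x (G x)%:E)%E.
  apply: eq_measure_integral => [|mp B mB _]; [exact: measurable_orbit_point | exact: orbit_point_law].
rewrite (ge0_integral_pushforward measurable_orbit_point _ measurableT mGE).
  by rewrite preimage_setT.
by move=> x _; rewrite lee_fin.
Qed.

Lemma expect_orbit_point (g : L -> R) : bounded_measurable g ->
  expect mu g = expect muY (block_sum T tau' g) / tm.
Proof.
move=> bg; have [mg [B gB]] := bg.
have bgp : bounded_measurable (fun w => g (orbit_point w)).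
  split; last by exists B => w; exact: gB.
  exact: (measurableT_comp mg measurable_orbit_point).
transitivity (EP (fun w => g (orbit_point w))).
  rewrite /expect /Rintegral; congr fine.
  have mgE : measurable_fun setT (EFin \o g) by exact/measurable_EFinP.
  have -> : (\int[mu]_x (g x)%:E = \int[pushforward P orbit_point]_x (g x)%:E)%E.
    apply: eq_measure_integral => [|mp B' mB _]; [exact: measurable_orbit_point | exact: orbit_point_law].
  rewrite (integral_pushforward measurable_orbit_point mgE _ measurableT) ?preimage_setT//.
  exact: (bm_integrable P bgp).
rewrite (expect_tower mtau tau1 return_square (bm_dominated tau1 bgp)); congr (expect _ _ / _).
apply/funext => y; apply: eq_bigr => l _; rewrite /orbit_point /=.
by congr (g (iter _ _ _)); have := ltn_ord l; nat_lia.
Qed.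

Lemma Lnorm_orbit_point_le (G : L -> R) (H : L * nat -> R) (r X : R) : 1 <= r -> 0 <= X ->
  measurable_fun setT G -> (forall x, 0 <= G x) -> bounded_measurable H ->
  (forall w, G (orbit_point w) <= H w) -> EP (fun w => H w `^ r) <= X `^ r ->
  ('N[mu]_(r%:E) [EFin \o G] <= X%:E)%E.
Proof.
move=> r1 X0 mG G0 bH GH HX; have r0 : 0 < r by exact: lt_le_trans r1.
have bHr : bounded_measurable (fun w => H w `^ r) by apply: bm_powR => //; exact: ltW.
have mGr : measurable_fun setT (fun x => G x `^ r).
  exact: (measurableT_comp (measurable_powR _)).
have le : (\int[mu]_x (G x `^ r)%:E <= (X `^ r)%:E)%E.
  rewrite integral_orbit_point//; last by move=> x; exact: powR_ge0.
  apply: (@le_trans _ _ (EP (fun w => H w `^ r))%:E); last by rewrite lee_fin.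
  rewrite /expect /Rintegral fineK; last first.
    exact: (integrable_fin_num measurableT (bm_integrable P bHr)).
  apply: ge0_le_integral => //.
  - by move=> w _; rewrite lee_fin powR_ge0.
  - by apply/measurable_EFinP; apply: (measurableT_comp mGr); exact: measurable_orbit_point.
  - by apply/measurable_EFinP; case: bHr.
  - by move=> w _; rewrite lee_fin; apply: powR_le => //; exact: ltW.
rewrite unlock /Lnorm.
have -> : (X%:E = ((X `^ r)%:E `^ r^-1))%E.
  by rewrite poweR_EFin -powRrM divff ?gt_eqF// powRr1.
apply: gt0_ler_poweR.
- by rewrite invr_ge0 ltW.
- by rewrite in_itv/= leey andbT; apply: integral_ge0 => x _; rewrite lee_fin powR_ge0.
- by rewrite in_itv/= leey andbT lee_fin powR_ge0.
apply: le_trans le; rewrite le_eqVlt; apply/orP; left; apply/eqP.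
by apply: eq_integral => x _ /=; rewrite ger0_norm// poweR_EFin.
Qed.

(** * Vector-valued observables, reduced to their coordinates *)

Section VectorObservable.
Variables (d : nat) (v : L -> 'cV[R]_d) (h : R).
Hypotheses (h0 : 0 <= h) (hd : (1 <= d)%N).
Let vi i x := v x i ord0 / h.
Hypotheses (vE : forall i x, v x i ord0 = h * vi i x)
  (v_admissible : forall i, admissible (vi i)).
Variables (n : nat).
Hypothesis n1 : (1 <= n)%N.

Local Notation c1 := (first_const D C1 beta eta p t).
Local Notation c2 := (second_const D C1 beta eta p t).

Let mvi i : measurable_fun setT (vi i). Proof. by have [] := v_admissible i. Qed.

Let bu i : bounded_measurable (u (vi i)).
Proof. by have [? ? _ _] := v_admissible i; exact: observable_bm. Qed.

Let uE i k w : u (vi i) (iter k f w) = vi i (iter k T (orbit_point w)).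
Proof. by rewrite -orbit_point_iter. Qed.

Let S i w := 2 * h * sum_max f (u (vi i)) n w.

Let birkhoff_entry k x i : birkhoff_sum T v k x i ord0 = h * \sum_(j < k) vi i (iter j T x).
Proof. by rewrite summxE mulr_sumr; apply: eq_bigr => j _; rewrite vE. Qed.

Let iterated_entry k x a b : iterated_sum T v k x a b =
  h ^+ 2 * \sum_(j < k) (\sum_(i < j) vi a (iter i T x)) * vi b (iter j T x).
Proof.
rewrite summxE mulr_sumr; apply: eq_bigr => j _; rewrite summxE mulr_suml mulr_sumr.
apply: eq_bigr => i _; rewrite mxE big_ord1 mxE !vE; ring.
Qed.

Let N0 : 0 < n%:R :> R. Proof. by rewrite ltr0n. Qed.
Let d0 : 0 < d%:R :> R. Proof. by rewrite ltr0n. Qed.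

Let sum_max_ge0' i w : 0 <= sum_max f (u (vi i)) n w. Proof. exact: sum_max_ge0. Qed.

Let c1_ge0 : 0 <= c1.
Proof.
have := observable_first_moment (leqnn 1) (v_admissible (Ordinal hd)).
rewrite powR1 mulr1; apply: le_trans.
by apply: expect_ge0 => w; exact: powR_ge0.
Qed.

(** The Frobenius norm is bounded by the sum over coordinates, which costs the factor [d]; the 2
    comes from [ergodic_sum_le_max], and [1 + c1] from [power_bound]. *)
Lemma birkhoff_norm : ('N[mu]_((2 * (p - 1))%:E)
   [(fun x => (\big[Num.max/0]_(k < n.+1) frobenius (birkhoff_sum T v k x))%:E)]
   <= (2 * d%:R * (1 + c1) * Num.sqrt n%:R * h)%:E)%E.
Proof.
have q1' := q1; set r := 2 * (p - 1); have r1 : 1 <= r by rewrite /r; lra.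
have r0 : 0 <= r by lra.
apply: (Lnorm_orbit_point_le (G := fun x => \big[Num.max/0]_(k < n.+1)
  frobenius (birkhoff_sum T v k x)) (H := fun w => \sum_(i < d) S i w) r1).
- by rewrite !mulr_ge0 ?sqrtr_ge0 ?addr_ge0.
- apply: (@measurable_bigmax R _ L n.+1 (fun k x => frobenius (birkhoff_sum T v k x))) => k.
  apply: measurable_frobenius => i j.
  have -> : (fun x => birkhoff_sum T v k x i j) =
      (fun x => h * \sum_(j < k) vi i (iter j T x)); last first.
    apply: measurable_funM => //; apply: measurable_sum => l.
    by apply: (measurableT_comp (mvi i)); exact: measurable_iter.
  by apply/funext => x; rewrite (ord1 j) birkhoff_entry.
- move=> x; apply: (big_ind (fun y => 0 <= y)) => // [a b a0 b0|k _].
    by rewrite le_max a0.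
  exact: frobenius_ge0.
- by apply: bm_sum_ord => i; apply: bmZ; exact: bm_sum_max.
- move=> w; apply: bigmax_le => [|k _].
    by apply: sumr_ge0 => i _; rewrite !mulr_ge0.
  apply: (le_trans (frobenius_le _)); apply: ler_sum => i _; rewrite big_ord1 birkhoff_entry.
  rewrite normrM (ger0_norm h0) /S -mulrA mulrCA ler_wpM2l//.
  have kn : (k <= n)%N by rewrite -ltnS.
  apply: le_trans (ergodic_sum_le_max f (u (vi i)) w kn).
  rewrite le_eqVlt; apply/orP; left; apply/eqP; congr `|_|.
  by apply: eq_bigr => j _; rewrite uE.
apply: (le_trans (expect_power_sum (K := (2 * h) `^ r * (c1 * n%:R `^ (p - 1))) r1 _ _ _)).
- by move=> i; apply: bmZ; exact: bm_sum_max.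
- by move=> i w; rewrite !mulr_ge0.
- move=> i; under eq_fun do rewrite /S powRM ?mulr_ge0//.
  rewrite expectZ; last by apply: bm_powR => //; exact: bm_sum_max.
  by rewrite ler_wpM2l ?powR_ge0//; exact: observable_first_moment.
have -> : n%:R `^ (p - 1) = (Num.sqrt n%:R) `^ r :> R.
  by rewrite -powR12_sqrt// -powRrM /r mulKf.
rewrite mulrA -powRM ?mulr_ge0//.
apply: (le_trans (power_bound _ _ _ _)) => //; rewrite ?mulr_ge0 ?sqrtr_ge0//.
rewrite le_eqVlt; apply/orP; left; apply/eqP; congr powR; ring.
Qed.

Local Notation Imax a b := (iterated_max f (cost_n n) n (u (vi a)) (u (vi b))).

Let c2_ge0 : 0 <= c2.
Proof.
have := observable_second_moment (leqnn 1) (v_admissible (Ordinal hd)) (v_admissible (Ordinal hd)).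
rewrite powR1 mulr1; apply: le_trans.
by apply: expect_ge0 => w; exact: powR_ge0.
Qed.

Let bImax a b : bounded_measurable (Imax a b).
Proof. by apply: bm_iterated_max => //; exact: c0. Qed.

Let Imax_ge0 a b w : 0 <= Imax a b w.
Proof. by apply: iterated_max_ge0 => //; exact: c0. Qed.

Lemma iterated_norm : ('N[mu]_((p - 1)%:E)
   [(fun x => (\big[Num.max/0]_(k < n.+1) frobenius (iterated_sum T v k x))%:E)]
   <= (d%:R ^+ 2 * (1 + c2) * n%:R * h ^+ 2)%:E)%E.
Proof.
have q1' := q1; have q0 : 0 <= p - 1 by lra.
have h20 : 0 <= h ^+ 2 by rewrite exprn_ge0.
apply: (Lnorm_orbit_point_le (G := fun x => \big[Num.max/0]_(k < n.+1)
  frobenius (iterated_sum T v k x))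
  (H := fun w => \sum_(a < d) \sum_(b < d) h ^+ 2 * Imax a b w) q1).
- by rewrite !mulr_ge0 ?exprn_ge0 ?addr_ge0.
- apply: (@measurable_bigmax R _ L n.+1 (fun k x => frobenius (iterated_sum T v k x))) => k.
  apply: measurable_frobenius => a b.
  have mk i l : measurable_fun setT (fun x => vi i (iter l T x)).
    by apply: (measurableT_comp (mvi i)); exact: measurable_iter.
  have -> : (fun x => iterated_sum T v k x a b) = (fun x => h ^+ 2 *
      \sum_(j < k) (\sum_(i < j) vi a (iter i T x)) * vi b (iter j T x)).
    by apply/funext => x; rewrite iterated_entry.
  apply: measurable_funM => //; apply: measurable_sum => l.
  by apply: measurable_funM => //; exact: measurable_sum.
- move=> x; apply: (big_ind (fun y => 0 <= y)) => // [a b a0 b0|k _].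
    by rewrite le_max a0.
  exact: frobenius_ge0.
- by apply: bm_sum_ord => a; apply: bm_sum_ord => b; exact: bmZ.
- move=> w; apply: bigmax_le => [|k _].
    by apply: sumr_ge0 => a _; apply: sumr_ge0 => b _; rewrite mulr_ge0.
  apply: (le_trans (frobenius_le _)); apply: ler_sum => a _; apply: ler_sum => b _.
  rewrite iterated_entry normrM (ger0_norm h20) ler_wpM2l//.
  have kn : (k <= n)%N by rewrite -ltnS.
  apply: le_trans (iterated_le_max f (c0 n) n1 (u (vi a)) (u (vi b)) w kn).
  rewrite le_eqVlt; apply/orP; left; apply/eqP; congr `|_|.
  apply: eq_bigr => j _; rewrite uE; congr (_ * _).
  by apply: eq_bigr => i _; rewrite uE.
apply: (le_trans (expect_power_sum (K := d%:R `^ (p - 1) *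
  ((h ^+ 2) `^ (p - 1) * (c2 * n%:R `^ (p - 1)))) q1 _ _ _)).
- by move=> a; apply: bm_sum_ord => b; exact: bmZ.
- by move=> a w; apply: sumr_ge0 => b _; rewrite mulr_ge0.
- move=> a; apply: expect_power_sum => // [b|b w|b]; [exact: bmZ|by rewrite mulr_ge0|].
  under eq_fun do rewrite powRM//.
  rewrite expectZ; last exact: bm_powR.
  by rewrite ler_wpM2l ?powR_ge0//; exact: observable_second_moment.
rewrite 2!mulrA -!powRM ?mulr_ge0//.
apply: (le_trans (power_bound _ _ _ _)) => //; rewrite ?mulr_ge0//.
rewrite le_eqVlt; apply/orP; left; apply/eqP; congr powR; ring.
Qed.

End VectorObservable.
End Projection.
End SystemBound.

(** * Continuity of the constant *)

Section ContinuityAt.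
Context (R : realType) (X : topologicalType) (x : X).
Implicit Types g h : X -> R.

Local Notation cts g := (continuous_at x g).

Lemma continuous_atD g h : cts g -> cts h -> cts (fun z => g z + h z).
Proof. exact: cvgD. Qed.

Lemma continuous_atB g h : cts g -> cts h -> cts (fun z => g z - h z).
Proof. exact: cvgB. Qed.

Lemma continuous_atM g h : cts g -> cts h -> cts (fun z => g z * h z).
Proof. exact: cvgM. Qed.

Lemma continuous_atN g : cts g -> cts (fun z => - g z).
Proof. exact: cvgN. Qed.

Lemma continuous_atV g : g x != 0 -> cts g -> cts (fun z => (g z)^-1).
Proof. exact: cvgV. Qed.

Lemma continuous_at_cst (r : R) : cts (fun=> r).
Proof. exact: cvg_cst. Qed.

Lemma continuous_at_expR g : cts g -> cts (fun z => expR (g z)).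
Proof. by move=> cg; apply: (cvg_comp g expR cg); exact: continuous_expR. Qed.

(** The power is defined by cases at base 0; a positive base stays positive nearby, where the power
    is the exponential of a product with a logarithm. *)
Lemma continuous_at_powR g h : 0 < g x -> cts g -> cts h -> cts (fun z => g z `^ h z).
Proof.
move=> g0 cg ch.
have near0 : \forall z \near x, 0 < g z by exact: (cvgr_gt _ cg).
have e : \forall z \near x, expR (h z * ln (g z)) = g z `^ h z.
  by near=> z; rewrite /powR gt_eqF//; near: z.
rewrite /continuous_at -(nbhs_singleton e).
apply: cvg_trans (near_eq_cvg e) _.
apply: continuous_at_expR; apply: continuous_atM => //.
by apply: (cvg_comp g (@ln R) cg); exact: continuous_ln.
Unshelve. all: by end_near. Qed.

End ContinuityAt.

Section ConstantContinuity.
Context (R : realType) (z0 : R * R * R * R * R * R).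
Hypothesis z0_domain : @param_domain R z0.

Let D (z : R * R * R * R * R * R) := z.1.1.1.1.1.
Let C1 (z : R * R * R * R * R * R) := z.1.1.1.1.2.
Let beta (z : R * R * R * R * R * R) := z.1.1.1.2.
Let eta (z : R * R * R * R * R * R) := z.1.1.2.
Let p (z : R * R * R * R * R * R) := z.1.2.
Let t (z : R * R * R * R * R * R) := z.2.

Local Notation cts g := (continuous_at z0 g).

Let dom : [/\ 0 <= D z0, 1 <= C1 z0, 1 < beta z0, 0 < eta z0 <= 1 & 2 <= p z0 /\ 1 <= t z0].
Proof. by move: z0_domain; rewrite /D /C1 /beta /eta /p /t; case: z0 => [[[[[? ?] ?] ?] ?] ?]. Qed.

Let cfst (U V : topologicalType) (W : topologicalType) (g : W -> U * V) (w : W) :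
  continuous_at w g -> continuous_at w (fun z => (g z).1).
Proof. by move=> cg; apply: (cvg_comp g fst cg); exact: cvg_fst. Qed.

Let csnd (U V : topologicalType) (W : topologicalType) (g : W -> U * V) (w : W) :
  continuous_at w g -> continuous_at w (fun z => (g z).2).
Proof. by move=> cg; apply: (cvg_comp g snd cg); exact: cvg_snd. Qed.

Let cid : continuous_at z0 (fun z => z). Proof. exact: cvg_id. Qed.

Let cD : cts D. Proof. by do 5 apply: cfst. Qed.
Let cC1 : cts C1. Proof. by apply: csnd; do 4 apply: cfst. Qed.
Let cbeta : cts beta. Proof. by apply: csnd; do 3 apply: cfst. Qed.
Let ceta : cts eta. Proof. by apply: csnd; do 2 apply: cfst. Qed.
Let cp : cts p. Proof. by apply: csnd; do 1 apply: cfst. Qed.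
Let ct : cts t. Proof. by apply: csnd. Qed.

Let gam z := beta z `^ (- eta z).

Let cgam : cts gam.
Proof.
have [_ _ b1 _ _] := dom; apply: continuous_at_powR => //; last exact: continuous_atN.
exact: lt_trans b1.
Qed.

Let gam1 : 0 < 1 - gam z0.
Proof.
have [_ _ b1 /andP[e0 _] _] := dom; rewrite subr_gt0.
have b0 : 0 < beta z0 by exact: lt_trans b1.
rewrite /gam powRN invf_lt1 ?powR_gt0//.
by rewrite -(powRr0 (beta z0)) /powR gt_eqF// ltr_expR mul0r mulr_gt0// ln_gt0.
Qed.

Let cgamV : cts (fun z => (1 - gam z)^-1).
Proof.
apply: continuous_atV; first by rewrite gt_eqF.
by apply: continuous_atB => //; exact: continuous_at_cst.
Qed.

Let dist z := acip_distortion (beta z) (eta z) (C1 z).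

Let cdist : cts dist.
Proof.
apply: continuous_atM; first exact: continuous_at_cst.
apply: continuous_atD; last exact: continuous_at_cst.
exact: continuous_atM.
Qed.

Let dist0 : 0 <= dist z0.
Proof.
have [_ C11 _ _ _] := dom.
by rewrite mulr_ge0// addr_ge0// divr_ge0 ?(ltW gam1)// (le_trans _ C11).
Qed.

Let cpl z := coupling_const (beta z) (eta z) (C1 z) (dist z).

Let ccpl : cts cpl.
Proof.
apply: continuous_atM => //; apply: continuous_atM; first exact: continuous_at_cst.
exact: continuous_atD.
Qed.

Let c1D : cts (fun z => 1 + D z).
Proof. by apply: continuous_atD => //; exact: continuous_at_cst. Qed.

Let rate z := coupling_rate (eta z) (D z) (beta z) (cpl z).

Let crate : cts rate.
Proof.
apply: continuous_atM.
  apply: continuous_atM; last exact: continuous_at_cst.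
  by apply: continuous_atB => //; exact: continuous_at_cst.
by apply: continuous_at_expR; apply: continuous_atN; exact: continuous_atM.
Qed.

Let rate0 : 0 < rate z0.
Proof. by rewrite mulr_gt0 ?expR_gt0// mulr_gt0. Qed.

Let tp z := t z `^ p z.

Let ctp : cts tp.
Proof. by have [_ _ _ _ [_ t1]] := dom; apply: continuous_at_powR => //; exact: lt_le_trans t1. Qed.

Let tp0 : 0 < tp z0.
Proof. by have [_ _ _ _ [_ t1]] := dom; apply: powR_gt0; exact: lt_le_trans t1. Qed.

Let corr z := correlation_const (D z) (C1 z) (beta z) (eta z) (p z) (t z).

Let ccorr : cts corr.
Proof.
apply: continuous_atM.
  by apply: continuous_atM => //; exact: continuous_at_cst.
by apply: continuous_at_expR; exact: continuous_atM.
Qed.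

Let corr0 : 0 <= corr z0.
Proof. by rewrite !mulr_ge0 ?expR_ge0// ltW. Qed.

Let mix z := mixing_const (dist z) (D z).

Let cmix : cts mix.
Proof. by apply: continuous_at_expR; exact: continuous_atM. Qed.

Let mix0 : 0 <= mix z0. Proof. exact: expR_ge0. Qed.

Let kap z := cost_const (D z) (C1 z) (beta z) (eta z) (p z) (t z).

Let rateE z : 1 - correlation_rate (D z) (C1 z) (beta z) (eta z) = rate z.
Proof. by rewrite /correlation_rate /decay_rate opprB addrCA subrr addr0. Qed.

(** The denominator is rewritten as the coupling rate itself, whose continuity and positivity at the
    given parameters are established above. *)
Let kapE z : kap z = 2 + mix z * tp z + corr z / rate z * (1 + mix z * tp z).
Proof. by rewrite -rateE. Qed.

Let ckap : cts kap.
Proof.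
rewrite (funext kapE).
have cm : cts (fun z => mix z * tp z) by exact: continuous_atM.
apply: continuous_atD; first by apply: continuous_atD => //; exact: continuous_at_cst.
apply: continuous_atM.
  by apply: continuous_atM => //; apply: continuous_atV => //; rewrite gt_eqF.
by apply: continuous_atD => //; exact: continuous_at_cst.
Qed.

Let kap0 : 0 < kap z0.
Proof.
have h1 : 0 <= mix z0 * tp z0 by rewrite mulr_ge0// ltW.
have h2 : 0 <= corr z0 / rate z0 * (1 + mix z0 * tp z0).
  by rewrite mulr_ge0 ?addr_ge0// divr_ge0// ltW.
rewrite kapE; lra.
Qed.

Let q z := p z - 1.
Let r z := 2 * q z.

Let cq : cts q. Proof. by apply: continuous_atB => //; exact: continuous_at_cst. Qed.
Let cr : cts r. Proof. by apply: continuous_atM => //; exact: continuous_at_cst. Qed.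

Let q0 : 1 <= q z0.
Proof. by have [_ _ _ _ [p2 _]] := dom; rewrite /q; lra. Qed.

Let Kc z := cost_moment_const (D z) (C1 z) (beta z) (eta z) (p z) (t z).

Let cKc : cts Kc.
Proof. by apply: continuous_atM => //; exact: continuous_at_powR. Qed.

Let c4r : cts (fun z => 4 `^ r z).
Proof. by apply: continuous_at_powR => //; exact: continuous_at_cst. Qed.

Let pc z := pathwise_const (r z).

Let cpc : cts pc.
Proof.
apply: continuous_atM => //; apply: continuous_atD; last exact: continuous_at_cst.
apply: continuous_atM => //; apply: continuous_atM => //; exact: continuous_at_cst.
Qed.

Let pc0 : 0 < pc z0.
Proof.
have q0' := q0; have r0 : 0 < r z0 by rewrite /r; lra.
by rewrite mulr_gt0// addr_gt0// mulr_gt0// mulr_gt0// powR_gt0.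
Qed.

Let c84 : cts (fun z => 8 * 4 `^ r z).
Proof. by apply: continuous_atM => //; exact: continuous_at_cst. Qed.

Let c1 z := first_const (D z) (C1 z) (beta z) (eta z) (p z) (t z).

Let cc1 : cts c1.
Proof.
apply: continuous_atM; first exact: continuous_at_cst.
apply: continuous_atM.
  apply: continuous_at_powR => //; first by rewrite mulr_gt0.
  by apply: continuous_atM => //; exact: continuous_at_cst.
apply: continuous_atD => //; apply: continuous_at_powR => //.
Qed.

Let c2 z := second_const (D z) (C1 z) (beta z) (eta z) (p z) (t z).

Let cenv : cts (fun z => envelope_const (q z) (kap z) (Kc z)).
Proof.
apply: continuous_atM => //; apply: continuous_atD.
  apply: continuous_atD => //; apply: continuous_atD => //; exact: continuous_at_cst.
apply: continuous_atM => //; apply: continuous_atM; last exact: continuous_at_powR.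
by apply: continuous_atD => //; exact: continuous_at_cst.
Qed.

Let cdbl : cts (fun z => double_const (q z)).
Proof.
apply: continuous_atM; first exact: continuous_at_cst.
apply: continuous_atD; apply: continuous_at_powR => //.
- by rewrite mulr_gt0.
- by apply: continuous_atM => //; exact: continuous_at_cst.
- by apply: mulr_gt0; [exact: mulr_gt0 | rewrite addr_gt0// mulr_gt0// powR_gt0].
- apply: continuous_atM.
    by apply: continuous_atM => //; exact: continuous_at_cst.
  by apply: continuous_atD => //; exact: continuous_at_cst.
Qed.

Let cc2 : cts c2.
Proof.
apply: continuous_atM.
  by apply: continuous_at_powR => //; exact: continuous_at_cst.
apply: continuous_atD.
  by apply: continuous_atD => //; exact: continuous_atM.
by apply: continuous_atM => //; exact: continuous_at_cst.
Qed.

Let Kc0 : 0 <= Kc z0. Proof. by rewrite mulr_ge0 ?powR_ge0. Qed.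

Let c10 : 0 <= c1 z0.
Proof. by rewrite !mulr_ge0 ?addr_ge0 ?powR_ge0. Qed.

Let c20 : 0 <= c2 z0.
Proof.
have q0' := q0; have r0 : 0 <= 1 + r z0 by rewrite /r; lra.
have e0 : 0 <= envelope_const (q z0) (kap z0) (Kc z0).
  apply: mulr_ge0; first exact: powR_ge0.
  apply: addr_ge0; last by do 2 (apply: mulr_ge0 => //); exact: powR_ge0.
  by apply: addr_ge0 => //; apply: addr_ge0.
have d0 : 0 <= double_const (q z0) by rewrite mulr_ge0 ?addr_ge0 ?powR_ge0.
by rewrite mulr_ge0 ?powR_ge0// !addr_ge0// mulr_ge0.
Qed.

Variable d : nat.

(** The sum of the constants of the two inequalities serves for both, each summand being nonnegative
    on the parameter domain. *)
Definition moment_bound (z : R * R * R * R * R * R) : R :=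
  2 * d%:R * (1 + c1 z) + d%:R ^+ 2 * (1 + c2 z).

Lemma moment_bound_continuous : continuous_at z0 moment_bound.
Proof.
apply: continuous_atD; apply: continuous_atM; try exact: continuous_at_cst.
  by apply: continuous_atD => //; exact: continuous_at_cst.
by apply: continuous_atD => //; exact: continuous_at_cst.
Qed.

Lemma moment_bound_parts :
  0 <= 2 * d%:R * (1 + c1 z0) /\ 0 <= d%:R ^+ 2 * (1 + c2 z0).
Proof. by rewrite !mulr_ge0 ?exprn_ge0 ?addr_ge0. Qed.

Lemma moment_bound_gt0 : (1 <= d)%N -> 0 < moment_bound z0.
Proof.
move=> d1; have [_ h] := moment_bound_parts.
by rewrite ltr_pwDl// !mulr_gt0 ?ltr0n// ltr_pwDl.
Qed.

End ConstantContinuity.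

(** * The norm of the return time as a parameter *)

Section ReturnTimeNorm.
Context (disp : measure_display) (R : realType) (L : borelMetricType disp R).
Variables (rho : {finite_measure set L -> \bar R}) (T : L -> L) (Y : set L)
  (alpha : set (set L)) (tau : L -> nat) (beta eta C1 p : R) (muY : probability L R).
Hypotheses (nue : nonuniformly_expanding rho T Y alpha tau beta eta C1)
  (acip : is_acip rho Y (induced_map T tau) muY) (p2 : 2 <= p)
  (Nfin : (return_time_norm Y tau muY p < +oo)%E)
  (mtau : measurable_fun setT (total_return Y tau)).

Let t := fine (return_time_norm Y tau muY p).
Let p0 : p != 0. Proof. by rewrite gt_eqF// (lt_le_trans _ p2). Qed.

Let mY := nue_measurable_base nue.

Lemma return_time_norm_power :
  (\int[muY]_y ((total_return Y tau y)%:R `^ p)%:E = (t `^ p)%:E)%E.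
Proof.
have NE : return_time_norm Y tau muY p = t%:E.
  by rewrite fineK// ge0_fin_numE//; exact: Lnorm_ge0.
rewrite -poweR_EFin -NE /return_time_norm poweR_Lnorm//.
have mnY : measurable (~` Y) by exact: measurableC.
have Y0 : muY (~` Y) = 0%E by exact: acip_complement nue acip.
have mp : measurable_fun setT (fun y => ((total_return Y tau y)%:R `^ p)%:E : \bar R).
  apply/measurable_EFinP.
  apply: (measurable_nat_family (g := fun k _ => k%:R `^ p : R) mtau) => k.
  exact: measurable_cst.
have e y : (`|((fun y => (tau y)%:R%:E) \_ Y) y| `^ p)%E =
    (((total_return Y tau y)%:R `^ p * \1_Y y)%:E : \bar R).
  rewrite /patch indicE; case: ifPn => Yy; rewrite /total_return ?Yy ?(negPf Yy).
    by rewrite abse_EFin normr_nat poweR_EFin mulr1.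
  by rewrite abse0 mulr0 poweR_EFin powR0.
transitivity (\int[muY]_y ((total_return Y tau y)%:R `^ p * \1_Y y)%:E)%E; last first.
  by apply: eq_integral => y _; rewrite -e.
apply: ge0_ae_eq_integral => //.
- apply/measurable_EFinP; apply: measurable_funM; last exact: measurable_indic.
  exact/measurable_EFinP.
- exists (~` Y); split => // y /=; apply: contra_notP => /contrapT Yy _.
  by rewrite indicE mem_set// mulr1.
Qed.

(** Return times are at least 1 and [muY] is a probability. This places the parameters in
    [param_domain], where powers of [t] are continuous because [t] is positive. *)
Lemma return_time_norm_ge1 : 1 <= t.
Proof.
have t0 : 0 <= t by apply: fine_ge0; exact: Lnorm_ge0.
rewrite leNgt; apply/negP => t1.
have : (1%:E <= (t `^ p)%:E :> \bar R)%E.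
  rewrite -return_time_norm_power -(@probability_setT _ _ _ muY) -[X in (X <= _)%E]mul1e.
  rewrite -integral_cst//; apply: ge0_le_integral => //.
  - apply/measurable_EFinP.
    apply: (measurable_nat_family (g := fun k _ => k%:R `^ p : R) mtau) => k.
    exact: measurable_cst.
  - move=> y _; rewrite lee_fin; apply: (@le_trans _ _ (1 `^ p)); first by rewrite powR1.
    apply: powR_le => //.
      by rewrite (le_trans _ p2).
    by rewrite ler1n; exact: (total_return_ge1 nue).
rewrite lee_fin leNgt => /negP; apply.
have p1 : 1 <= p by rewrite (le_trans _ p2)// ler1n.
have [->|tn] := eqVneq t 0; first by rewrite powR0.
apply: (le_lt_trans _ t1); rewrite -[leRHS]powRr1//; apply: ger_powR p1.
by rewrite lt_neqAle eq_sym tn t0 ltW.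
Qed.

End ReturnTimeNorm.

(** * Normalization of Hoelder observables *)

Section HolderObservables.
Context (disp : measure_display) (R : realType) (L : borelMetricType disp R) (d : nat).
Variables (eta : R) (v : L -> 'cV[R]_d).
Hypotheses (eta0 : 0 < eta) (vfin : (holder_norm eta v < +oo)%E).

Let h := fine (holder_norm eta v).

Let sup0 : (0 <= sup_norm v)%E.
Proof.
apply: (@le_trans _ _ (frobenius (v point))%:E); first by rewrite lee_fin frobenius_ge0.
by apply: ereal_sup_ubound; exists point.
Qed.

Let semi0 : (0 <= holder_seminorm eta v)%E.
Proof. by rewrite /holder_seminorm le_max lexx. Qed.

Lemma holder_normE : holder_norm eta v = h%:E.
Proof. by rewrite fineK// ge0_fin_numE// adde_ge0. Qed.

Lemma holder_norm_fine_ge0 : 0 <= h.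
Proof. by apply: fine_ge0; exact: adde_ge0. Qed.

Lemma holder_norm_sup i x : `|v x i ord0| <= h.
Proof.
rewrite -lee_fin -holder_normE.
apply: (@le_trans _ _ (frobenius (v x))%:E); first by rewrite lee_fin le_frobenius.
apply: (@le_trans _ _ (sup_norm v)); last exact: leeDl.
by apply: ereal_sup_ubound; exists x.
Qed.

Lemma holder_norm_diff i x y : `|v x i ord0 - v y i ord0| <= h * mdist x y `^ eta.
Proof.
have [->|xy] := eqVneq x y.
  by rewrite subrr normr0 mulr_ge0 ?powR_ge0//; exact: holder_norm_fine_ge0.
have dp : 0 < mdist x y `^ eta.
  by rewrite powR_gt0// lt_neqAle mdist_ge0 andbT eq_sym; apply: contra xy => /eqP/mdist_positivity ->.
rewrite -ler_pdivrMr// -lee_fin -holder_normE.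
apply: (@le_trans _ _ (frobenius (v x - v y) / mdist x y `^ eta)%:E).
  rewrite lee_fin ler_pM2r ?invr_gt0//.
  by have := le_frobenius (v x - v y) i ord0; rewrite !mxE.
apply: (@le_trans _ _ (holder_seminorm eta v)); last exact: leeDr.
rewrite /holder_seminorm le_max; apply/orP; right.
by apply: ereal_sup_ubound; exists x, y.
Qed.

(** If the norm is 0 then [v] vanishes, and division by 0 giving 0 keeps the identity true; no
    separate treatment of the zero observable is needed afterwards. *)
Lemma normalized_holder i x : v x i ord0 = h * (v x i ord0 / h).
Proof.
have [h0|hn] := eqVneq h 0; last by rewrite mulrC divfK.
have := holder_norm_sup i x; rewrite h0 normr_le0 => /eqP ->.
by rewrite mul0r.
Qed.

Lemma normalized_le1 i x : `|v x i ord0 / h| <= 1.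
Proof.
have [h0|hn] := eqVneq h 0; first by rewrite h0 invr0 mulr0 normr0.
have hp : 0 < h by rewrite lt_neqAle eq_sym hn holder_norm_fine_ge0.
by rewrite normrM normfV (gtr0_norm hp) ler_pdivrMr// mul1r holder_norm_sup.
Qed.

Lemma normalized_diff i x y : `|v x i ord0 / h - v y i ord0 / h| <= mdist x y `^ eta.
Proof.
have [h0|hn] := eqVneq h 0.
  by rewrite h0 invr0 !mulr0 subrr normr0 powR_ge0.
have hp : 0 < h by rewrite lt_neqAle eq_sym hn holder_norm_fine_ge0.
by rewrite -mulrBl normrM normfV (gtr0_norm hp) ler_pdivrMr// mulrC holder_norm_diff.
Qed.

Lemma holder_measurable (g : L -> R) :
  (forall x y, `|g x - g y| <= mdist x y `^ eta) -> measurable_fun setT g.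
Proof.
move=> gh; apply: semicontinuous_measurable => x e e0.
exists (e `^ eta^-1); first exact: powR_gt0.
move=> y xy; have lt : mdist x y `^ eta < e.
  rewrite -[ltRHS](powRr1 (ltW e0)) -(mulVf (lt0r_neq0 eta0)) powRrM.
  by apply: gt0_ltr_powR; rewrite ?nnegrE ?mdist_ge0 ?powR_ge0.
have := le_lt_trans (gh x y) lt; rewrite ltr_norml => /andP[_]; lra.
Qed.

End HolderObservables.

Theorem theorem2p4 (R : realType) (d : nat) (hd : (1 <= d)%N) :
  exists C : R * R * R * R * R * R -> R,
    {within @param_domain R, continuous C} /\
    (forall z, @param_domain R z -> 0 < C z) /\
    forall (disp : measure_display) (L : borelMetricType disp R)
      (rho : {finite_measure set L -> \bar R}) (T : L -> L) (Y : set L)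
      (alpha : set (set L)) (tau : L -> nat) (beta eta C1 p : R)
      (muY mu : probability L R),
      nonuniformly_expanding rho T Y alpha tau beta eta C1 ->
      is_acip rho Y (induced_map T tau) muY ->
      2 <= p ->
      (return_time_norm Y tau muY p < +oo)%E ->
      (forall A : set L, measurable A ->
         mu A = pushforward (tower_measure Y tau muY) (tower_proj T) A) ->
      let K : R := C (diameter L, C1, beta, eta, p,
                      fine (return_time_norm Y tau muY p)) in
      forall v : L -> 'cV[R]_d,
        (holder_norm eta v < +oo)%E ->
        (forall i : 'I_d, (\int[mu]_x (v x i ord0)%:E = 0)%E) ->
        forall n : nat, (1 <= n)%N ->
          ('N[mu]_((2 * (p - 1))%:E)
             [(fun x => (\big[Num.max/0]_(k < n.+1)
                          frobenius (birkhoff_sum T v k x))%:E)]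
           <= (K * Num.sqrt n%:R)%:E * holder_norm eta v)%E /\
          ('N[mu]_((p - 1)%:E)
             [(fun x => (\big[Num.max/0]_(k < n.+1)
                          frobenius (iterated_sum T v k x))%:E)]
           <= (K * n%:R)%:E * holder_norm eta v ^+ 2)%E.
Proof.
exists (@moment_bound R d); split.
  apply: continuous_in_subspaceT => z /set_mem zd.
  exact: (@moment_bound_continuous _ _ zd d).
split; first by move=> z zd; exact: moment_bound_gt0.
move=> disp L rho T Y alpha tau beta eta C1 p muY mu nue acip p2 Nfin muE K v vfin v0 n n1.
have [A [mA tA coverA A0 AS]] := countable_partition_enum (nue_countable nue)
  (nue_partition nue) (nue_measurable_partition nue) (nue_measurable_base nue).
pose t := fine (return_time_norm Y tau muY p).
have mtau := measurable_total_return nue mA coverA A0 AS.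
have tp := return_time_norm_power nue acip p2 Nfin mtau.
have t1 := return_time_norm_ge1 nue acip p2 Nfin mtau.
have tple : (\int[muY]_y ((total_return Y tau y)%:R `^ p)%:E <= (t `^ p)%:E)%E by rewrite tp.
have /andP[eta0 eta1] := nue_eta nue.
have zd : @param_domain R (diameter L, C1, beta, eta, p, t).
  split => //; [exact: (diameter_ge0 nue) | exact: (nue_C1 nue) | exact: (nue_beta nue)
    | exact: (nue_eta nue)].
have [part1 part2] := moment_bound_parts zd d.
set h := fine (holder_norm eta v).
have h0 : 0 <= h by exact: holder_norm_fine_ge0.
have mv i : measurable_fun setT (fun x => v x i ord0 / h).
  by apply: (holder_measurable eta0) => x y; exact: normalized_diff.
have bv i : bounded_measurable (fun x => v x i ord0 / h).
  by split => //; exists 1 => x; exact: normalized_le1.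
have mean0 i : expect mu (fun x => v x i ord0 / h) = 0.
  have bvi : bounded_measurable (fun x => v x i ord0).
    apply: (bm_ext (g := fun x => h * (v x i ord0 / h))); last exact: bmZ.
    by move=> x; rewrite -normalized_holder.
  rewrite /expect RintegralZr//; last exact: (bm_integrable mu bvi).
  by rewrite /Rintegral v0 mul0r.
have adm i : admissible T Y tau eta muY (fun x => v x i ord0 / h).
  split => //; [exact: normalized_le1 | exact: normalized_diff |].
  (* The mean under [mu] is the mean of the block sums divided by the mean return time; the latter
     is at least 1, so a zero mean passes to the block sums. *)
  have := expect_orbit_point nue acip mA coverA A0 AS p2 tple muE (bv i).
  rewrite mean0 => /esym/eqP; rewrite mulf_eq0 invr_eq0 => /orP[/eqP//|/eqP tm].
  have := tau_mean_ge1 mtau (total_return_ge1 nue)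
    (return_square nue mA coverA A0 AS p2 tple).
  by rewrite tm ler10.
have vE i x : v x i ord0 = h * (v x i ord0 / h) by exact: normalized_holder.
have n0 : 0 <= n%:R :> R by [].
split.
- apply: le_trans (birkhoff_norm nue acip mA tA coverA A0 AS p2 tple muE h0 hd vE adm n1) _.
  rewrite holder_normE// -EFinM lee_fin -/h ler_wpM2r// ler_wpM2r ?sqrtr_ge0//.
  by rewrite /K /moment_bound lerDl.
- apply: le_trans (iterated_norm nue acip mA tA coverA A0 AS p2 tple muE h0 hd vE adm n1) _.
  rewrite holder_normE// -EFin_expe -EFinM lee_fin -/h ler_wpM2r ?exprn_ge0// ler_wpM2r//.
  by rewrite /K /moment_bound lerDr.
Qed.
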